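(* Let $k\geq 1$ be an integer, $\sigma>0$, $\sigma'\ge0$, let $b:\mathbb{T}^k\to\mathbb{R}^k$ be smooth, let $H:\mathbb{T}^d\times\mathbb{R}^d\to\mathbb{R}$ be $\mathcal{C}^1$ and convex in its second argument, and let $f,U_0:\mathbb{T}^d\times\mathcal{P}(\mathbb{T}^d)\times\mathbb{T}^k\to\mathbb{R}$ be continuous and such that for every $p\in\mathbb{T}^k$, $f(\cdot,\cdot,p)$ and $U_0(\cdot,\cdot,p)$ are monotone, i.e. for $g\in\{f,U_0\}$, $\langle g(\cdot,\mu,p)-g(\cdot,\nu,p),\mu-\nu\rangle\ge0$ for all $\mu,\nu\in\mathcal{P}(\mathbb{T}^d)$. If $U$ and $V$ are two monotone solutions of the master equation (MECP), then there is a function $c:[0,\infty)\times\mathcal{P}(\mathbb{T}^d)\times\mathbb{T}^k\to\mathbb{R}$ such that $U(t,x,m,p)=V(t,x,m,p)+c(t,m,p)$ for all $(t,x,m,p)$. Moreover, if a monotone solution $U$ exists, then for any $t\ge0$, $p\in\mathbb{T}^k$, $U(t,\cdot,\cdot,p)$ is monotone: $\langle U(t,\cdot,\mu,p)-U(t,\cdot,\nu,p),\mu-\nu\rangle\ge0$ for all $\mu,\nu\in\mathcal{P}(\mathbb{T}^d)$.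
   Context: Notation. $d$ is an integer greater than $1$; $\mathbb{T}^d,\mathbb{T}^k$ are tori; $\mathcal{M}(\mathbb{T}^d)$ is the set of (finite signed) measures; $\mathcal{P}(\mathbb{T}^d)$ is the set of probability measures with the 1-Wasserstein distance. $\langle g,\mu\rangle=\int g\,d\mu$, $\langle g,\mathrm{div}(\beta m)\rangle=-\int\nabla g\cdot \beta\,dm$, $\langle g,\Delta m\rangle=\int\Delta g\,dm$ (derivatives in $x$). $D_pH$ is the gradient of $H$ in its second argument (not related to the parameter $p\in\mathbb{T}^k$). $\mathcal{B}'_t$ is the space of globally continuous $U:[0,\infty)\times\mathbb{T}^d\times\mathcal{P}(\mathbb{T}^d)\times\mathbb{T}^k\to\mathbb{R}$ with $\sup_{m,\,t\in[0,T]}\|U(t,\cdot,m,\cdot)\|_2<\infty$ for all $T>0$, where $\|\cdot\|_2$ is the $\mathcal{C}^2(\mathbb{T}^d\times\mathbb{T}^k)$ norm. Master equation (MECP), on $(0,\infty)\times\mathbb{T}^d\times\mathcal{P}(\mathbb{T}^d)\times\mathbb{T}^k$: $$\partial_tU-\sigma\Delta_xU+H(x,\nabla_xU)-\sigma'\Delta_pU-b\cdot\nabla_pU-\sigma\Big\langle\tfrac{\delta U}{\delta m}(x,m,p,\cdot),\Delta m\Big\rangle-\Big\langle\tfrac{\delta U}{\delta m}(x,m,p,\cdot),\mathrm{div}\big(D_pH(\cdot,\nabla_xU(\cdot,m,p))m\big)\Big\rangle=f(x,m,p),$$ with $U(0,x,m,p)=U_0(x,m,p)$. Monotone solution of (MECP):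 $U\in\mathcal{B}'_t$ with $U(0,\cdot,\cdot,\cdot)=U_0$ such that for any $\mathcal{C}^2$ function $\phi:\mathbb{T}^d\times\mathbb{T}^k\to\mathbb{R}$, any $\nu\in\mathcal{M}(\mathbb{T}^d)$, any smooth $\vartheta:[0,\infty)\to\mathbb{R}$, any $T>0$ and any point $(t_0,m_0,p_0)\in(0,T]\times\mathcal{P}(\mathbb{T}^d)\times\mathbb{T}^k$ of strict minimum of $(t,m,p)\mapsto\langle U(t,\cdot,m,p)-\phi(\cdot,p),m-\nu\rangle-\vartheta(t)$ on $[0,T]\times\mathcal{P}(\mathbb{T}^d)\times\mathbb{T}^k$ (strictly smaller than at any other point), $$\frac{d\vartheta}{dt}(t_0)+\langle-\sigma\Delta_xU-b\cdot\nabla_pU-\sigma'\Delta_pU+H(\cdot,\nabla_xU),m_0-\nu\rangle\ge\langle f(\cdot,m_0,p_0),m_0-\nu\rangle-\langle U-\phi,\mathrm{div}(D_pH(\cdot,\nabla_xU)m_0)\rangle-\sigma\langle\Delta_x(U-\phi),m_0\rangle,$$ where $U$ and its derivatives are evaluated at $(t_0,\cdot,m_0,p_0)$, $b$ at $p_0$, and $\phi$ at $(\cdot,p_0)$. *)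

(* Defs.v *)
From HB Require Import structures.
From mathcomp Require Import all_boot all_order all_algebra.
From mathcomp Require Import all_classical all_reals all_analysis.

Set Implicit Arguments.
Unset Strict Implicit.
Unset Printing Implicit Defensive.

Import Order.TTheory GRing.Theory Num.Theory.
Import numFieldNormedType.Exports.

Local Open Scope classical_set_scope.
Local Open Scope ring_scope.
Local Open Scope quotient_scope.

Section Torus.
Context (R : realType) (n : nat).

Definition zn_equiv (x y : 'rV[R]_n) : bool :=
  [forall i, x 0 i - y 0 i \is a Num.int].

Lemma zn_equiv_refl : reflexive zn_equiv.
Proof. by move=> x; apply/forallP => i; rewrite subrr rpred0. Qed.

Lemma zn_equiv_sym : symmetric zn_equiv.
Proof. by move=> x y; apply: eq_forallb => i; rewrite -opprB rpredN. Qed.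

Lemma zn_equiv_trans : transitive zn_equiv.
Proof.
move=> y x z /forallP xy /forallP yz; apply/forallP => i.
by rewrite -(subrK (y 0 i) (x 0 i)) -addrA rpredD.
Qed.

Canonical zn_equiv_rel :=
  EquivRel zn_equiv zn_equiv_refl zn_equiv_sym zn_equiv_trans.

Definition torus : Type := quotient_topology {eq_quot zn_equiv_rel}.

HB.instance Definition _ := Quotient.on torus.
HB.instance Definition _ := PointedTopological.on torus.
HB.instance Definition _ :=
  Measurable.copy torus (g_sigma_algebraType (@open torus)).

(* The library norm [`|x|] on ['rV[R]_n] is the sup norm, hence the explicit
   Euclidean distance, which is minimized over the representatives. *)
Definition tdist (x y : torus) : R :=
  inf [set Num.sqrt (\sum_(i < n) (z.1 0 i - z.2 0 i) ^+ 2)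
      | z in [set z : 'rV[R]_n * 'rV[R]_n |
               \pi_torus z.1 = x /\ \pi_torus z.2 = y]].

End Torus.

Section Measures.
Context (R : realType) (n : nat).
Local Notation T := (torus R n).

Definition pmeas := probability T R.

(* A term of [probability T R] is a function on all subsets of T, whose values
   on non-Borel sets carry no information: Leibniz equality is too fine to
   mean equality of measures. *)
Definition pmeas_eq (mu nu : pmeas) : Prop :=
  forall A : set T, measurable A -> mu A = nu A.

Definition smeas := {charge set T -> \bar R}.

Definition is_coupling (mu nu : pmeas) (pi : probability (T * T)%type R) : Prop :=
  forall A : set T, measurable A ->
    pi (A `*` setT) = mu A /\ pi (setT `*` A) = nu A.

Definition W1 (mu nu : pmeas) : R :=
  inf [set \int[pi]_z tdist z.1 z.2
      | pi in [set pi : probability (T * T)%type R | is_coupling mu nu pi]].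

Definition pair_p (g : T -> R) (mu : pmeas) : R := \int[mu]_x g x.

(* Integral against a signed measure, through its Jordan decomposition; the
   value does not depend on the Hahn decomposition that is picked. *)
Definition pair_s (g : T -> R) (nu : smeas) : R :=
  let P := cid (Hahn_decomposition nu) in
  let N := cid (projT2 P) in
  \int[jordan_pos (projT2 N)]_x g x - \int[jordan_neg (projT2 N)]_x g x.

Definition monotone_fun (g : T -> pmeas -> R) : Prop :=
  forall mu nu : pmeas,
    0 <= pair_p (fun x => g x mu - g x nu) mu
         - pair_p (fun x => g x mu - g x nu) nu.

End Measures.

Section Derivatives.
Context (R : realType).

(* [Cn n F]: all iterated directional derivatives of F up to order n exist and
   are continuous.  On a finite-dimensional V, the only case in use, this is
   the class C^n. *)
Fixpoint Cn (V : normedModType R) (n : nat) (F : V -> R) : Prop :=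
  continuous F /\
  match n with
  | 0%N => True
  | n'.+1 => forall v : V, (forall z, derivable F z v) /\ Cn n' ('D_v F)
  end.

Definition smooth (V : normedModType R) (F : V -> R) : Prop :=
  forall n, Cn n F.

Section OneTorus.
Context (n : nat).
Local Notation T := (torus R n).

(* A function on the torus is differentiated through its periodic lift to R^n;
   the result does not depend on the representative. *)
Definition partial (i : 'I_n) (g : T -> R) (x : T) : R :=
  'D_(delta_mx 0 i) (g \o \pi_T) (repr x).

Definition grad (g : T -> R) (x : T) : 'rV[R]_n := \row_i partial i g x.

Definition lap (g : T -> R) (x : T) : R :=
  \sum_(i < n) partial i (partial i g) x.

Definition dotv (u v : 'rV[R]_n) : R := \sum_(i < n) u 0 i * v 0 i.

(* <g, div (beta m)> *)
Definition pair_div (g : T -> R) (beta : T -> 'rV[R]_n) (m : pmeas R n) : R :=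
  - pair_p (fun x => dotv (grad g x) (beta x)) m.

Definition DpH (H : T -> 'rV[R]_n -> R) (x : T) (q : 'rV[R]_n) : 'rV[R]_n :=
  \row_i 'D_(delta_mx 0 i) (H x) q.

Definition C1_hamiltonian (H : T -> 'rV[R]_n -> R) : Prop :=
  Cn 1 (fun z : 'rV[R]_n * 'rV[R]_n => H (\pi_T z.1) z.2).

Definition smooth_field (b : T -> 'rV[R]_n) : Prop :=
  forall j, smooth (fun y : 'rV[R]_n => b (\pi_T y) 0 j).

End OneTorus.

Section TwoTori.
Context (d k : nat).

Definition lift2 (g : torus R d -> torus R k -> R) (z : 'rV[R]_d * 'rV[R]_k) : R :=
  g (\pi_(torus R d) z.1) (\pi_(torus R k) z.2).

Definition C2 (g : torus R d -> torus R k -> R) : Prop := Cn 2 (lift2 g).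

Definition basis_dir (a : 'I_d + 'I_k) : 'rV[R]_d * 'rV[R]_k :=
  match a with
  | inl i => (delta_mx 0 i, 0)
  | inr j => (0, delta_mx 0 j)
  end.

(* C^2 norm: the supremum of the absolute values of all the partial
   derivatives of order at most 2. *)
Definition C2norm (g : torus R d -> torus R k -> R) : \bar R :=
  ereal_sup
    ([set `|lift2 g z|%:E | z in setT]
     `|` [set e | exists a z, e = `|'D_(basis_dir a) (lift2 g) z|%:E]
     `|` [set e | exists a a' z,
            e = `|'D_(basis_dir a) ('D_(basis_dir a') (lift2 g)) z|%:E]).

End TwoTori.
End Derivatives.

Section Master.
Context (R : realType) (d k : nat).
Local Notation Td := (torus R d).
Local Notation Tk := (torus R k).
Local Notation P := (pmeas R d).

Definition continuous_xmp (g : Td -> P -> Tk -> R) : Prop :=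
  forall x m p (eps : R), 0 < eps -> exists2 delta : R, 0 < delta &
    forall x' m' p', tdist x x' < delta -> W1 m m' < delta ->
      tdist p p' < delta -> `|g x m p - g x' m' p'| < eps.

(* Functions of t in [0, +oo[ are functions on R whose values at negative
   times are irrelevant. *)
Definition continuous_txmp (U : R -> Td -> P -> Tk -> R) : Prop :=
  forall t x m p (eps : R), 0 <= t -> 0 < eps -> exists2 delta : R, 0 < delta &
    forall t' x' m' p', 0 <= t' -> `|t - t'| < delta -> tdist x x' < delta ->
      W1 m m' < delta -> tdist p p' < delta ->
      `|U t x m p - U t' x' m' p'| < eps.

Definition space_B't (U : R -> Td -> P -> Tk -> R) : Prop :=
  [/\ continuous_txmp U,
      forall t m, 0 <= t -> C2 (fun x p => U t x m p)
    & forall T : R, 0 < T ->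
        (ereal_sup [set C2norm (fun x p => U tm.1 x tm.2 p)
                   | tm in [set tm : R * P | (0 <= tm.1 <= T)%R]] < +oo)%E].

Definition strict_min_point (T : R) (Phi : R -> P -> Tk -> R)
    (t0 : R) (m0 : P) (p0 : Tk) : Prop :=
  forall t m p, 0 <= t <= T -> ~ [/\ t = t0, pmeas_eq m m0 & p = p0] ->
    Phi t0 m0 p0 < Phi t m p.

(* A smooth function on [0, +oo[ is the restriction of a smooth function on R,
   which is what theta is. *)
Definition monotone_solution (sigma sigma' : R) (b : Tk -> 'rV[R]_k)
    (H : Td -> 'rV[R]_d -> R) (f U0 : Td -> P -> Tk -> R)
    (U : R -> Td -> P -> Tk -> R) : Prop :=
  [/\ space_B't U,
      forall x m p, U 0 x m p = U0 x m p
    & forall (phi : Td -> Tk -> R) (nu : smeas R d) (theta : R -> R) (T : R)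
        (t0 : R) (m0 : P) (p0 : Tk),
        C2 phi -> smooth (theta : R^o -> R) -> 0 < T -> 0 < t0 <= T ->
        strict_min_point T
          (fun t m p => pair_p (fun x => U t x m p - phi x p) m
                        - pair_s (fun x => U t x m p - phi x p) nu - theta t)
          t0 m0 p0 ->
        let u := fun x => U t0 x m0 p0 in
        let v := fun x p => U t0 x m0 p in
        let w := fun x => u x - phi x p0 in
        let L := fun x =>
          - sigma * lap u x - dotv (b p0) (grad (v x) p0)
          - sigma' * lap (v x) p0 + H x (grad u x) in
        let F := fun x => f x m0 p0 in
        derive1 theta t0 + (pair_p L m0 - pair_s L nu)
        >= (pair_p F m0 - pair_s F nu)
           - pair_div w (fun x => DpH H x (grad u x)) m0
           - sigma * pair_p (lap w) m0].

End Master.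

(* Main.v *)
(** Only time is doubled.  If [<U(t,.,mu,p) - V(t,.,nu,p), mu - nu>] takes a
    negative value, then so does the minimum over (t,s,mu,nu,p) of
    [<U(t,.,mu,p) - V(s,.,nu,p), mu - nu> + K (t - s)^2 + gam (t + s)
    + <A(.,p), mu> + <B(.,p), nu>] for K large and for gam, A and B small, and
    it is not reached at t = 0 or s = 0, because U0 is monotone.  The functions
    A and B are sums of a summable series of smooth test functions that separate
    the triples (mu,nu,p) with mu <> nu; its coefficients are chosen by a
    variational principle so that all minimizers have the same (mu,nu,p), and
    A + B does not depend on p.  After adding (t - t0)^2 + (s - s0)^2 the minimum
    is strict in each group of variables: U is tested with [V(s0,.,nu0,.) - A]
    against nu0, and V with [U(t0,.,mu0,.) - B] against mu0.  In the sum of the two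
    inequalities the sigma-terms cancel, convexity of H absorbs the transport
    terms, and the optimality conditions in p absorb the terms in b and sigma',
    up to O(A + B): this contradicts gam > 0.

    Minima exist since the probability measures are sequentially compact: the
    torus is the image of a continuous curve, so each measure is the law of a
    nondecreasing quantile function followed by the curve, and Helly's selection
    theorem applies to the quantiles.

    Hence the bracket is nonnegative.  With nu = (1 - h) mu + h lam and h -> 0 it
    gives [<U - V, mu - lam> >= 0] at (t,.,mu,p), and equality by exchanging U and V;
    lam = dirac x shows that U - V does not depend on x. *)
Require Import Defs.
From HB Require Import structures.
From mathcomp Require Import all_boot all_order all_algebra.
From mathcomp Require Import all_classical all_reals all_analysis.
From mathcomp Require Import measurable_realfun.
From mathcomp Require Import ring lra.

Set Implicit Arguments.
Unset Strict Implicit.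
Unset Printing Implicit Defensive.

Import Order.TTheory GRing.Theory Num.Theory.
Import numFieldNormedType.Exports.

Local Open Scope classical_set_scope.
Local Open Scope ring_scope.
Local Open Scope quotient_scope.

(** What shapes the proof is that solutions are tested only at points of strict minimum, against
    functionals that are linear in the measure: the tested quantity is [<U - phi(.,p), m - nu>], so
    that no penalization such as a squared distance between measures can be added. Strictness in
    [(mu, nu, p)] has to come from pairings with fixed functions [A] and [B], which enter [phi]; in
    time, squares are available because [theta] is free. Testing [U] with [V - A] against [nu0]
    produces [- <A(.,p), nu0>] where the cost has [<B(.,p), nu0>]: this is why [A + B] must not
    depend on [p]. Such a pair cannot detect [p] when [mu = nu], but there the bracket vanishes, so
    a minimizer at a negative level stays off the diagonal. Time is doubled since no derivative in
    [t] is at hand, whereas the solutions are C^2 in [p], so that [p] is kept common and the usual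
    optimality conditions are used. The gradients of [U] and [V] are bounded on [[0, T]]
    independently of the perturbation, hence the factor hidden in [O(A + B)] is known before [A] and
    [B] are chosen. *)

(** * Directional derivatives along lines *)

Section DirectionalDerivatives.
Context (R : realType) (V : normedModType R).
Implicit Types (F G : V -> R) (z v w : V).

Lemma is_derive_line F z v (t : R) : derivable F (t *: v + z) v ->
  is_derive t 1 (fun s : R => F (s *: v + z)) ('D_v F (t *: v + z)).
Proof.
move=> dF.
have E : (fun h : R => h^-1 *: (((fun s : R => F (s *: v + z)) \o shift t) (h *: 1)
   - F (t *: v + z))) = (fun h : R => h^-1 *: ((F \o shift (t *: v + z)) (h *: v)
   - F (t *: v + z))).
  by apply/funext => h /=; rewrite [h%:A]mulr1 scalerDl addrA.
by split; rewrite /derivable /derive E.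
Qed.

Lemma is_derive_line0 F z v : derivable F z v ->
  is_derive (0 : R) 1 (fun s : R => F (s *: v + z)) ('D_v F z).
Proof.
move=> dF; have E : (0 : R) *: v + z = z by rewrite scale0r add0r.
by move: dF (@is_derive_line F z v 0); rewrite E => dF; apply.
Qed.

Lemma is_derive_of_line F z v (d : R) :
  is_derive (0 : R) 1 (fun s : R => F (s *: v + z)) d -> is_derive z v F d.
Proof.
have E : (fun h : R => h^-1 *: (((fun s : R => F (s *: v + z)) \o shift 0) (h *: 1)
   - F (0 *: v + z))) = (fun h : R => h^-1 *: ((F \o shift z) (h *: v)
   - F z)).
  by apply/funext => h /=; rewrite [h%:A]mulr1 addr0 scale0r add0r.
by case; rewrite /derivable /derive E => ? ?; split.
Qed.

(** The segment is parametrized by [[0, 1]], so that both signs of [h] are covered at once. *)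
Lemma mvt_line F z v (h : R) : (forall z, derivable F z v) ->
  exists2 th : R, `|th| <= `|h| & F (h *: v + z) - F z = h * 'D_v F (th *: v + z).
Proof.
move=> dF.
have dg (s : R) : is_derive s 1 (fun s : R => F ((h * s) *: v + z))
    ('D_v F ((h * s) *: v + z) * h).
  have /= := @is_derive1_comp _ (fun s : R => F (s *: v + z)) (fun s => h * s) s.
  move=> /(_ ('D_v F ((h * s) *: v + z)) h) H; apply: H.
    exact: (is_derive_line (t := h * s)).
  have := @is_deriveZ _ _ _ (@id R) h s 1 1 _.
  by rewrite /GRing.scale/= mulr1; apply.
have [|th] := @MVT R _ _ 0 1 ltr01 (fun x _ => dg x).
  apply: derivable_within_continuous => x _; exact: ex_derive.
rewrite in_itv/= mulr1 mulr0 scale0r add0r subr0 mulr1 => /andP[t0 t1] E.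
exists (h * th); last by rewrite E mulrC.
by rewrite normrM ler_piMr// gtr0_norm// ltW.
Qed.

Lemma is_deriveZv F z v (a : R) : derivable F z v ->
  is_derive z (a *: v) F (a * 'D_v F z).
Proof.
move=> dF; apply: is_derive_of_line.
have -> : (fun s => F (s *: (a *: v) + z)) = (fun s => F (s *: v + z)) \o (fun s : R => a * s).
  by apply/funext => s /=; rewrite scalerA mulrC.
rewrite mulrC; apply: is_derive1_comp.
  by rewrite mulr0; exact: is_derive_line0.
have H := @is_deriveZ _ _ _ (@id R) a (0 : R) 1 1 _.
by apply: is_derive_eq; rewrite [_ *: _]mulr1.
Qed.

(** The increment along [h *: (v + w)] is cut into a step along [w], governed by the derivative at
    [z], and a step along [v], governed by the mean value theorem, whose intermediate point tends to
    [z]. *)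
Lemma is_deriveDv F z v w : (forall z, derivable F z v) -> derivable F z w ->
  {for z, continuous ('D_v F)} -> is_derive z (v + w) F ('D_v F z + 'D_w F z).
Proof.
move=> dv dw cv.
have /choice[th th_] : forall h : R, exists th : R, `|th| <= `|h| /\
    F (h *: v + (h *: w + z)) - F (h *: w + z) = h * 'D_v F (th *: v + (h *: w + z)).
  by move=> h; have [th ? ?] := mvt_line (h *: w + z) h dv; exists th.
suff H : h^-1 *: ((F \o shift z) (h *: (v + w)) - F z) @[h --> 0^'] -->
    'D_v F z + 'D_w F z.
  by split; [apply/cvg_ex; exists ('D_v F z + 'D_w F z) | exact: cvg_lim H].
have th0 : th h @[h --> (0 : R)^'] --> (0 : R).
  apply/cvgrPdist_lt => e e0; near=> h.
  rewrite sub0r normrN; apply: le_lt_trans (proj1 (th_ h)) _.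
  near: h; apply: nbhs_dnbhs.
  by exists e => // h /=; rewrite sub0r normrN.
have h0 : (h : R) @[h --> (0 : R)^'] --> (0 : R) by exact: nbhs_dnbhs.
have lim1 : 'D_v F (th h *: v + (h *: w + z)) @[h --> (0 : R)^'] --> 'D_v F z.
  apply: (@cvg_comp _ _ _ (fun h => th h *: v + (h *: w + z)) ('D_v F) _ _ _ _ cv).
  rewrite [X in _ `=>` nbhs X](_ : _ = 0 *: v + (0 *: w + z)); last first.
    by rewrite !scale0r !add0r.
  apply: cvgD; first by apply: cvgZr_tmp.
  by apply: cvgD; [apply: cvgZr_tmp|exact: cvg_cst].
apply: cvg_trans (cvgD lim1 dw).
apply: near_eq_cvg; near=> h => /=.
have hn0 : h != 0 by near: h; exact: nbhs_dnbhs_neq.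
have scE (a c : R) : a *: c = a * c by [].
rewrite !fctE !scE.
rewrite -[LHS](mulKf hn0) mulrDr -(proj2 (th_ h)) mulVKf//; congr (_ * _).
rewrite (scalerDr h v w) -(addrA (h *: v)).
by ring.
Unshelve. all: by end_near. Qed.

Lemma is_derive_expR_comp F z v : derivable F z v ->
  is_derive z v (fun z => expR (F z)) (expR (F z) * 'D_v F z).
Proof.
move=> dF; apply: is_derive_of_line.
have E : (0 : R) *: v + z = z by rewrite scale0r add0r.
apply: (@is_derive1_comp _ (@expR R)); last exact: is_derive_line0.
by rewrite E; exact: is_derive_expR.
Qed.

End DirectionalDerivatives.

(** * Functions with bounded iterated derivatives, and their weighted series *)

Section BoundedDerivatives.
Context (R : realType) (V : normedModType R).
Implicit Types (F G : V -> R) (z v w : V) (M : R) (n : nat).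

(** A quantitative form of [Cn]: the derivative along [v1, ..., vj], for [j <= n], is bounded by
    [M * |v1| ... |vj|]. A single constant for all orders makes the class stable under series with
    summable weights, which is how [A] and [B] are built. *)
Fixpoint BD n M F : Prop :=
  (forall z, `|F z| <= M) /\
  if n is n'.+1 then
    forall v, (forall z, derivable F z v) /\ BD n' (M * `|v|) ('D_v F)
  else True.

Lemma BD_bound n M F z : BD n M F -> `|F z| <= M.
Proof. by case: n => [|n] [/(_ z)]. Qed.

Lemma BD_ge0 n M F : BD n M F -> 0 <= M.
Proof. by move=> /BD_bound -/(_ 0); apply: le_trans. Qed.

Lemma BDS n M F : BD n.+1 M F -> BD n M F.
Proof.
elim: n M F => [|n IH] M F [bF dF]; first by split.
by split => // v; have [? ?] := dF v; split=> //; apply: IH.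
Qed.

Lemma BD_le n M M' F : M <= M' -> BD n M F -> BD n M' F.
Proof.
elim: n M M' F => [|n IH] M M' F MM [bF dF]; split => //; first by move=> z; exact: le_trans (bF z) MM.
  by move=> z; exact: le_trans (bF z) MM.
move=> v.
have [? H] := dF v; split=> //; apply: IH H; exact: ler_wpM2r.
Qed.

Lemma BD_lipschitz M F z v : BD 1 M F -> `|F (v + z) - F z| <= M * `|v|.
Proof.
move=> [_ dF]; have [dv [bv _]] := dF v.
have [th _] := mvt_line z 1 dv; rewrite scale1r mul1r => ->; exact: bv.
Qed.

Lemma BD_continuous M F : BD 1 M F -> continuous F.
Proof.
move=> bF z; have M0 := BD_ge0 bF.
apply/cvgrPdist_lt => e e0; near=> y.
rewrite distrC; have -> : y = (y - z) + z by rewrite subrK.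
apply: le_lt_trans (BD_lipschitz _ _ bF) _.
apply: (@le_lt_trans _ _ ((M + 1) * `|y - z|)); first by rewrite ler_wpM2r// lerDl.
rewrite -ltr_pdivlMl ?ltr_wpDl//.
near: y.
under eq_near do rewrite distrC.
apply: (@cvgr_dist_lt _ _ _ _ _ id z cvg_id).
by rewrite mulr_gt0// invr_gt0 ltr_wpDl.
Unshelve. all: by end_near. Qed.

(** One order is lost: the continuity of a derivative is read off the bound on the next one. *)
Lemma BD_Cn n M F : BD n.+1 M F -> Cn n F.
Proof.
elim: n M F => [|n IH] M F bF.
  by split=> //; apply: BD_continuous bF.
split; first by apply: (@BD_continuous M); elim: n.+1 bF => // m IHm /BDS.
by move=> v; case: bF => _ /(_ v)[dv bv]; split=> //; apply: IH bv.
Qed.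

Lemma BD_cst n (c : R) : BD n `|c| (fun=> c).
Proof.
elim: n c => [|n IH] c; split => // v; split; first by move=> z; apply: derivable_cst.
have -> : 'D_v (fun=> c) = (fun=> 0) by apply/funext => z; rewrite derive_cst.
by apply: BD_le (IH 0); rewrite normr0 mulr_ge0.
Qed.

Lemma BD_add n M M' F G : BD n M F -> BD n M' G ->
  BD n (M + M') (fun z => F z + G z).
Proof.
elim: n M M' F G => [|n IH] M M' F G [bF dF] [bG dG].
  by split=> // z; apply: le_trans (ler_normD _ _) (lerD _ _).
split=> [z|v]; first by apply: le_trans (ler_normD _ _) (lerD _ _).
have [dFv bFv] := dF v; have [dGv bGv] := dG v; split.
  by move=> z; apply: derivableD.
have -> : 'D_v (fun z => F z + G z) = (fun z => 'D_v F z + 'D_v G z).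
  by apply/funext => z; rewrite -deriveD.
by rewrite mulrDl; apply: IH.
Qed.

(** The factor [2 ^+ n] counts the terms of the Leibniz rule, two for each derivation. *)
Lemma BD_mul n M M' F G : BD n M F -> BD n M' G ->
  BD n (2 ^+ n * (M * M')) (fun z => F z * G z).
Proof.
elim: n M M' F G => [|n IH] M M' F G bF bG.
  split=> // z; rewrite expr0 mul1r normrM ler_pM//; [exact: BD_bound bF|exact: BD_bound bG].
have bF' := BDS bF; have bG' := BDS bG.
have M0 := BD_ge0 bF; have M'0 := BD_ge0 bG.
have [_ dF] := bF; have [_ dG] := bG.
split=> [z|v].
  rewrite normrM (@le_trans _ _ (M * M'))//.
    by rewrite ler_pM//; [exact: BD_bound bF|exact: BD_bound bG].
  by rewrite ler_peMl ?mulr_ge0// exprn_ege1// ler1n.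
have [dFv bFv] := dF v; have [dGv bGv] := dG v; split.
  by move=> z; apply: derivableM.
have -> : 'D_v (fun z => F z * G z) = (fun z => F z * 'D_v G z + 'D_v F z * G z).
  apply/funext => z; rewrite (@deriveM _ _ F G)// /GRing.scale/=.
  by rewrite [G z * _]mulrC.
have -> : 2 ^+ n.+1 * (M * M') * `|v| = 2 ^+ n * (M * (M' * `|v|)) + 2 ^+ n * (M * `|v| * M').
  by rewrite exprS; ring.
by apply: BD_add; apply: IH.
Qed.

Lemma BD_expR n M F : BD n M F -> exists C, BD n C (fun z => expR (F z)).
Proof.
suff H : exists C, forall F, BD n M F -> BD n C (fun z => expR (F z)).
  by move=> bF; have [C HC] := H; exists C; apply: HC.
elim: n => [|n [C HC]].
  exists (expR M) => {}F [bF _]; split=> // z.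
  by rewrite ger0_norm ?expR_ge0// ler_expR (le_trans (ler_norm _)).
exists (Num.max (expR M) (2 ^+ n * (C * M))) => {}F bF.
have [bF0 dF] := bF.
split=> [z|v].
  rewrite le_max ger0_norm ?expR_ge0// ler_expR.
  by rewrite (le_trans (ler_norm _))//.
have [dv bv] := dF v.
split=> [z|]; first by have [] := is_derive_expR_comp (dv z).
have -> : 'D_v (fun z => expR (F z)) = (fun z => expR (F z) * 'D_v F z).
  by apply/funext => z; have [_ ->] := is_derive_expR_comp (dv z).
have := BD_mul (HC F (BDS bF)) bv; apply: BD_le.
by rewrite mulrA mulrA -(mulrA _ C) ler_wpM2r// le_max lexx orbT.
Qed.

Lemma BD_sum n (I : Type) (r : seq I) (f : I -> V -> R) (M : I -> R) :
  (forall i, BD n (M i) (f i)) ->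
  BD n (\sum_(i <- r) M i) (fun z => \sum_(i <- r) f i z).
Proof.
move=> bf; elim: r => [|i r IH].
  rewrite big_nil; under eq_fun do rewrite big_nil.
  by have := BD_cst n 0; rewrite normr0.
have -> : (fun z => \sum_(j <- i :: r) f j z) = (fun z => f i z + \sum_(j <- r) f j z).
  by apply/funext => z; rewrite big_cons.
by rewrite big_cons; exact: BD_add.
Qed.

Lemma BD_scale m M F (c : R) : BD m M F -> BD m (`|c| * M) (fun z => c * F z).
Proof.
elim: m M F => [|m IHm] M F [bF dF].
  by split=> // z; rewrite normrM ler_wpM2l.
split=> [z|v]; first by rewrite normrM ler_wpM2l.
have [dv bv] := dF v; split=> [z|]; first by apply: (@derivableZ _ _ _ F).
have -> : 'D_v (fun z => c * F z) = (fun z => c * 'D_v F z).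
  by apply/funext => z; rewrite (@deriveZ _ _ _ F).
by rewrite -mulrA; apply: IHm.
Qed.

(** Cosine and sine are treated together because each differentiates into the other; [1 <= K] lets
    [K ^+ n] bound the lower orders as well. *)
Lemma BD_trig n (l : V -> R) (K : R) : 1 <= K ->
  (forall z v (h : R), l (h *: v + z) = h * l v + l z) ->
  (forall v, `|l v| <= K * `|v|) ->
  BD n (K ^+ n) (fun z => cos (l z)) /\ BD n (K ^+ n) (fun z => sin (l z)).
Proof.
move=> K1 lin lK; have K0 : 0 <= K by apply: le_trans K1.
have dlin z v : is_derive (0 : R) 1 (fun s => l (s *: v + z)) (l v).
  under eq_fun do rewrite lin.
  have -> : (fun x : R => x * l v + l z) = (l v *: (@id R) : R -> R) + cst (l z).
    by apply/funext => x; rewrite !fctE mulrC.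
  by apply: is_derive_eq; rewrite addr0 [_ *: _]mulr1.
have dcos z v : is_derive z v (fun z => cos (l z)) (- sin (l z) * l v).
  apply: is_derive_of_line.
  have E : (0 : R) *: v + z = z by rewrite scale0r add0r.
  have H : is_derive (l ((0 : R) *: v + z)) 1 (@cos R) (- sin (l z)).
    by rewrite E; exact: is_derive_cos.
  exact: (@is_derive1_comp _ (@cos R) (fun s => l (s *: v + z)) 0 _ _ H (dlin z v)).
have dsin z v : is_derive z v (fun z => sin (l z)) (cos (l z) * l v).
  apply: is_derive_of_line.
  have E : (0 : R) *: v + z = z by rewrite scale0r add0r.
  have H : is_derive (l ((0 : R) *: v + z)) 1 (@sin R) (cos (l z)).
    by rewrite E; exact: is_derive_sin.
  exact: (@is_derive1_comp _ (@sin R) (fun s => l (s *: v + z)) 0 _ _ H (dlin z v)).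
elim: n => [|n [IHc IHs]].
  by split; split=> // z; rewrite expr0 ler_norml; [rewrite cos_geN1 cos_le1|rewrite sin_geN1 sin_le1].
have Kn : 1 <= K ^+ n.+1 by rewrite exprn_ege1.
split; split=> [z|v].
- by apply: le_trans Kn; rewrite ler_norml cos_geN1 cos_le1.
- split=> [z|]; first by have [] := dcos z v.
  have -> : 'D_v (fun z => cos (l z)) = (fun z => (- l v) * sin (l z)).
    by apply/funext => z; have [_ ->] := dcos z v; rewrite mulNr mulrC mulNr.
  apply: BD_le (BD_scale _ IHs); rewrite normrN exprS -mulrA (mulrC (K ^+ n)) mulrA.
  by rewrite ler_wpM2r// exprn_ge0.
- by apply: le_trans Kn; rewrite ler_norml sin_geN1 sin_le1.
- split=> [z|]; first by have [] := dsin z v.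
  have -> : 'D_v (fun z => sin (l z)) = (fun z => l v * cos (l z)).
    by apply/funext => z; have [_ ->] := dsin z v; rewrite mulrC.
  apply: BD_le (BD_scale _ IHc); rewrite exprS -mulrA (mulrC (K ^+ n)) mulrA.
  by rewrite ler_wpM2r// exprn_ge0.
Qed.


Definition wsum (s : nat -> R) (f : nat -> V -> R) (z : V) : R :=
  limn (series (fun j => s j * f j z)).

Section WeightedSeries.
Context (s : nat -> R) (s0 : forall j, 0 <= s j) (cs : cvgn (series s)).

Lemma wsum_cvg f M z : (forall j, `|f j z| <= M) ->
  cvgn (series (fun j => s j * f j z)).
Proof.
move=> fM; apply: normed_cvg.
have M0 : 0 <= M by apply: le_trans (fM 0%N).
apply: (@series_le_cvg _ _ (fun j => M * s j)) => [j|j|j|].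
- by rewrite normr_ge0.
- exact: mulr_ge0.
- by rewrite /= normrM ger0_norm// mulrC ler_wpM2r.
- exact: is_cvg_seriesZ.
Qed.

Lemma wsum_tail f M z n : (forall j, `|f j z| <= M) ->
  `|wsum s f z - \sum_(0 <= j < n) s j * f j z| <=
    M * (limn (series s) - series s n).
Proof.
move=> fM; have c := wsum_cvg fM.
have M0 : 0 <= M by apply: le_trans (fM 0%N).
set u := fun m => series (fun j => s j * f j z) m - series (fun j => s j * f j z) n.
have cu : u m @[m --> \oo] --> wsum s f z - series (fun j => s j * f j z) n.
  by apply: cvgB => //; exact: cvg_cst.
have cv : M * (series s m - series s n) @[m --> \oo] -->
    M * (limn (series s) - series s n).
  by apply: cvgMl_tmp; apply: cvgB => //; exact: cvg_cst.
have cnu : `|u m| @[m --> \oo] --> `|wsum s f z - series (fun j => s j * f j z) n|.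
  exact: cvg_norm.
rewrite -(cvg_lim (@Rhausdorff R) cnu) -(cvg_lim (@Rhausdorff R) cv).
apply: ler_lim; [by apply/cvg_ex; eexists; exact: cnu|by apply/cvg_ex; eexists; exact: cv|].
near=> m.
have nm : (n <= m)%N by near: m; exact: nbhs_infty_ge.
rewrite /u !sub_series_geq// mulr_sumr (le_trans (ler_norm_sum _ _ _))//.
by apply: ler_sum => j _; rewrite normrM ger0_norm// mulrC ler_wpM2r.
Unshelve. all: by end_near. Qed.

Lemma wsum_bound f M z : (forall j, `|f j z| <= M) ->
  `|wsum s f z| <= limn (series s) * M.
Proof.
by move=> fM; have := wsum_tail 0 fM; rewrite big_geq// seriesEnat/= big_geq// !subr0 mulrC.
Qed.

(** Termwise differentiation. Each difference quotient of [f j] is a value of its derivative at a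
    point at distance at most [|h| * |v|] from [z]; the spare order makes that derivative Lipschitz,
    so the error is at most [K * |h|] after summation. *)
Lemma BD_wsum n M f : (forall j, BD n.+1 M (f j)) ->
  BD n (limn (series s) * M) (wsum s f).
Proof.
elim: n M f => [|n IH] M f bf.
  by split=> // z; apply: wsum_bound => j; exact: BD_bound (bf j).
split=> [z|v]; first by apply: wsum_bound => j; exact: BD_bound (bf j).
have dv j : forall z, derivable (f j) z v by case: (bf j) => _ /(_ v)[].
have bv j : BD n.+1 (M * `|v|) ('D_v (f j)) by case: (bf j) => _ /(_ v)[].
suff D z : is_derive z v (wsum s f) (wsum s (fun j => 'D_v (f j)) z).
  split=> [z|]; first by have [] := D z.
  have -> : 'D_v (wsum s f) = wsum s (fun j => 'D_v (f j)).
    by apply/funext => z; have [] := D z.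
  by rewrite -mulrA; exact: IH.
set S := limn (series s); set K := S * (M * `|v| * `|v|).
have S0 : 0 <= S.
  apply: limr_ge => //; near=> m; rewrite seriesEnat; exact: sumr_ge0.
have M0 : 0 <= M := BD_ge0 (bf 0%N).
have K0 : 0 <= K by rewrite !mulr_ge0.
have est (h : R) : h != 0 ->
  `|wsum s (fun j => 'D_v (f j)) z - h^-1 *: (wsum s f (h *: v + z) - wsum s f z)|
    <= K * `|h|.
  move=> hn0.
  have E : wsum s (fun j => 'D_v (f j)) z
      - h^-1 *: (wsum s f (h *: v + z) - wsum s f z) =
    wsum s (fun j z => 'D_v (f j) z - h^-1 * (f j (h *: v + z) - f j z)) z.
    have c1 := @wsum_cvg (fun j => 'D_v (f j)) _ z (fun j => BD_bound z (bv j)).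
    have c2 := @wsum_cvg f _ z (fun j => BD_bound z (bf j)).
    have c3 := @wsum_cvg f _ (h *: v + z) (fun j => BD_bound (h *: v + z) (bf j)).
    apply/esym/(cvg_lim (@Rhausdorff R)).
    rewrite (_ : series _ = (fun m => series (fun j => s j * 'D_v (f j) z) m -
        h^-1 * (series (fun j => s j * f j (h *: v + z)) m -
                series (fun j => s j * f j z) m))).
      by apply: cvgB => //; apply: cvgMl_tmp; apply: cvgB.
    apply/funext => m; rewrite !seriesEnat /= -sumrB mulr_sumr -sumrB.
    apply: eq_bigr => j _; ring.
  rewrite E /K -mulrA; apply: wsum_bound => j.
  have [th th_h ->] := mvt_line z h (dv j).
  have b1 : BD 1 (M * `|v|) ('D_v (f j)).
    by move: (bv j); clear; elim: n => // m IHm /BDS; exact: IHm.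
  rewrite mulKf// distrC; have := BD_lipschitz z (th *: v) b1.
  rewrite normrZ => /le_trans; apply.
  by rewrite -[leRHS]mulrA ler_wpM2l ?mulr_ge0// mulrC ler_wpM2l.
suff H : h^-1 *: ((wsum s f \o shift z) (h *: v) - wsum s f z) @[h --> 0^'] -->
    wsum s (fun j => 'D_v (f j)) z.
  by split; [apply/cvg_ex; eexists; exact: H | exact: cvg_lim H].
apply/cvgrPdist_lt => e e0; near=> h.
have hn0 : h != 0 by near: h; exact: nbhs_dnbhs_neq.
apply: le_lt_trans (est h hn0) _.
apply: (@le_lt_trans _ _ ((K + 1) * `|h|)); first by rewrite ler_wpM2r// lerDl.
rewrite -ltr_pdivlMl ?ltr_wpDl//.
near: h; apply: nbhs_dnbhs; exists ((K + 1)^-1 * e) => /=.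
  by rewrite mulr_gt0// invr_gt0 ltr_wpDl.
by move=> h /=; rewrite sub0r normrN.
Unshelve. all: by end_near. Qed.

End WeightedSeries.

(** Linearity of the derivative in its direction; it turns the derivative of [H] along [q' - q] into
    a scalar product with [DpH]. *)
Lemma Cn1_derive_sum F (I : Type) (r : seq I) (w : I -> V) (a : I -> R) z :
  Cn 1 F -> 'D_(\sum_(i <- r) a i *: w i) F z = \sum_(i <- r) a i * 'D_(w i) F z.
Proof.
move=> [_ dF]; elim: r z => [|i r IH] z; first by rewrite !big_nil derive0.
have [_ E] := is_deriveZv (a i) ((dF (w i)).1 z).
rewrite !big_cons -IH -E.
have [di [ci _]] := dF (a i *: w i).
have [dr _] := dF (\sum_(j <- r) a j *: w j).
by have [_ ->] := is_deriveDv di (dr z) (ci z).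
Qed.

End BoundedDerivatives.

Lemma cvg_sumr (R : realType) (X : Type) (F : set_system X) (FF : Filter F)
    (I : Type) (r : seq I) (f : I -> X -> R) (l : I -> R) :
  (forall i, f i x @[x --> F] --> l i) ->
  \sum_(i <- r) f i x @[x --> F] --> \sum_(i <- r) l i.
Proof.
move=> fl; elim: r => [|i r IH].
  by rewrite big_nil; under eq_fun do rewrite big_nil; exact: cvg_cst.
rewrite big_cons.
rewrite (_ : (fun x => \sum_(j <- i :: r) f j x) =
  (fun x => f i x + \sum_(j <- r) f j x)); last first.
  by apply/funext => x; rewrite big_cons.
exact: cvgD.
Qed.

Lemma continuous_sumr (R : realType) (X : topologicalType) (I : Type)
    (r : seq I) (f : I -> X -> R) :
  (forall i, continuous (f i)) -> continuous (fun x => \sum_(i <- r) f i x).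
Proof. by move=> cf x; apply: (cvg_sumr (nbhs_filter x)) => i; exact: cf. Qed.

Lemma continuous_near (R : realType) (X : topologicalType) (g : X -> R) :
  (forall x e, 0 < e -> \forall y \near x, `|g x - g y| < e) -> continuous g.
Proof.
move=> H x; have Fx := nbhs_filter x.
by apply/cvgrPdist_lt => e e0; exact: H.
Qed.

(** * Compactness of the torus; its distance and its quotient topology *)

Section TorusTopology.
Context (R : realType) (n : nat).
Local Notation T := (torus R n).

Lemma pi_torusP (x y : 'rV[R]_n) :
  (\pi_T x = \pi_T y) <-> (forall i, x 0 i - y 0 i \is a Num.int).
Proof.
split=> [/eqmodP/forallP//|H].
by apply/eqmodP/forallP.
Qed.

Lemma repr_pi_int (x : 'rV[R]_n) i : (repr (\pi_T x)) 0 i - x 0 i \is a Num.int.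
Proof. by move: i; apply/pi_torusP; rewrite reprK. Qed.

Lemma pi_torus_continuous : continuous (\pi_T : 'rV[R]_n -> T).
Proof. exact: (@pi_continuous _ {eq_quot (zn_equiv_rel R n)}). Qed.

Lemma torus_continuousP (Z : topologicalType) (f : T -> Z) :
  continuous f <-> continuous (f \o \pi_T).
Proof. exact: (@quotient_continuous _ {eq_quot (zn_equiv_rel R n)}). Qed.

Definition unit_cube : set 'rV[R]_n := [set v | forall i, `[0, 1]%classic (v 0 i)].

Lemma unit_cube_compact : compact unit_cube.
Proof.
exact: (@rV_compact R n (fun=> `[0, 1]%classic) (fun i => @segment_compact R 0 1)).
Qed.

Lemma unit_cube_surj (x : T) : exists2 v, unit_cube v & \pi_T v = x.
Proof.
exists (\row_i (repr x 0 i - (Num.floor (repr x 0 i))%:~R)).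
  move=> i; rewrite mxE /= in_itv/=.
  have /andP[h1 h2] := floor_itv (repr x 0 i).
  by rewrite subr_ge0 h1/= lerBlDl -(intrD1)// ltW.
rewrite -[RHS](@reprK _ T); apply/pi_torusP => i.
by rewrite mxE addrAC subrr add0r rpredN intr_int.
Qed.

Lemma torus_compact : compact [set: T].
Proof.
have -> : [set: T] = (\pi_T : 'rV[R]_n -> T) @` unit_cube.
  apply/seteqP; split => // x _; have [v Kv <-] := unit_cube_surj x.
  by exists v.
apply: continuous_compact unit_cube_compact.
exact: continuous_subspaceT pi_torus_continuous.
Qed.

Lemma torus_bounded (g : T -> R) : continuous g -> exists M, forall x, `|g x| <= M.
Proof.
move=> cg; have cn : {within [set: T], continuous (fun x => `|g x|)}.
  apply: continuous_subspaceT => x; apply: continuous_comp; first exact: cg.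
  exact: norm_continuous.
have [|c _ H] := compact_EVT_max _ torus_compact cn; first by exists point.
by exists `|g c| => x; apply: H; rewrite inE.
Qed.

Lemma torus_measurable_continuous (g : T -> R) :
  continuous g -> measurable_fun setT g.
Proof.
move=> cg; apply: (measurability _ (measurable_realfun.RGenOInfty.measurableE R)).
move=> _ [_ [r ->] <-]; apply: sub_sigma_algebra; rewrite setTI.
apply: open_comp; first by move=> x _; exact: cg.
exact: rray_open.
Qed.

Lemma torus_integrable (mu : pmeas R n) (g : T -> R) :
  continuous g -> mu.-integrable setT (EFin \o g).
Proof.
move=> cg; apply: measurable_bounded_integrable => //.
- by rewrite -[ltLHS]/(mu [set: T]) probability_setT ltry.
- exact: torus_measurable_continuous.
- have [M HM] := torus_bounded cg; exists M; split; first exact: num_real.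
  by move=> x Mx y _; apply: le_trans (HM y) (ltW Mx).
Qed.

Lemma tdist_ge0 (x y : T) : 0 <= tdist x y.
Proof.
apply: lb_le_inf => [|_ [z _ <-]]; last exact: sqrtr_ge0.
by exists (Num.sqrt (\sum_(i < n) ((repr x) 0 i - (repr y) 0 i) ^+ 2)), (repr x, repr y) => //=; rewrite !reprK.
Qed.

Lemma tdist_pi_le (x y : 'rV[R]_n) :
  tdist (\pi_T x) (\pi_T y) <= \sum_(i < n) `|x 0 i - y 0 i|.
Proof.
apply: (@le_trans _ _ (Num.sqrt (\sum_(i < n) (x 0 i - y 0 i) ^+ 2))).
  apply: ge_inf; last by exists (x, y).
  by exists 0 => _ [z _ <-]; exact: sqrtr_ge0.
have S0 : 0 <= \sum_(i < n) `|x 0 i - y 0 i| by apply: sumr_ge0.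
rewrite -(ger0_norm S0) -sqrtr_sqr ler_wsqrtr//.
rewrite expr2 mulr_suml; apply: ler_sum => i _.
rewrite -real_normK ?num_real//.
rewrite expr2 ler_wpM2l//= (bigD1 i)//= lerDl; exact: sumr_ge0.
Qed.

(** The data are continuous in the sense of [tdist], while integrability rests on the quotient
    topology; this is the passage from the former to the latter. *)
Lemma tdist_continuous (g : T -> R) :
  (forall x (e : R), 0 < e -> exists2 del : R, 0 < del &
     forall y, tdist x y < del -> `|g x - g y| < e) -> continuous g.
Proof.
move=> H; apply/torus_continuousP; apply: continuous_near => z e e0; have [del d0 Hd] := H (\pi_T z) e e0.
have Fz := nbhs_filter z.
have cS : (fun y : 'rV[R]_n => \sum_(i < n) `|z 0 i - y 0 i|) @ (z : 'rV[R]_n) -->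
    \sum_(i < n) `|z 0 i - z 0 i|.
  apply: cvg_sumr => i; apply: cvg_norm; apply: cvgB; first exact: cvg_cst.
  exact: coord_continuous.
have S0 : \sum_(i < n) `|z 0 i - z 0 i| = 0.
  by apply: big1 => i _; rewrite subrr normr0.
rewrite S0 in cS; have /cvgr0_norm_lt/(_ _ d0) := cS.
apply: filterS => y Hy; apply: Hd.
apply: le_lt_trans (tdist_pi_le _ _) (le_lt_trans (ler_norm _) Hy).
Qed.

End TorusTopology.

(** * Integration of continuous functions against measures *)

Section Pairing.
Context (R : realType) (n : nat).
Local Notation T := (torus R n).
Implicit Types (mu nu : pmeas R n) (g h : T -> R).

Lemma pair_pD g h mu : continuous g -> continuous h ->
  pair_p (fun x => g x + h x) mu = pair_p g mu + pair_p h mu.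
Proof. by move=> cg ch; rewrite /pair_p RintegralD//; exact: torus_integrable. Qed.

Lemma pair_pB g h mu : continuous g -> continuous h ->
  pair_p (fun x => g x - h x) mu = pair_p g mu - pair_p h mu.
Proof. by move=> cg ch; rewrite /pair_p RintegralB//; exact: torus_integrable. Qed.

Lemma pair_pZ (c : R) g mu : continuous g ->
  pair_p (fun x => c * g x) mu = c * pair_p g mu.
Proof. by move=> cg; rewrite /pair_p RintegralZl//; exact: torus_integrable. Qed.

Lemma pair_p_cst (c : R) mu : pair_p (fun=> c) mu = c.
Proof.
by rewrite /pair_p Rintegral_cst// -[X in fine X]/(mu [set: T]) probability_setT mulr1.
Qed.

Lemma pair_p_le g h mu : continuous g -> continuous h -> (forall x, g x <= h x) ->
  pair_p g mu <= pair_p h mu.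
Proof. by move=> cg ch gh; apply: le_Rintegral => //; exact: torus_integrable. Qed.

Lemma pair_p_norm g mu (M : R) : continuous g -> (forall x, `|g x| <= M) ->
  `|pair_p g mu| <= M.
Proof.
move=> cg gM; have cc (c : R) : continuous (fun _ : T => c) by exact: cst_continuous.
rewrite ler_norml -{1}(pair_p_cst (- M) mu) -{2}(pair_p_cst M mu).
by apply/andP; split; apply: pair_p_le => // x; have := gM x; rewrite ler_norml => /andP[].
Qed.

Lemma pair_p_sum (I : Type) (r : seq I) (g : I -> T -> R) mu :
  (forall i, continuous (g i)) ->
  pair_p (fun x => \sum_(i <- r) g i x) mu = \sum_(i <- r) pair_p (g i) mu.
Proof.
move=> cg; elim: r => [|i r IH].
  rewrite big_nil -[RHS](pair_p_cst 0 mu); congr pair_p.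
  by apply/funext => x; rewrite big_nil.
rewrite big_cons -IH -pair_pD//; last first.
  exact: continuous_sumr.
by congr pair_p; apply/funext => x; rewrite big_cons.
Qed.

Lemma pair_p_eq g mu nu : pmeas_eq mu nu -> continuous g -> pair_p g mu = pair_p g nu.
Proof.
move=> E cg; rewrite /pair_p /Rintegral; congr fine.
by apply: eq_measure_integral => A mA _; exact: E.
Qed.

Definition charge_of (mu : pmeas R n) : smeas R n :=
  [the {charge set _ -> \bar R} of charge_of_finite_measure mu].

(** Whatever Hahn decomposition is picked, its negative set is null for a measure, so the positive
    part is [mu] and the negative part is zero. This is what allows a probability measure as the
    [nu] of a monotone solution. *)
Lemma pair_s_charge g mu : continuous g -> pair_s g (charge_of mu) = pair_p g mu.
Proof.
move=> cg; rewrite /pair_s; set P := cid _; set N := cid _.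
have hd := projT2 N; have [[mP posP] [mN negN] PN P0] := hd.
have muN A : measurable A -> mu (A `&` projT1 N) = 0.
  move=> mA; apply/eqP; rewrite eq_le measure_ge0 andbT.
  by apply: (negN); [exact: measurableI|exact: subIsetr].
have E1 : \int[jordan_pos hd]_x g x = pair_p g mu.
  rewrite /pair_p /Rintegral; congr fine; apply: eq_measure_integral => A mA _.
  rewrite [LHS]jordan_posE charge.cjordan_posE /crestr0 mem_set//=.
  rewrite /crestr -[in RHS](setIT A) -PN setIUr.
  change (mu (A `&` projT1 P) = mu ((A `&` projT1 P) `|` (A `&` projT1 N))).
  have mAP := measurableI _ _ mA mP; have mAN := measurableI _ _ mA mN.
  have -> : (mu ((A `&` projT1 P) `|` (A `&` projT1 N)) =
      mu (A `&` projT1 P) + mu (A `&` projT1 N))%E.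
    by apply: measureU => //; rewrite setIACA setIid P0 setI0.
  by rewrite (muN A mA) adde0.
have E2 : \int[jordan_neg hd]_x g x = 0.
  rewrite /Rintegral (@eq_measure_integral _ _ _ _ mzero).
    by rewrite integral_measure_zero.
  move=> A mA _; rewrite [LHS]jordan_negE charge.cjordan_negE /crestr0 mem_set//=.
  by rewrite /crestr -[X in (- X)%E]/(mu (A `&` projT1 N)) muN// oppe0.
by rewrite -[RHS]subr0 -E1 -E2.
Qed.

End Pairing.

(** * Trigonometric coordinates on the torus *)

Section TrigCoordinates.
Context (R : realType) (n : nat).
Local Notation T := (torus R n).

Lemma cos_sin_int (m : int) (a : R) :
  cos (pi *+ 2 * (a + m%:~R)) = cos (pi *+ 2 * a) /\
  sin (pi *+ 2 * (a + m%:~R)) = sin (pi *+ 2 * a).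
Proof.
have P (k : nat) (c : R) : cos (pi *+ 2 * (c + k%:R)) = cos (pi *+ 2 * c) /\
  sin (pi *+ 2 * (c + k%:R)) = sin (pi *+ 2 * c).
  rewrite mulrDr [X in _ + X]mulr_natr; split.
    exact: (periodicn (@cosD2pi R)).
  exact: (periodicn (@sinD2pi R)).
case: m => k; first exact: P.
by have [] := P k.+1 (a - k.+1%:R); rewrite subrK NegzE !mulrNz => <- <-.
Qed.

(** The fractional part [d] of [a - b] satisfies [cos (2 pi d) = 1 - 2 sin^2 (pi d) = 1], and
    [sin (pi d)] is positive for [0 < d < 1]. *)
Lemma trig_inj (a b : R) :
  cos (pi *+ 2 * a) = cos (pi *+ 2 * b) -> sin (pi *+ 2 * a) = sin (pi *+ 2 * b) ->
  a - b \is a Num.int.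
Proof.
move=> ec es.
have c1 : cos (pi *+ 2 * (a - b)) = 1.
  by rewrite mulrBr cosB ec es -!expr2 cos2Dsin2.
set d := a - b - (Num.floor (a - b))%:~R.
have /andP[h1 h2] := floor_itv (a - b).
have d0 : 0 <= d by rewrite /d subr_ge0.
have d1 : d < 1 by rewrite /d ltrBlDl -(intrD1).
have cd : cos (pi *+ 2 * d) = 1.
  have [+ _] := cos_sin_int (Num.floor (a - b)) d.
  by rewrite /d subrK c1.
suff -> : a - b = (Num.floor (a - b))%:~R by exact: intr_int.
apply/eqP; rewrite -subr_eq0 -/d; apply/eqP.
move: d0; rewrite le_eqVlt => /orP[/eqP//|d0].
have s0 : sin (pi * d) != 0.
  rewrite gt_eqF// sin_gt0_pi// mulr_gt0 ?pi_gt0//=.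
  by rewrite gtr_pMr// pi_gt0.
have : sin (pi * d) ^+ 2 = 0.
  have := cos2Dsin2 (pi * d); move: cd.
  rewrite mulrnAl cos_mulr2n => e1 e2; lra.
by move/eqP; rewrite expf_eq0/= (negbTE s0).
Qed.

(** The embedding of the torus by cosines and sines: unlike the coordinates of [repr x], these are
    continuous on the torus. *)
Definition trigc (j : 'I_n * bool) (x : T) : R :=
  (if j.2 then @cos R else @sin R) (pi *+ 2 * repr x 0 j.1).

Lemma trigc_pi j (z : 'rV[R]_n) :
  trigc j (\pi_T z) = (if j.2 then @cos R else @sin R) (pi *+ 2 * z 0 j.1).
Proof.
rewrite /trigc; have /intrP[m Em] := repr_pi_int z j.1.
have -> : repr (\pi_T z) 0 j.1 = z 0 j.1 + m%:~R by rewrite -Em addrC subrK.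
by have [Ec Es] := cos_sin_int m (z 0 j.1); case: (j.2).
Qed.

Lemma trigc_sep (x y : T) : (forall j, trigc j x = trigc j y) -> x = y.
Proof.
move=> H; rewrite -[x](@reprK _ T) -[y](@reprK _ T); apply/pi_torusP => i.
by apply: trig_inj; [exact: (H (i, true))|exact: (H (i, false))].
Qed.

Lemma trigc_continuous j : continuous (trigc j).
Proof.
apply/torus_continuousP.
have -> : trigc j \o \pi_T =
  (if j.2 then @cos R else @sin R) \o (fun z : 'rV[R]_n => pi *+ 2 * z 0 j.1).
  by apply/funext => z /=; rewrite trigc_pi.
move=> z; apply: continuous_comp.
  apply: continuous_comp; first exact: coord_continuous.
  exact: mulrl_continuous.
by case: (j.2); [exact: continuous_cos|exact: continuous_sin].
Qed.

Lemma trigc_bound j x : `|trigc j x| <= 1.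
Proof.
by rewrite /trigc ler_norml; case: (j.2); rewrite ?cos_geN1 ?cos_le1 ?sin_geN1 ?sin_le1.
Qed.

Lemma torus_hausdorff : hausdorff_space T.
Proof.
rewrite open_hausdorff => x y xy.
have [j jxy] : exists j, trigc j x != trigc j y.
  apply/not_existsP => H; move/eqP: xy; apply; apply: trigc_sep => j.
  by apply/eqP/negP => K; apply: (H j); apply/negP.
have := @Rhausdorff R; rewrite open_hausdorff => H.
have [[A B] [xA yB] [oA oB AB]] := H _ _ jxy.
exists (trigc j @^-1` A, trigc j @^-1` B); first by rewrite !inE in xA yB *.
split; try by apply: open_comp => // z _; exact: trigc_continuous.
by rewrite -preimage_setI; move/eqP: AB => ->; rewrite preimage_set0.
Qed.

(** The sum [g] of the coordinate gaps to [x] vanishes only at [x], so on the compact complement of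
    [U] it has a positive minimum. *)
Lemma torus_box (U : set T) x : open U -> U x -> exists2 e : R, 0 < e &
  forall y, (forall j, `|trigc j y - trigc j x| < e) -> U y.
Proof.
move=> oU Ux; have cK : compact (~` U).
  by apply: (@subclosed_compact _ _ setT _ (@torus_compact R n)) => //; exact: open_closedC.
pose g y := \sum_(j : 'I_n * bool) `|trigc j y - trigc j x|.
have cg : continuous g.
  apply: continuous_sumr => j y.
  apply: (@continuous_comp _ _ _ (fun y => trigc j y - trigc j x) (fun r : R => `|r|)); last first.
    exact: norm_continuous.
  have Fy := nbhs_filter y.
  by apply: cvgB; [exact: trigc_continuous|exact: cvg_cst].
have [[y0 Ky0]|/set0P/negP/negPn/eqP K0] := pselect (~` U !=set0); last first.
  exists 1 => // y _; apply: contrapT => nU; have : (~` U) y by [].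
  by rewrite K0.
have [|c Kc Hc] := compact_EVT_min _ cK (continuous_subspaceT cg); first by exists y0.
have g0 : 0 < g c.
  rewrite lt_neqAle sumr_ge0 ?andbT//; apply/negP => /eqP/esym/eqP.
  rewrite psumr_eq0// => /allP H; move: Kc; rewrite inE; apply.
  suff -> : c = x by [].
  apply: trigc_sep => j; apply/eqP; rewrite -subr_eq0 -normr_eq0.
  by apply: H; rewrite mem_index_enum.
exists (g c / #|{: 'I_n * bool}|.+1%:R); first by rewrite divr_gt0.
move=> y Hy; apply: contrapT => nU.
have := Hc y; rewrite inE => /(_ nU); apply/negP; rewrite -ltNge.
apply: (@le_lt_trans _ _ (\sum_(j : 'I_n * bool) (g c / #|{: 'I_n * bool}|.+1%:R))).
  by apply: ler_sum => j _; exact: ltW.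
rewrite sumr_const -[X in X < _]mulr_natr -mulrA gtr_pMr// mulrC ltr_pdivrMr// mul1r ltr_nat.
by [].
Qed.

End TrigCoordinates.

(** * Continuity of weighted series *)

Section UniformLimit.
Context (R : realType) (V : normedModType R).

Lemma wsum_continuous (s : nat -> R) (f : nat -> V -> R) (M : R) :
  (forall j, 0 <= s j) -> cvgn (series s) -> (forall j z, `|f j z| <= M) ->
  (forall j, continuous (f j)) -> continuous (wsum s f).
Proof.
move=> s0 cs fM cf; have M0 : 0 <= M by apply: le_trans (fM 0%N 0).
apply: continuous_near => z e e0.
have T0 : M * (limn (series s) - series s m) @[m --> \oo] --> 0.
  have H : M * (limn (series s) - series s m) @[m --> \oo] -->
      M * (limn (series s) - limn (series s)).
    by apply: cvgMl_tmp; apply: cvgB => //; exact: cvg_cst.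
  by rewrite subrr mulr0 in H.
have e3 : 0 < e / 3 by rewrite divr_gt0.
have /cvgr0_norm_lt/(_ _ e3)[m _ Hm] := T0.
have {}Hm : M * (limn (series s) - series s m) < e / 3.
  by apply: le_lt_trans (Hm m _); [exact: ler_norm|exact: leqnn].
have cp : continuous (fun z => \sum_(0 <= j < m) s j * f j z).
  apply: continuous_sumr => j y; apply: cvgMl_tmp; exact: cf.
have Fz := nbhs_filter z.
have /cvgrPdist_lt/(_ _ e3) := cp z.
apply: filterS => y Hy.
have t1 := wsum_tail s0 cs m (fM ^~ z).
have t2 := wsum_tail s0 cs m (fM ^~ y).
move: t1 t2 Hy Hm; set a := wsum s f z; set b := wsum s f y.
set a' := \sum_(_ <= _ < _) _; set b' := \sum_(_ <= _ < _) _.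
move=> t1 t2 Hy Hm.
have -> : a - b = (a - a') + ((a' - b') - (b - b')) by ring.
apply: le_lt_trans (ler_normD _ _) _; apply: le_lt_trans (lerD (lexx _) (ler_normB _ _)) _.
lra.
Qed.

End UniformLimit.

(** * A space-filling curve *)

Section Schoenberg.
Context (R : realType) (n : nat).

Lemma binary_expansion (y : R) : 0 <= y <= 1 -> exists a : nat -> bool,
  series (fun k => geometric 2^-1 2^-1 k * (a k)%:R) m @[m --> \oo] --> y.
Proof.
move=> y01.
(* The doubling map, arranged to fix 1, so that 1 expands as 0.111... and the orbit stays in
   [[0, 1]]. *)
pose step (y : R) := if 2^-1 <= y then 2 * y - 1 else 2 * y.
pose Y k := iter k step y.
have Y01 k : 0 <= Y k <= 1.
  elim: k => //= k; rewrite /step -/(Y k) => /andP[h0 h1].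
  by case: ifPn => [|/negP/negP]; rewrite ?leNgt ?negbK => h; apply/andP; split; lra.
pose D k : bool := 2^-1 <= Y k.
exists D.
have E m : series (fun k => geometric 2^-1 2^-1 k * (D k)%:R) m =
    y - (2^-1) ^+ m * Y m.
  elim: m => [|m IH]; first by rewrite /series/= big_geq// expr0 mul1r subrr.
  rewrite seriesSr IH /= exprS /step -/(Y m) /D.
  case: ifPn => _ /=; first by field.
  by field.
rewrite (_ : series _ = fun m => y - (2^-1) ^+ m * Y m); last exact/funext.
rewrite -[X in _ --> X]subr0; apply: cvgB; first exact: cvg_cst.
apply: (@squeeze_cvgr _ _ _ _ (fun=> 0) (fun m => (2^-1) ^+ m)).
- near=> m; have /andP[h0 h1] := Y01 m.
  have p2 : 0 <= (2^-1 : R) ^+ m by rewrite exprn_ge0// invr_ge0.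
  by rewrite mulr_ge0//= ler_piMr.
- exact: cvg_cst.
- apply: cvg_expr; rewrite ger0_norm ?invr_ge0// invf_lt1//; lra.
Unshelve. all: by end_near. Qed.

(** A continuous function of period 2 that is 0 on [[0, 1/3]] and 1 on [[2/3, 1]]: it reads the
    first ternary digit, 0 or 2, as a bit. *)
Definition clampc (t : R) : R := Num.min 1 (Num.max 0 (2^-1 - cos (pi * t))).

Lemma clampc_itv t : 0 <= clampc t <= 1.
Proof. by rewrite /clampc le_min ge_min lexx/= le_max lexx ler01. Qed.

Lemma clampc_continuous : continuous clampc.
Proof.
apply: continuous_near => t e e0.
have c1 : {for t, continuous (fun t : R => 2^-1 - cos (pi * t))}.
  apply: (@cvgB _ R^o); first exact: cvg_cst.
  apply: (@continuous_comp _ _ _ (fun t : R => pi * t) cos); last exact: continuous_cos.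
  by apply: cvgMl_tmp; exact: cvg_id.
have /cvgrPdist_lt/(_ _ e0) := c1.
apply: filterS => y; apply: le_lt_trans.
rewrite /clampc; set u := 2^-1 - _; set v := 2^-1 - _.
by rewrite /Num.min /Num.max; do ?case: ifPn; rewrite -?leNgt => *;
  rewrite ler_norml; have := ler_norm (u - v); have := ler_norm (v - u);
  rewrite (distrC v u) => *; lra.
Qed.

Lemma clampc_digit (N : nat) (a : bool) (r t : R) :
  t = (2 * N)%:R + 2 * a%:R / 3 + r -> 0 <= r <= 3^-1 -> clampc t = a%:R.
Proof.
move=> -> r01.
have -> : clampc ((2 * N)%:R + 2 * a%:R / 3 + r) = clampc (2 * a%:R / 3 + r).
  rewrite /clampc; congr (Num.min _ (Num.max _ (_ - _))).
  have -> : pi * ((2 * N)%:R + 2 * a%:R / 3 + r) =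
      pi * (2 * a%:R / 3 + r) + (pi *+ 2) *+ N :> R.
    by rewrite -mulrnA -[X in _ = _ + X]mulr_natr; ring.
  exact: (periodicn (@cosD2pi R)).
(* From [cos (2 pi / 3) = - cos (pi / 3)] and the duplication formula, [cos (pi / 3)] is a positive
   root of [(2 c - 1) (c + 1)]. *)
have c13 : cos (pi / 3 : R) = 2^-1.
  have := cos_mulr2n (pi / 3 : R).
  have -> : cos ((pi / 3 : R) *+ 2) = - cos (pi / 3).
    have -> : (pi / 3 : R) *+ 2 = pi - pi / 3 by rewrite -mulr_natr; field.
    by rewrite cosB cospi sinpi mul0r addr0 mulN1r.
  set c := cos _ => E.
  have c0 : 0 < c.
    by apply: cos_gt0_pihalf; have := pi_gt0 R; lra.
  have : (2 * c - 1) * (c + 1) = 0 by lra.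
  move/eqP; rewrite mulf_eq0 => /orP[/eqP|/eqP]; lra.
have p0 := pi_gt0 R.
case: a => /=.
- have : cos (pi * (2 * 1 / 3 + r)) <= - 2^-1.
    rewrite -c13 -cosDpi -[X in _ <= X]cosN.
    rewrite (_ : - (pi / 3 + pi) = 2 * (pi / 3) - pi *+ 2); last by rewrite -mulr_natr; field.
    rewrite -[X in _ <= X](@cosD2pi R) subrK.
    rewrite leNgt ltr_cos ?in_itv/= -?leNgt; nra.
  rewrite /clampc /Num.min /Num.max => H; do ?case: ifPn; rewrite -?leNgt => *; lra.
- have : 2^-1 <= cos (pi * (2 * 0 / 3 + r)).
    rewrite -c13 leNgt ltr_cos ?in_itv/= -?leNgt; nra.
  rewrite /clampc /Num.min /Num.max => H; do ?case: ifPn; rewrite -?leNgt => *; lra.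
Qed.

(** The witness is the Cantor point [sum_j 2 A_j / 3^(j+1)]. Multiplication by [3^m] turns the
    digits before [m] into an even integer, which the period of [clampc] removes, and the digits
    after [m] into a remainder of at most 1/3. *)
Lemma ternary_point (A : nat -> bool) : exists2 t : R, 0 <= t <= 1 &
  forall m, clampc (3 ^+ m * t) = (A m)%:R.
Proof.
pose tm m : R := \sum_(0 <= j < m) 2 * (A j)%:R * (3^-1) ^+ j.+1.
have tS m : tm m.+1 = tm m + 2 * (A m)%:R * (3^-1) ^+ m.+1.
  by rewrite /tm big_nat_recr.
have p3 m : 0 < (3^-1 : R) ^+ m by rewrite exprn_gt0// invr_gt0.
have A01 m : 0 <= ((A m)%:R : R) <= 1 by case: (A m); rewrite ?lexx ?ler01.
have up m k : tm m <= tm (m + k)%N <= tm m + (3^-1) ^+ m - (3^-1) ^+ (m + k).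
  elim: k => [|k /andP[h1 h2]]; first by rewrite addn0 addrK lexx.
  rewrite addnS tS exprS; have := p3 (m + k)%N; have /andP[] := A01 (m + k)%N => *; nra.
pose t := sup (range tm).
have ub m : ubound (range tm) (tm m + (3^-1) ^+ m).
  move=> _ [k _ <-]; have [km|mk] := leqP k m.
    have := up k (m - k)%N; rewrite subnKC// => /andP[h _].
    by apply: le_trans h _; rewrite lerDl ltW.
  have := up m (k - m)%N; rewrite subnKC 1?ltnW// => /andP[_ /le_trans]; apply.
  by rewrite lerBlDr lerDl ltW.
have hs : has_sup (range tm) by split; [exists (tm 0%N), 0%N|exists (tm 0%N + 3^-1 ^+ 0); exact: ub].
have tl m : tm m <= t by apply: ub_le_sup; [exact: hs.2|exists m].
have tu m : t <= tm m + (3^-1) ^+ m by apply: ge_sup; [exact: hs.1|exact: ub].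
have tm0 : tm 0%N = 0 by rewrite /tm big_geq.
exists t; first by have := tl 0%N; have := tu 0%N; rewrite tm0 expr0 add0r => -> ->.
move=> m.
have [N EN] : exists N : nat, 3 ^+ m * tm m = (2 * N)%:R.
  elim: m => [|m [N EN]]; first by exists 0%N; rewrite tm0 mulr0.
  exists (3 * N + A m)%N; rewrite tS mulrDr exprS -mulrA EN.
  have -> : 3 * (3 ^+ m) * (2 * (A m)%:R * 3^-1 ^+ m.+1) = 2 * (A m)%:R :> R.
    have q : (3 : R) ^+ m.+1 * 3^-1 ^+ m.+1 = 1 by rewrite -exprMn mulfV ?expr1n.
    rewrite -exprS; transitivity (2 * (A m)%:R * (3 ^+ m.+1 * 3^-1 ^+ m.+1) : R); first ring.
    by rewrite q mulr1.
  by rewrite !natrM natrD natrM; ring.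
apply: (@clampc_digit N (A m) (3 ^+ m * (t - tm m.+1))).
  rewrite tS -EN.
  have -> : 2 * (A m)%:R / 3 = 3 ^+ m * (2 * (A m)%:R * 3^-1 ^+ m.+1) :> R.
    rewrite exprS [RHS]mulrC -!mulrA -exprMn mulVf ?expr1n//; ring.
  ring.
have := tl m.+1; have := tu m.+1; rewrite exprS => h1 h2.
have q3 : 0 < (3 : R) ^+ m by rewrite exprn_gt0.
rewrite mulr_ge0 ?subr_ge0// ?(ltW q3)//=.
have -> : (3^-1 : R) = 3 ^+ m * (3^-1 * 3^-1 ^+ m).
  by rewrite mulrCA -exprMn mulfV ?expr1n ?mulr1.
by rewrite ler_wpM2l ?(ltW q3)// lerBlDl.
Qed.

(** Schoenberg's curve: coordinate [i] reads the ternary digits of [t] whose ranks are [i] modulo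
    [n] and uses them as its binary digits. *)
Definition schoenberg (t : R) : 'rV[R]_n :=
  \row_i wsum (V := R^o) (geometric 2^-1 2^-1) (fun k t => clampc (3 ^+ (n * k + i) * t)) t.

Let s0 j : 0 <= geometric (2^-1 : R) 2^-1 j.
Proof. by rewrite /= mulr_ge0 ?exprn_ge0// invr_ge0. Qed.

Let cs : cvgn (series (geometric (2^-1 : R) 2^-1)).
Proof. by apply: is_cvg_geometric_series; rewrite ger0_norm ?invr_ge0// invf_lt1//; lra. Qed.

Lemma schoenberg_continuous i : continuous (fun t => schoenberg t 0 i).
Proof.
have -> : (fun t => schoenberg t 0 i) =
   wsum (V := R^o) (geometric 2^-1 2^-1) (fun k t => clampc (3 ^+ (n * k + i) * t)).
  by apply/funext => t; rewrite mxE.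
apply: (@wsum_continuous _ _ _ _ 1 s0 cs) => [j z|j z].
  by have /andP[h0 h1] := clampc_itv (3 ^+ (n * j + i) * z); rewrite ger0_norm.
apply: (@continuous_comp _ _ _ (fun t : R => 3 ^+ (n * j + i) * t) clampc).
  by apply: cvgMl_tmp; exact: cvg_id.
exact: clampc_continuous.
Qed.

Lemma schoenberg_bound t i :
  `|schoenberg t 0 i| <= limn (series (geometric (2^-1 : R) 2^-1)).
Proof.
rewrite mxE -[leRHS]mulr1; apply: (wsum_bound s0 cs) => j.
by have /andP[h0 h1] := clampc_itv (3 ^+ (n * j + i) * t); rewrite ger0_norm.
Qed.

Lemma schoenberg_surj (v : 'rV[R]_n) : unit_cube v ->
  exists2 t : R, 0 <= t <= 1 & schoenberg t = v.
Proof.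
move=> cv.
have /choice[a Ha] : forall i : 'I_n, exists a : nat -> bool,
    series (fun k => geometric 2^-1 2^-1 k * (a k)%:R) m @[m --> \oo] --> v 0 i.
  by move=> i; apply: binary_expansion; have := cv i; rewrite /= in_itv.
(* The binary digits of the coordinates are interleaved; the default value is reached only for
   [n = 0]. *)
pose A m := if insub (m %% n)%N is Some i then a i (m %/ n)%N else false.
have [t t01 Ht] := ternary_point A.
exists t => //; apply/rowP => i; rewrite mxE.
apply: cvg_lim => //.
rewrite (_ : (fun j => _) = (fun k => geometric 2^-1 2^-1 k * (a i k)%:R)); first exact: Ha.
apply/funext => k; rewrite Ht /A.
have n0 : (0 < n)%N by apply: leq_trans (ltn_ord i).
by rewrite mulnC modnMDl modn_small// valK divnMDl// divn_small// addn0.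
Qed.

Lemma torus_curve_continuous :
  continuous ((fun t => \pi_(torus R n) (schoenberg t)) : R -> torus R n).
Proof.
move=> t; apply: (@continuous_comp _ _ _ schoenberg (\pi_(torus R n))).
  have Ft := nbhs_filter t.
  apply/cvgrPdist_lt => e e0.
  have : \forall y \near t, forall j, `|schoenberg t 0 j - schoenberg y 0 j| < e.
    have := @filter_forall _ _ (fun j y => `|schoenberg t 0 j - schoenberg y 0 j| < e) _ Ft; apply=> j.
    by have /cvgrPdist_lt/(_ _ e0) := @schoenberg_continuous j t.
  apply: filterS => y Hy.
  change (mx_norm (schoenberg t - schoenberg y) < e).
  rewrite mx_normrE; apply: bigmax_lt => // -[i j] _ /=.
  by have := Hy j; rewrite !mxE.
exact: pi_torus_continuous.
Qed.

End Schoenberg.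

(** * Extraction of a subsequence converging in countably many coordinates *)

Section Diagonal.
Context (R : realType) (D : countType).

(** The sequence lives in a product of segments, compact by Tychonoff, and [g] is a cluster point.
    As [D] is countable, the neighbourhoods [B k], which control the coordinates of code at most [k]
    up to [1 / (k + 1)], are enough to pick a convergent subsequence. *)
Lemma diagonal_extraction (f : nat -> D -> R) (M : R) :
  (forall n i, `|f n i| <= M) ->
  exists phi : nat -> nat, exists g : D -> R,
    (forall k, (phi k < phi k.+1)%N) /\
    (forall i, f (phi k) i @[k --> \oo] --> g i).
Proof.
move=> fM.
have cpt := @tychonoff D (fun=> R) (fun=> `[- M, M]%classic)
  (fun=> @segment_compact R (- M) M).
have [|g [_ cg]] := cpt (f @ \oo) _.
  by exists 0%N => // n _ i /=; rewrite in_itv/= -ler_norml.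
pose B k := [set h : D -> R | forall j : 'I_k.+1,
  if unpickle j is Some i then is_true (`|h i - g i| < k.+1%:R^-1) else True].
have nB k : nbhs (g : prod_topology (fun=> R)) (B k).
  have Fg := @nbhs_filter (prod_topology (fun _ : D => R)) g.
  apply: (@filter_forall _ 'I_k.+1 (fun j h => if unpickle j is Some i then
    is_true (`|h i - g i| < k.+1%:R^-1) else True) _ Fg) => j /=.
  case: (unpickle j) => [i|]; last exact: filterT.
  have /(_ g) := @proj_continuous D (fun=> R) i.
  move=> /cvgrPdist_lt/(_ k.+1%:R^-1); rewrite invr_gt0 ltr0n => /(_ isT).
  by apply: filterS => h; rewrite distrC.
have pick m k : exists n, (m <= n)%N /\ B k (f n).
  have [|x [[n /= mn <-] Bn]] := cg ((fun h => exists2 n, (m <= n)%N & f n = h)) (B k) _ (nB k).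
    by exists m => // n /= mn; exists n.
  by exists n.
have /choice[p Hp] : forall mk : nat * nat, exists n, (mk.1 <= n)%N /\ B mk.2 (f n).
  by move=> [m k]; exact: pick.
pose phi := fix phi k := if k is k'.+1 then p ((phi k').+1, k) else p (0%N, 0%N).
exists phi, g; split=> [k|i]; first by have [] := Hp ((phi k).+1, k.+1).
apply/cvgrPdist_lt => e e0; near=> k.
have Bk : B k (f (phi k)).
  by case: (k) => [|m]; [have [] := Hp (0%N, 0%N)|have [] := Hp ((phi m).+1, m.+1)].
have ik : (pickle i < k.+1)%N by rewrite ltnS; near: k; exact: nbhs_infty_ge.
have := Bk (Ordinal ik); rewrite /= pickleK distrC => /lt_trans; apply.
near: k; have [m _ Hm] := near_infty_natSinv_lt (PosNum e0).
by exists m => // k mk; have := Hm k mk.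
Unshelve. all: by end_near. Qed.

End Diagonal.

(** * The uniform law and quantile functions *)

Section UniformLaw.
Context (R : realType).

Definition unif : probability (measurableTypeR R) R := uniform_prob (@ltr01 R).

Lemma unif_oc (c : R) : 0 <= c <= 1 -> unif `]-oo, c]%classic = c%:E.
Proof.
move=> /andP[c0 c1].
have mI : measurable (`]-oo, c]%classic : set R) by exact: measurable_itv.
have -> : unif `]-oo, c]%classic = (\int[unif]_x (\1_(`]-oo, c]%classic) x)%:E)%E.
  by rewrite integral_indic// setIT.
rewrite integral_uniform; last 2 first.
- exact/measurable_EFinP.
- by move=> x; rewrite lee_fin.
rewrite subr0 invr1 mul1e integral_indic//.
have -> : `]-oo, c]%classic `&` `[0, 1]%classic = `[0, c]%classic :> set R.
  apply/seteqP; split=> x /=; rewrite !in_itv/=; first by move=> [-> /andP[->]].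
  by move=> /andP[-> xc]; rewrite xc (le_trans xc).
rewrite [LHS](lebesgue_measure_itv `[0, c]%R)/= lte_fin.
by case: ltgtP c0 => // [_ _|<- _]; rewrite ?sube0.
Qed.

Lemma unif_oy (c : R) : 0 <= c <= 1 -> unif `]c, +oo[%classic = (1 - c)%:E.
Proof.
move=> c01; have -> : `]c, +oo[%classic = ~` `]-oo, c]%classic :> set R by rewrite setCitvl.
by rewrite probability_setC ?unif_oc//; exact: measurable_itv.
Qed.

Lemma probability_rays_unique (P Q : probability (measurableTypeR R) R) :
  (forall x : R, P `]x, +oo[%classic = Q `]x, +oo[%classic) ->
  forall A, measurable A -> P A = Q A.
Proof.
move=> PQ A mA.
have U := @measure_unique _ R (measurableTypeR R) (@RGenOInfty.G R)
  (fun k => `](- k%:R), +oo[%classic).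
apply: U mA.
- exact: RGenOInfty.measurableE.
- move=> _ _ [x ->] [y ->]; exists (Num.max x y).
  apply/seteqP; split=> z /=; rewrite !in_itv/= !andbT gt_max; first by move=> [-> ->].
  by move=> /andP[].
- by move=> k; exists (- k%:R).
- apply/seteqP; split=> // x _; exists (Num.trunc `|x|).+1 => //=.
  rewrite in_itv/= andbT ltrNl; apply: le_lt_trans (truncnS_gt _).
  by rewrite -normrN ler_norm.
- by move=> _ [x ->]; exact: PQ.
- by move=> k; rewrite ltey_eq fin_num_measure.
Qed.

Lemma quantile_exists (P : probability (measurableTypeR R) R) :
  P `[0, 1]%classic = 1%:E ->
  exists q : R -> R, [/\ {homo q : x y / x <= y}, forall u, 0 <= q u <= 1 &
    forall A, measurable A -> P A = unif (q @^-1` A)].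
Proof.
move=> P1.
pose F x := fine (P `]-oo, x]%classic).
have mray (x : R) : measurable (`]-oo, x]%classic : set R) by exact: measurable_itv.
have FE x : P `]-oo, x]%classic = (F x)%:E by rewrite fineK// fin_num_measure.
have F0 x : 0 <= F x by rewrite fine_ge0.
have F1 x : F x <= 1 by rewrite -lee_fin -FE probability_le1.
have Fmono : {homo F : x y / x <= y}.
  move=> x y xy; rewrite -lee_fin -!FE le_measure ?inE//.
  by move=> z /=; rewrite !in_itv/= => /le_trans; apply.
have Fone : F 1 = 1.
  apply/eqP; rewrite eq_le F1 -lee_fin -FE -P1 le_measure ?inE//.
  by move=> z /=; rewrite !in_itv/= => /andP[].
have Frc x (c : R) : (forall y, x < y -> c <= F y) -> c <= F x.
  move=> H.
  have mid : measurable_fun setT (@id R : measurableTypeR R -> R) by exact: measurable_id.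
  pose X : {RV P >-> R} := @mfun_Sub _ _ (measurableTypeR R) R _ (mem_set mid).
  have rc := @cdf_right_continuous _ _ R P X x.
  have {}rc : F y @[y --> x^'+] --> F x.
    by apply: fine_cvg; rewrite -FE; exact: rc.
  rewrite -(cvg_lim (@Rhausdorff R) rc).
  apply: limr_ge; first by apply/cvg_ex; exists (F x).
  by near=> y; apply: H; near: y; exact: nbhs_right_gt.
(* Capping [u] at 1 keeps 1 in [S u] for every real [u], so that the quantile function is
   nondecreasing with values in [[0, 1]] on the whole line. *)
pose S (u : R) := [set x : R | 0 <= x <= 1 /\ Num.min u 1 <= F x].
have S1 u : S u 1 by split; rewrite ?ler01 ?lexx// Fone ge_min lexx orbT.
have Slb u : lbound (S u) 0 by move=> x [/andP[]].
have hS u : has_inf (S u) by split; [exists 1|exists 0].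
pose q u := inf (S u).
have q01 u : 0 <= q u <= 1.
  by rewrite lb_le_inf ?ge_inf//; [exists 0|exists 1].
(* The Galois property of the generalized inverse; its direct implication is where the right
   continuity of the distribution function, in the form [Frc], enters. *)
have qle u x : 0 <= x -> x <= 1 -> (q u <= x) = (Num.min u 1 <= F x).
  move=> x0 x1; apply/idP/idP => [qx|h].
    apply: le_trans (_ : F (q u) <= _); last exact: Fmono.
    apply: Frc => y qy.
    have [z [_ Fz] zy] := inf_lt (hS u).1 qy.
    exact: le_trans Fz (Fmono _ _ (ltW zy)).
  by apply: ge_inf; [exists 0|split=> //; rewrite x0].
have qmono : {homo q : x y / x <= y}.
  move=> u v uv; have /andP[v0 v1] := q01 v; rewrite qle//.
  have := qle v (q v) v0 v1; rewrite lexx => /esym; apply: le_trans.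
  by rewrite le_min !ge_min uv lexx orbT.
have mq : measurable_fun setT (q : measurableTypeR R -> measurableTypeR R).
  by apply: nondecreasing_measurable => // x y _ _; exact: qmono.
exists q; split=> //.
pose X : {mfun measurableTypeR R >-> measurableTypeR R} :=
  @mfun_Sub _ _ (measurableTypeR R) (measurableTypeR R) q (mem_set mq).
move=> A mA; change (P A = distribution unif X A).
apply: probability_rays_unique mA => x.
change (P `]x, +oo[%classic = unif (q @^-1` `]x, +oo[)).
have -> : P `]x, +oo[%classic = (1 - F x)%:E.
  have -> : `]x, +oo[%classic = ~` `]-oo, x]%classic :> set R by rewrite setCitvl.
  by rewrite probability_setC// FE.
have [x0|x0] := ltP x 0.
  have -> : F x = 0.
    apply/eqP; rewrite eq_le F0 andbT -lee_fin -FE.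
    rewrite (@le_trans _ _ (P (~` `[0, 1]%classic)))//.
      rewrite le_measure ?inE//; first by apply: measurableC; exact: measurable_itv.
      by move=> z /=; rewrite !in_itv/= => zx /andP[/le_trans/(_ zx)]; rewrite leNgt x0.
    by rewrite probability_setC ?P1 ?subee//; exact: measurable_itv.
  rewrite subr0 (_ : q @^-1` _ = setT) ?probability_setT//.
  by apply/seteqP; split=> // u _ /=; rewrite in_itv/= andbT (lt_le_trans x0)//; have /andP[] := q01 u.
have [x1|x1] := ltP x 1; last first.
  have -> : F x = 1 by apply/eqP; rewrite eq_le F1 -Fone Fmono.
  rewrite subrr (_ : q @^-1` _ = set0) ?measure0//.
  apply/seteqP; split=> // u /=; rewrite in_itv/= andbT ltNge => /negP; apply.
  by apply: le_trans x1; have /andP[] := q01 u.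
have [Fx1|Fx1] := ltP (F x) 1; last first.
  have E : F x = 1 by apply/eqP; rewrite eq_le F1.
  rewrite E subrr (_ : q @^-1` _ = set0) ?measure0//.
  apply/seteqP; split=> // u /=; rewrite in_itv/= andbT ltNge => /negP; apply.
  by rewrite qle ?(ltW x1)// E ge_min lexx orbT.
rewrite -(@unif_oy (F x)) ?F0 ?F1//; congr (unif _).
apply/seteqP; split=> u /=; rewrite !in_itv/= !andbT !ltNge qle ?(ltW x1)// ge_min negb_or.
  by move=> -> /=; rewrite -ltNge.
by move=> /andP[].
Unshelve. all: by end_near. Qed.

Lemma unif_integrable (f : measurableTypeR R -> R) (M : R) :
  measurable_fun setT f -> (forall u, `|f u| <= M) ->
  unif.-integrable setT (EFin \o f).
Proof.
move=> mf fM; apply: measurable_bounded_integrable => //.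
- by rewrite -[ltLHS]/(unif [set: _]) probability_setT ltry.
- exists M; split; first exact: num_real.
  by move=> x Mx y _; apply: le_trans (fM y) (ltW Mx).
Qed.

End UniformLaw.

(** * Measures on the torus as laws on the curve, and their convergence *)

Section Curve.
Context (R : realType) (n : nat).
Local Notation T := (torus R n).

Definition curve (t : R) : T := \pi_T (@schoenberg R n t).

Lemma curve_continuous : continuous curve.
Proof. exact: torus_curve_continuous. Qed.

Lemma curve_surj (x : T) : exists2 t, 0 <= t <= 1 & curve t = x.
Proof.
have [v cv <-] := unit_cube_surj x; have [t t01 E] := schoenberg_surj cv.
by exists t => //; rewrite /curve E.
Qed.

Lemma curve_measurable (q : measurableTypeR R -> measurableTypeR R) : measurable_fun setT q ->
  measurable_fun setT (curve \o q : measurableTypeR R -> T).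
Proof.
move=> mq; apply: (@measurability _ _ _ T _ _ (@open T)) => //.
move=> _ [A oA <-]; rewrite setTI comp_preimage.
have oGA : open (curve @^-1` A) by apply: open_comp => // t _; exact: curve_continuous.
rewrite -[X in measurable X]setTI; apply: mq => //.
exact: open_measurable.
Qed.

(** The first parameter at which the curve passes through [x]; the fibre is compact, so this infimum
    is attained and gives a right inverse of the curve. *)
Definition curve_section (x : T) : R := inf [set t | 0 <= t <= 1 /\ curve t = x].

Lemma curve_sectionP (x : T) :
  0 <= curve_section x <= 1 /\ curve (curve_section x) = x.
Proof.
pose S := [set t | 0 <= t <= 1 /\ curve t = x].
have SE : S = `[0, 1]%classic `&` curve @^-1` [set x].
  by apply/seteqP; split=> t /=; rewrite in_itv.
have cS : compact S.
  rewrite SE; apply: compact_closedI; first exact: segment_compact.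
  apply: preimage_closed; first by move=> t _; exact: curve_continuous.
  apply: compact_closed; [exact: torus_hausdorff|exact: compact_set1].
have S0 : S !=set0 by have [t t01 E] := curve_surj x; exists t.
have bS : has_lbound S by exists 0 => t [/andP[]].
have cid : {within S, continuous (id : R -> R)} by apply: continuous_subspaceT => t; exact: cvg_id.
have [c + Hc] := compact_EVT_min S0 cS cid.
rewrite inE => Sc; suff -> : curve_section x = c by [].
apply/eqP; rewrite eq_le ge_inf//= lb_le_inf// => t St.
by apply: Hc; rewrite inE.
Qed.

(** The section exceeds [r] exactly off the image of the parameters in [[0, min 1 r]], which is
    compact, hence closed. *)
Lemma curve_section_measurable :
  measurable_fun setT (curve_section : T -> measurableTypeR R).
Proof.
apply: (measurability _ (RGenOInfty.measurableE R)).
move=> _ [_ [r ->] <-]; rewrite setTI.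
have -> : curve_section @^-1` `]r, +oo[%classic =
    ~` (curve @` [set t | 0 <= t <= 1 /\ t <= r]).
  apply/seteqP; split=> x /=; rewrite in_itv/= andbT.
    move=> rx [t [t01 tr] tx]; move: rx; rewrite ltNge => /negP; apply.
    by apply: le_trans tr; apply: ge_inf; [exists 0 => u [/andP[]]|split].
  move=> H; rewrite ltNge; apply/negP => xr; apply: H.
  have [s01 sx] := curve_sectionP x; by exists (curve_section x).
apply: sub_sigma_algebra; apply: closed_openC.
apply: compact_closed; first exact: torus_hausdorff.
apply: continuous_compact; first by apply: continuous_subspaceT; exact: curve_continuous.
rewrite (_ : mkset _ = `[0, Num.min 1 r]%classic); first exact: segment_compact.
apply/seteqP; split=> t /=; rewrite in_itv/= le_min; first by move=> [/andP[-> ->] ->].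
by move=> /and3P[-> -> ->].
Qed.

Definition law_of (mu : pmeas R n) (q : R -> R) : Prop :=
  forall A : set T, measurable A -> mu A = unif R ((curve \o q) @^-1` A).

(** The section pushes [mu] to a law on [[0, 1]], and [q] is its quantile function; the curve, of
    which the section is a right inverse, carries this law back to [mu]. *)
Lemma law_exists (mu : pmeas R n) : exists q : R -> R,
  [/\ {homo q : x y / x <= y}, forall u, 0 <= q u <= 1 & law_of mu q].
Proof.
pose X : {mfun T >-> measurableTypeR R} :=
  @mfun_Sub _ _ T (measurableTypeR R) _ (mem_set curve_section_measurable).
have [|q [hq q01 Hq]] := @quantile_exists R (distribution mu X).
  rewrite -(@probability_setT _ _ _ mu); congr (mu _).
  apply/seteqP; split=> // x _ /=; rewrite in_itv/=.
  by have [] := curve_sectionP x.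
exists q; split=> // A mA.
have mG : measurable (curve @^-1` A : set (measurableTypeR R)).
  by rewrite -[X in measurable X]setTI; apply: (@curve_measurable id) => //; exact: measurable_id.
rewrite -[RHS](Hq _ mG); congr (mu _).
apply/seteqP; split=> x /=; by have [_ ->] := curve_sectionP x.
Qed.

Lemma law_mfun_exists (q : measurableTypeR R -> measurableTypeR R) :
  measurable_fun setT q -> exists mu : pmeas R n, law_of mu q.
Proof.
move=> mq; pose X : {mfun measurableTypeR R >-> T} :=
  @mfun_Sub _ _ (measurableTypeR R) T _ (mem_set (curve_measurable mq)).
by exists (distribution (unif R) X).
Qed.

Lemma law_pair_p mu (q : measurableTypeR R -> measurableTypeR R) (g : T -> R) :
  measurable_fun setT q -> law_of mu q -> continuous g ->
  pair_p g mu = \int[unif R]_u g (curve (q u)).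
Proof.
move=> mq lq cg; pose X : {mfun measurableTypeR R >-> T} :=
  @mfun_Sub _ _ (measurableTypeR R) T _ (mem_set (curve_measurable mq)).
have -> : pair_p g mu = pair_p g (distribution (unif R) X).
  by apply: pair_p_eq.
have ig : (distribution (unif R) X : probability _ _).-integrable setT (EFin \o g).
  exact: torus_integrable.
rewrite /pair_p /Rintegral; congr fine.
rewrite integral_pushforward//.
- apply/measurable_EFinP; exact: torus_measurable_continuous.
- have [M HM] := torus_bounded cg.
  apply: (@unif_integrable _ _ M) => //.
  apply: measurableT_comp (curve_measurable mq).
  exact: torus_measurable_continuous.
Qed.

Lemma W1_ge0 (mu nu : pmeas R n) : 0 <= W1 mu nu.
Proof.
rewrite /W1; set S := [set _ | _ in _].
have S0 : lbound S 0.
  by move=> _ [pi _ <-]; apply: Rintegral_ge0 => z _; exact: tdist_ge0.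
have [->|/set0P Sn] := eqVneq S set0; first by rewrite inf0.
exact: lb_le_inf.
Qed.

Definition path_gap (a b : R -> R) (u : R) : R :=
  \sum_(i < n) `|schoenberg n (a u) 0 i - schoenberg n (b u) 0 i|.

Let Cg : R := \sum_(i < n) (limn (series (geometric (2^-1 : R) 2^-1)) +
                             limn (series (geometric (2^-1 : R) 2^-1))).

Lemma path_gap_bound a b u : `|path_gap a b u| <= Cg.
Proof.
rewrite ger0_norm ?sumr_ge0//; apply: ler_sum => i _.
by apply: le_trans (ler_normB _ _) (lerD _ _); exact: schoenberg_bound.
Qed.

Lemma path_gap_measurable (a b : measurableTypeR R -> measurableTypeR R) :
  measurable_fun setT a -> measurable_fun setT b ->
  measurable_fun setT (path_gap a b : measurableTypeR R -> R).
Proof.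
move=> ma mb; apply: measurable_sum => i.
apply: measurableT_comp => //; apply: measurable_funB.
  exact: (measurableT_comp (continuous_measurable_fun (@schoenberg_continuous R n i)) ma).
exact: (measurableT_comp (continuous_measurable_fun (@schoenberg_continuous R n i)) mb).
Qed.

Import HBNNSimple.

(** The joint law of the two parametrized points is a coupling, and [path_gap] is the l1 distance
    between their lifts, which dominates [tdist]. *)
Lemma W1_law_le (mu nu : pmeas R n) (a b : measurableTypeR R -> measurableTypeR R) :
  measurable_fun setT a -> measurable_fun setT b -> law_of mu a -> law_of nu b ->
  W1 mu nu <= \int[unif R]_u path_gap a b u.
Proof.
move=> ma mb la lb.
pose c u : T * T := (curve (a u), curve (b u)).
have mc : measurable_fun setT c.
  by apply: measurable_fun_pair; exact: curve_measurable.
pose C : {mfun measurableTypeR R >-> (T * T)%type} :=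
  @mfun_Sub _ _ (measurableTypeR R) (T * T)%type _ (mem_set mc).
pose pi : probability (T * T)%type R := distribution (unif R) C.
have cpl : is_coupling mu nu pi.
  move=> A mA; split; [rewrite (la A mA)|rewrite (lb A mA)]; congr (unif R _);
  by apply/seteqP; split => u //= [].
apply: (@le_trans _ _ (\int[pi]_z tdist z.1 z.2)).
  apply: ge_inf; last by exists pi.
  by exists 0 => _ [pi' _ <-]; apply: Rintegral_ge0 => z _; exact: tdist_ge0.
have gi := unif_integrable (path_gap_measurable ma mb) (path_gap_bound a b).
have gap0 u : 0 <= path_gap a b u by apply: sumr_ge0.
have J0 : (0 <= \int[pi]_z (tdist z.1 z.2)%:E)%E.
  by apply: integral_ge0 => z _; rewrite lee_fin tdist_ge0.
(* The integral of a nonnegative function is a supremum over the simple functions [h] below it;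
   these are measurable, and the pushforward formula is applied to each of them rather than to
   [tdist]. *)
have JK : (\int[pi]_z (tdist z.1 z.2)%:E <= \int[unif R]_u (path_gap a b u)%:E)%E.
  rewrite ge0_integralTE; last by move=> z; rewrite lee_fin tdist_ge0.
  apply: ge_ereal_sup => _ [h hle <-].
  rewrite -integralT_nnsfun ge0_integral_pushforward//=; last 2 first.
    by apply/measurable_EFinP; exact: (measurable_funPT h).
    by move=> z _; rewrite lee_fin.
  rewrite preimage_setT; apply: ge0_le_integral => //=.
  - by move=> u _; rewrite lee_fin.
  - apply/measurable_EFinP; exact: (measurableT_comp (measurable_funPT h) mc).
  - by apply/measurable_EFinP; exact: path_gap_measurable.
  - move=> u _; apply: le_trans (hle _) _; rewrite lee_fin; exact: tdist_pi_le.
have Kfin : (\int[unif R]_u (path_gap a b u)%:E)%E \is a fin_num.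
  exact: integrable_fin_num gi.
apply: fine_le => //; rewrite ge0_fin_numE//.
by apply: le_lt_trans JK _; rewrite ltey_eq Kfin.
Qed.

(** Convergence of measures in the form of a Skorokhod representation: all of them are laws over the
    same uniform space, with parameters that converge almost everywhere. Convergence in [W1] and of
    integrals both become dominated convergence. *)
Definition law_cvg (mun : nat -> pmeas R n) (mu : pmeas R n) : Prop :=
  exists qn : nat -> measurableTypeR R -> measurableTypeR R,
  exists q : measurableTypeR R -> measurableTypeR R,
  [/\ forall k, measurable_fun setT (qn k) /\ law_of (mun k) (qn k),
      measurable_fun setT q, law_of mu q &
      {ae unif R, forall u, (qn k u : R) @[k --> \oo] --> (q u : R)}].

Lemma unif_dominated (f : nat -> measurableTypeR R -> R) (g : measurableTypeR R -> R) (M : R) :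
  (forall k, measurable_fun setT (f k)) -> measurable_fun setT g ->
  (forall k u, `|f k u| <= M) -> {ae unif R, forall u, f k u @[k --> \oo] --> g u} ->
  \int[unif R]_u f k u @[k --> \oo] --> \int[unif R]_u g u.
Proof.
move=> mf mg fM fg.
have [|||||ig _ H] := @dominated_convergence _ _ R (unif R) setT measurableT
  (fun k u => (f k u)%:E) (EFin \o g) (EFin \o cst M).
- by move=> k; exact/measurable_EFinP.
- exact/measurable_EFinP.
- by apply: filterS fg => u Hu _; apply: cvg_EFin Hu; exact: nearW.
- by apply: (@unif_integrable _ _ `|M|).
- by apply: aeW => u k _; rewrite lee_fin.
apply: fine_cvg; rewrite fineK//.
exact: integrable_fin_num ig.
Qed.

Lemma law_cvg_W1 mun mu : law_cvg mun mu -> W1 mu (mun k) @[k --> \oo] --> 0.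
Proof.
move=> [qn [q [mqn mq lq cq]]].
have H : \int[unif R]_u path_gap q (qn k) u @[k --> \oo] --> \int[unif R]_u (fun=> 0) u.
  apply: (@unif_dominated _ _ Cg) => //.
  - by move=> k; apply: path_gap_measurable => //; case: (mqn k).
  - by move=> k u; exact: path_gap_bound.
  - apply: filterS cq => u Hu.
    have E : \sum_(i < n) `|schoenberg n (q u) 0 i - schoenberg n (q u) 0 i| = 0.
      by apply: big1 => i _; rewrite subrr normr0.
    rewrite -E /path_gap; apply: cvg_sumr => i; apply: cvg_norm.
    apply: cvgB; first exact: cvg_cst.
    exact: (cvg_comp _ _ Hu (@schoenberg_continuous R n i (q u))).
rewrite Rintegral_cst// mul0r in H.
apply: (@squeeze_cvgr _ _ _ _ (fun=> 0) _ _ _ _ _ H); last exact: cvg_cst.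
near=> k; have [mk lk] := mqn k.
by rewrite W1_ge0/=; exact: W1_law_le.
Unshelve. all: by end_near. Qed.

(** The integrand varies with [k] because it will be a slice of [U] taken at times, measures and
    parameters that depend on [k]. The last hypothesis is continuous convergence along the curve,
    exactly what dominated convergence asks for after passing to the uniform law. *)
Lemma law_cvg_pair mun mu (g : nat -> T -> R) (h : T -> R) (M : R) :
  law_cvg mun mu -> (forall k, continuous (g k)) -> continuous h ->
  (forall k x, `|g k x| <= M) ->
  (forall (tk : nat -> R) t, tk k @[k --> \oo] --> t ->
     g k (curve (tk k)) @[k --> \oo] --> h (curve t)) ->
  pair_p (g k) (mun k) @[k --> \oo] --> pair_p h mu.
Proof.
move=> [qn [q [mqn mq lq cq]]] cg ch gM H.
rewrite (law_pair_p mq lq ch).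
rewrite (_ : (fun k => pair_p (g k) (mun k)) = fun k => \int[unif R]_u g k (curve (qn k u))); last first.
  by apply/funext => k; have [mk lk] := mqn k; rewrite (law_pair_p mk lk).
apply: (@unif_dominated _ _ M) => //.
- move=> k; have [mk lk] := mqn k.
  exact: (measurableT_comp (torus_measurable_continuous (cg k)) (curve_measurable mk)).
- exact: (measurableT_comp (torus_measurable_continuous ch) (curve_measurable mq)).
- by apply: filterS cq => u Hu; exact: H.
Qed.

(** With [a u] the supremum of the rational limits to the left of [u] and [c u] the infimum of those
    to the right, monotonicity squeezes the sequence to [a u] wherever [c u <= a u]. The other
    points are the jumps, of which there are countably many. *)
Lemma helly (qn : nat -> R -> R) (g : rat -> R) :
  (forall k, {homo qn k : x y / x <= y}) -> (forall k u, 0 <= qn k u <= 1) ->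
  (forall r, qn k (ratr r) @[k --> \oo] --> g r) ->
  exists q : R -> R, {homo q : x y / x <= y} /\
    {ae unif R, forall u : measurableTypeR R, qn k u @[k --> \oo] --> q u}.
Proof.
move=> hq q01 qg.
have g01 r : 0 <= g r <= 1.
  rewrite -(cvg_lim (@Rhausdorff R) (qg r)); apply/andP; split.
    apply: limr_ge; first by apply/cvg_ex; exists (g r).
    by apply: nearW => k; have /andP[] := q01 k (ratr r).
  apply: limr_le; first by apply/cvg_ex; exists (g r).
  by apply: nearW => k; have /andP[] := q01 k (ratr r).
pose A (u : R) := [set x : R | x = 0 \/ exists2 r : rat, ratr r < u & x = g r].
pose C (u : R) := [set x : R | x = 1 \/ exists2 r : rat, u < ratr r & x = g r].
have hA u : has_sup (A u).
  split; first by exists 0; left.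
  by exists 1 => x [->//|[r _ ->]]; have /andP[] := g01 r.
have hC u : has_inf (C u).
  split; first by exists 1; left.
  by exists 0 => x [->//|[r _ ->]]; have /andP[] := g01 r.
pose a u := sup (A u); pose c u := inf (C u).
have amono : {homo a : u v / u <= v}.
  move=> u v uv; apply: sup_le_ub; first exact: (hA u).1.
  move=> x Ax; apply: ub_le_sup; first exact: (hA v).2.
  case: Ax => [->|[r ru ->]]; first by left.
  by right; exists r => //; apply: lt_le_trans uv.
have ca u v : u < v -> c u <= a v.
  move=> /rat_in_itvoo[r]; rewrite in_itv/= => /andP[ur rv].
  apply: (@le_trans _ _ (g r)).
    by apply: ge_inf; [exact: (hC u).2|right; exists r].
  by apply: ub_le_sup; [exact: (hA v).2|right; exists r].
exists a; split=> //.
(* A jump contains a rational level; since [c u <= a v] for [u < v], two distinct jumps cannot share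
   one. *)
pose Bad (r : rat) := [set u : R | a u < ratr r < c u].
have Bad1 r u v : Bad r u -> Bad r v -> u = v.
  move=> /andP[u1 u2] /andP[v1 v2].
  have [uv|vu|//] := ltgtP u v.
    by have := lt_trans (lt_le_trans u2 (ca _ _ uv)) v1; rewrite ltxx.
  by have := lt_trans (lt_le_trans v2 (ca _ _ vu)) u1; rewrite ltxx.
have cB : countable (\bigcup_r Bad r).
  apply: bigcup_countable => // r _.
  have [->|/set0P[u Bu]] := eqVneq (Bad r) set0; first exact: countable0.
  rewrite (_ : Bad r = [set u]); first exact: countable1.
  by apply/seteqP; split=> [v Bv|v ->//]; exact: Bad1 Bv Bu.
have mB : measurable (\bigcup_r Bad r : set (measurableTypeR R)).
  apply: countable_measurable cB => u; exact: measurable_set1.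
exists (\bigcup_r Bad r); split=> //.
  have dom := dominates_uniform_prob (@ltr01 R).
  apply/(measure0_null_setP (unif R) mB); apply: dom.
  apply/(measure0_null_setP (@lebesgue_measure R) mB).
  exact: countable_lebesgue_measure0.
move=> u /= Hu; apply: contrapT => nB; apply: Hu.
have ac : c u <= a u.
  rewrite leNgt; apply/negP => /rat_in_itvoo[r]; rewrite in_itv/= => h.
  by apply: nB; exists r.
apply/cvgrPdist_le => e e0.
have e2 : 0 < e / 2 by rewrite divr_gt0.
have lo : \forall k \near \oo, a u - e <= qn k u.
  have [x Ax xa] := sup_adherent e2 (hA u).
  case: Ax => [x0|[r ru xr]].
    apply: nearW => k; have /andP[h _] := q01 k u; apply: le_trans h.
    by move: xa; rewrite x0 -/(a u); lra.
  have /cvgrPdist_le/(_ _ e2) := qg r.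
  apply: filterS => k; rewrite ler_norml => /andP[h1 h2].
  have := hq k _ _ (ltW ru); move: xa; rewrite xr -/(a u); lra.
have hi : \forall k \near \oo, qn k u <= a u + e.
  have [x Cx xc] := inf_adherent e2 (hC u).
  case: Cx => [x1|[r ur xr]].
    apply: nearW => k; have /andP[_ h] := q01 k u; apply: le_trans h _.
    by move: xc; rewrite x1 -/(c u); lra.
  have /cvgrPdist_le/(_ _ e2) := qg r.
  apply: filterS => k; rewrite ler_norml => /andP[h1 h2].
  have := hq k _ _ (ltW ur); move: xc; rewrite xr -/(c u); lra.
near=> k; rewrite ler_norml; apply/andP; split.
  have : qn k u <= a u + e by near: k.
  lra.
have : a u - e <= qn k u by near: k.
lra.
Unshelve. all: by end_near. Qed.

End Curve.

(** * Smooth functions that determine a measure *)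

Section Separation.
Context (R : realType) (n : nat).
Local Notation T := (torus R n).
Local Notation J := ('I_n * bool)%type.

(** A smooth approximation of the indicator of [orthant r]: with [a = trigc j x - ratr (r j)], the
    inner exponent [N - N^2 a] tends to minus infinity if [a > 0] and is at least [N] if [a <= 0],
    boundary included. *)
Definition psi (N : nat) (r : {ffun J -> rat}) (x : T) : R :=
  expR (- \sum_(j : J) expR (N%:R - N%:R ^+ 2 * (trigc j x - ratr (r j)))).

Lemma psi_itv N r x : 0 <= psi N r x <= 1.
Proof.
rewrite expR_ge0 /psi -expR0 ler_expR oppr_le0.
by apply: sumr_ge0 => j _; exact: expR_ge0.
Qed.

Lemma psi_continuous N r : continuous (psi N r).
Proof.
have c1 : continuous (fun x : T => \sum_(j : J) expR (N%:R - N%:R ^+ 2 * (trigc j x - ratr (r j))) : R).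
  apply: continuous_sumr => j x.
  apply: (@continuous_comp _ _ _ (fun x => N%:R - N%:R ^+ 2 * (trigc j x - ratr (r j))) expR);
    last exact: continuous_expR.
  have Fx := nbhs_filter x.
  apply: cvgB; first exact: cvg_cst.
  apply: cvgMl_tmp; apply: cvgB; [exact: trigc_continuous|exact: cvg_cst].
move=> x; apply: (@continuous_comp _ _ _ (fun x => - \sum_(j : J)
  expR (N%:R - N%:R ^+ 2 * (trigc j x - ratr (r j)))) expR); last exact: continuous_expR.
by have Fx := nbhs_filter x; apply: cvgN; exact: c1.
Qed.

Definition orthant (r : {ffun J -> rat}) : set T :=
  [set x | forall j, ratr (r j) < trigc j x].

Lemma expRN_nat_cvg : (expR (- N%:R) : R) @[N --> \oo] --> 0.
Proof.
apply: (@squeeze_cvgr _ _ _ _ (fun=> 0) (fun N => N.+1%:R^-1)).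
- near=> N; rewrite expR_ge0/= expRN lef_pV2 ?posrE ?expR_gt0//.
  by rewrite -natr1 addrC; exact: expR_ge1Dx.
- exact: cvg_cst.
- exact: cvg_harmonic.
Unshelve. all: by end_near. Qed.

Lemma psi_cvg r x : psi N r x @[N --> \oo] --> (\1_(orthant r) x : R).
Proof.
rewrite indicE; have [Ox|nOx] := pselect (orthant r x).
  rewrite mem_set//= -expR0 -[in X in _ --> X]oppr0.
  rewrite -[0 in X in _ --> X](_ : \sum_(j : J) 0 = 0); last by rewrite big1.
  apply: (@cvg_comp _ _ _ (fun N => - \sum_(j : J) expR (N%:R - N%:R ^+ 2 * (trigc j x - ratr (r j)))) expR); last exact: continuous_expR.
  apply: cvgN; apply: cvg_sumr => j.
  apply: (@squeeze_cvgr _ _ _ _ (fun=> 0) (fun N => expR (- N%:R))); last 2 first.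
  - exact: cvg_cst.
  - exact: expRN_nat_cvg.
  have a0 : 0 < trigc j x - ratr (r j) by rewrite subr_gt0; exact: Ox.
  near=> N; rewrite expR_ge0/= ler_expR.
  have : 2 / (trigc j x - ratr (r j)) <= N%:R by near: N; exact: nbhs_infty_ger.
  rewrite ler_pdivrMr// => h; have N0 : 0 <= N%:R :> R by rewrite ler0n.
  have := ler_wpM2l N0 h; rewrite expr2; lra.
have -> : x \in orthant r = false by apply/negP; rewrite inE.
have [j jx] : exists j, trigc j x <= ratr (r j).
  by apply: contrapT => H; apply: nOx => j; rewrite ltNge; apply/negP => h; apply: H; exists j.
apply: (@squeeze_cvgr _ _ _ _ (fun=> 0) (fun N => expR (- N%:R))); last 2 first.
- exact: cvg_cst.
- exact: expRN_nat_cvg.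
near=> N; rewrite expR_ge0/= ler_expR lerN2.
rewrite (bigD1 j)//=; apply: (@le_trans _ _ (expR N%:R)).
  by apply: le_trans (expR_ge1Dx _); rewrite lerDr.
apply: (@le_trans _ _ (expR (N%:R - N%:R ^+ 2 * (trigc j x - ratr (r j))))); last first.
  by rewrite lerDl; apply: sumr_ge0 => i _; exact: expR_ge0.
by rewrite ler_expR lerDl oppr_ge0 mulr_ge0_le0 ?sqr_ge0// subr_le0.
Unshelve. all: by end_near. Qed.

Lemma orthant_open r : open (orthant r).
Proof.
rewrite openE => x Ox; rewrite /interior.
have Fx := nbhs_filter x; apply: (@filter_forall _ _ _ _ Fx) => j.
have /cvgrPdist_lt/(_ (trigc j x - ratr (r j))) := @trigc_continuous R n j x.
rewrite subr_gt0 => /(_ (Ox j)); apply: filterS => y.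
by have := ler_norm (trigc j x - trigc j y); lra.
Qed.

Lemma orthant_measurable r : measurable (orthant r).
Proof. by apply: sub_sigma_algebra; exact: orthant_open. Qed.

Lemma pair_psi_cvg (mu : pmeas R n) r :
  pair_p (psi N r) mu @[N --> \oo] --> fine (mu (orthant r)).
Proof.
have mO := orthant_measurable r.
have [|||||_ _ H] := @dominated_convergence _ _ R mu setT measurableT
  (fun N x => (psi N r x)%:E) (EFin \o \1_(orthant r)) (EFin \o cst 1).
- by move=> N; apply/measurable_EFinP; apply: torus_measurable_continuous; exact: psi_continuous.
- exact/measurable_EFinP.
- by apply: aeW => x _; apply: cvg_EFin; [exact: nearW|exact: psi_cvg].
- by apply: torus_integrable; exact: cst_continuous.
- by apply: aeW => x N _; rewrite lee_fin /=; have /andP[h0 h1] := psi_itv N r x; rewrite ger0_norm.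
rewrite integral_indic// setIT in H.
by apply: fine_cvg; rewrite fineK// fin_num_measure.
Qed.

Let G : set (set T) := range orthant.

(** A half-space [q < trigc j] is the orthant whose other thresholds are -2, below every value of
    the coordinates. Rational boxes are finite intersections of differences of half-spaces, and by
    [torus_box] an open set is a countable union of them. *)
Lemma open_orthants (U : set T) : open U -> <<s G >> U.
Proof.
move=> oU.
pose S := g_sigma_algebraType G.
have mO r : measurable (orthant r : set S) by apply: sub_sigma_algebra; exists r.
have m1 j (q : rat) : measurable ([set x | ratr q < trigc j x] : set S).
  rewrite (_ : [set x | _] = orthant [ffun i => if i == j then q else - 2]) //.
  apply/seteqP; split=> x /=; last by move=> /(_ j); rewrite ffunE eqxx.
  move=> qx i; rewrite ffunE; case: eqP => [->//|_].
  have := trigc_bound i x; rewrite ler_norml => /andP[h _].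
  apply: lt_le_trans h; rewrite rmorphN /= ltrN2.
  by rewrite (_ : ratr 2 = 2) ?ltr1n// ratr_nat.
pose box (rs : {ffun J -> rat} * {ffun J -> rat}) : set T :=
  [set x | forall j, ratr (rs.1 j) < trigc j x /\ trigc j x <= ratr (rs.2 j)].
have mbox rs : measurable (box rs : set S).
  have -> : box rs = \bigcap_(j in [set: J])
      ([set x | ratr (rs.1 j) < trigc j x] `\` [set x | ratr (rs.2 j) < trigc j x]).
    apply/seteqP; split=> x H j.
      by move=> _; have [h1 h2] := H j; split=> //=; rewrite ltNge h2.
    by have [h1 /= /negP] := H j Logic.I; rewrite -leNgt.
  apply: (@fin_bigcap_measurable _ S) => [|j _]; first exact: finite_finset.
  apply: measurableD; exact: m1.
suff -> : U = \bigcup_(rs in setT) (if `[< box rs `<=` U >] then box rs else set0).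
  apply: (@countable_bigcupT_measurable _ S) => [|rs]; first exact: countableP.
  by case: ifP => _ //; exact: measurable0.
apply/seteqP; split=> x; last by move=> [rs _]; case: ifPn => // /asboolP; exact.
move=> Ux; have [e e0 He] := torus_box oU Ux.
have /choice[r Hr] : forall j : J, exists q : rat, trigc j x - e < ratr q < trigc j x.
  move=> j; have /rat_in_itvoo[q] : trigc j x - e < trigc j x by rewrite ltrBlDr ltrDl.
  by rewrite in_itv/=; exists q.
have /choice[s Hs] : forall j : J, exists q : rat, trigc j x < ratr q < trigc j x + e.
  move=> j; have /rat_in_itvoo[q] : trigc j x < trigc j x + e by rewrite ltrDl.
  by rewrite in_itv/=; exists q.
exists ([ffun j => r j], [ffun j => s j]) => //.
rewrite asboolT /=; last first.
  move=> y By; apply: He => j; have [] := By j; rewrite !ffunE => h1 h2.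
  have /andP[h3 h4] := Hr j; have /andP[h5 h6] := Hs j.
  by rewrite ltr_norml; apply/andP; split; lra.
move=> j; rewrite !ffunE.
by have /andP[_ ->] := Hr j; have /andP[/ltW -> _] := Hs j.
Qed.

(** As [N] tends to infinity the measures agree on orthants, which are stable under intersection,
    include the whole torus (thresholds -2) and generate the Borel sets. *)
Lemma pair_psi_eq (mu nu : pmeas R n) :
  (forall N r, pair_p (psi N r) mu = pair_p (psi N r) nu) -> pmeas_eq mu nu.
Proof.
move=> H A mA.
have GA : <<s G >> A.
  by apply: smallest_sub mA; [exact: smallest_sigma_algebra|exact: open_orthants].
apply: (@g_sigma_algebra_measure_unique _ R T G _ (fun=> orthant [ffun=> - 2])) GA => //.
- by move=> _ [r _ <-]; exact: orthant_measurable.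
- by move=> k; exists [ffun=> - 2].
- apply/seteqP; split=> // x _; exists 0%N => // j; rewrite ffunE.
  have := trigc_bound j x; rewrite ler_norml => /andP[h _].
  apply: lt_le_trans h; rewrite rmorphN /= ltrN2.
  by rewrite (_ : ratr 2 = 2) ?ltr1n// ratr_nat.
- move=> _ _ [r _ <-] [s _ <-]; exists [ffun j => Num.max (r j) (s j)] => //.
  apply/seteqP; split=> x.
    move=> Hx; split=> j; have := Hx j; rewrite ffunE; apply: le_lt_trans;
    by rewrite ler_rat le_max lexx ?orbT.
  by move=> [H1 H2] j; rewrite ffunE; case: (leP (r j) (s j)) => _; [exact: H2|exact: H1].
- move=> _ [r _ <-].
  have E : fine (mu (orthant r)) = fine (nu (orthant r)).
    rewrite -(cvg_lim (@Rhausdorff R) (@pair_psi_cvg mu r)) -(cvg_lim (@Rhausdorff R) (@pair_psi_cvg nu r)).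
    by congr (limn _); apply/funext => N; exact: H.
  have mO := orthant_measurable r.
  by rewrite -[LHS]fineK ?fin_num_measure// -[RHS]fineK ?fin_num_measure// E.
- by move=> k; rewrite ltey_eq fin_num_measure//; exact: orthant_measurable.
Qed.

End Separation.

(** * A variational principle with prescribed perturbations *)

Section VariationalPrinciple.
Context (R : realType) (Z : Type).
Implicit Types (W e : Z -> R).

(* Near-minimizers of [W + s e] have [e]-values that decrease with [s], so that
   they cannot oscillate by [tau] at every point of a fine grid of [s]. *)
Lemma slope_step W e (b tau : R) : (forall z, `|e z| <= 1) -> 0 < b -> 0 < tau ->
  exists s eta : R, [/\ 0 <= s <= b, 0 < eta & forall z z',
    (forall y, W z + s * e z <= W y + s * e y + eta) ->
    (forall y, W z' + s * e z' <= W y + s * e y + eta) -> `|e z - e z'| <= tau].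
Proof.
move=> e1 b0 t0; apply: contrapT => H.
(* [e] ranges in [[-1, 1]] and each of the [N] grid steps will lower it by at least [tau / 2];
   [N * tau > 4] makes this impossible. *)
pose N := (Num.trunc (4 / tau)).+1.
have N0 : 0 < N%:R :> R by rewrite ltr0n.
have NT : 4 < N%:R * tau.
  by rewrite -ltr_pdivrMr// /N; exact: truncnS_gt.
(* Comparing near-minimizers at consecutive grid values shows that [e] rises by at most
   [2 * eta * N / b = tau / 2] from one to the next, against a drop of more than [tau] at each grid
   value. *)
pose eta := tau * b / (4 * N%:R).
have eta0 : 0 < eta by rewrite divr_gt0 ?mulr_gt0.
pose sk (k : nat) : R := k%:R * (b / N%:R).
have bN0 : 0 < b / N%:R by rewrite divr_gt0.
have bad k : (k <= N)%N -> exists zz : Z * Z,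
    [/\ forall y, W zz.1 + sk k * e zz.1 <= W y + sk k * e y + eta,
        forall y, W zz.2 + sk k * e zz.2 <= W y + sk k * e y + eta &
        tau < e zz.1 - e zz.2].
  move=> kN; apply: contrapT => nex; apply: H; exists (sk k), eta; split=> //.
    rewrite mulr_ge0 ?(ltW bN0)//= /sk mulrA ler_pdivrMr// mulrC ler_wpM2l ?(ltW b0)//.
    by rewrite ler_nat.
  move=> z z' Hz Hz'; rewrite ler_norml; apply/andP; split; rewrite leNgt; apply/negP => h.
    by apply: nex; exists (z', z); split=> //=; lra.
  by apply: nex; exists (z, z').
have /choice[zz Hzz] : forall k, exists zz : Z * Z, (k <= N)%N ->
    [/\ forall y, W zz.1 + sk k * e zz.1 <= W y + sk k * e y + eta,
        forall y, W zz.2 + sk k * e zz.2 <= W y + sk k * e y + eta &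
        tau < e zz.1 - e zz.2].
  move=> k; have [kN|nkN] := boolP (k <= N)%N; first by have [zz] := bad k kN; exists zz.
  by have [zz _] := bad 0%N isT; exists zz.
have desc k : (k <= N)%N -> e (zz k).2 <= 1 - k%:R * (tau / 2).
  elim: k => [|k IH] kN.
    by rewrite mul0r subr0 (le_trans (ler_norm _)).
  have [h1 h2 h3] := Hzz k (ltnW kN); have [g1 g2 g3] := Hzz k.+1 kN.
  have {}IH := IH (ltnW kN).
  have := h2 (zz k.+1).1; have := g1 (zz k).2.
  set x := e (zz k.+1).1; set y := e (zz k).2.
  have -> : sk k.+1 = sk k + b / N%:R by rewrite /sk -natr1 mulrDl mul1r.
  move=> i1 i2; have i3 : (b / N%:R) * (x - y) <= 2 * eta by lra.
  have i4 : x - y <= tau / 2.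
    rewrite -(ler_pM2l bN0); apply: le_trans i3 _; rewrite /eta le_eqVlt; apply/orP; left.
    by apply/eqP; field; rewrite gt_eqF.
  by move: g3 IH i4; rewrite -/x -/y -[k.+1%:R]natr1 mulrDl mul1r; lra.
have := desc N (leqnn N); have := e1 (zz N).2; rewrite ler_norml => /andP[h _].
lra.
Qed.

(** [slope_step] is applied to [e 0], [e 1], ... in turn, each time to the function perturbed so
    far, with later weights so small that an exact minimizer of the limit is still a near-minimizer
    at every stage. [Winf] is characterized by the tail bound alone, because the limit will be given
    as a cost containing [A] and [B]. *)
Lemma perturbed_minimum W (e : nat -> Z -> R) (b : R) :
  (forall j z, `|e j z| <= 1) -> 0 < b ->
  exists s : nat -> R, [/\ forall j, 0 <= s j, cvgn (series s), limn (series s) <= b &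
    forall Winf, (forall n z, `|Winf z - (W z + \sum_(0 <= j < n) s j * e j z)| <=
        limn (series s) - series s n) ->
      forall z z', (forall y, Winf z <= Winf y) -> (forall y, Winf z' <= Winf y) ->
      forall j, `|e j z - e j z'| <= j.+1%:R^-1].
Proof.
move=> e1 b0.
have /choice[f Hf] : forall x : (Z -> R) * R * nat, exists y : R * R, 0 < x.1.2 ->
    [/\ 0 <= y.1 <= x.1.2, 0 < y.2 & forall z z',
    (forall t, x.1.1 z + y.1 * e x.2 z <= x.1.1 t + y.1 * e x.2 t + y.2) ->
    (forall t, x.1.1 z' + y.1 * e x.2 z' <= x.1.1 t + y.1 * e x.2 t + y.2) ->
    `|e x.2 z - e x.2 z'| <= x.2.+1%:R^-1].
  move=> [[W' b'] j] /=; have [b'0|b'0] := boolP (0 < b'); last by exists (0, 0).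
  have tau0 : 0 < j.+1%:R^-1 :> R by rewrite invr_gt0 ltr0n.
  by have [s [eta [? ? ?]]] := slope_step W' (e1 j) b'0 tau0; exists (s, eta).
(* The state holds the function perturbed so far and the budget for the next weight. Halving the
   budget bounds the sum of the weights from rank [n] on by [2 * bb n]; the division by 8 bounds
   those after rank [n] by [eta n / 4], so near-minimality survives with a total error below
   [eta n]. *)
pose st := fix st n := if n is m.+1 then
    let x := st m in let y := f (x.1, x.2, m) in
    ((fun z => x.1 z + y.1 * e m z), Num.min (x.2 / 2) (y.2 / 8))
  else (W, b / 2).
pose s n := (f ((st n).1, (st n).2, n)).1.
pose eta n := (f ((st n).1, (st n).2, n)).2.
pose bb n := (st n).2.
have stS n : st n.+1 = ((fun z => (st n).1 z + s n * e n z), Num.min (bb n / 2) (eta n / 8)) by [].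
have bb0 n : 0 < bb n.
  elim: n => [|n IH]; first by rewrite /bb /= divr_gt0.
  rewrite /bb stS /= lt_min divr_gt0//= divr_gt0//.
  by have [] := Hf ((st n).1, (st n).2, n) IH.
have Hs n := Hf ((st n).1, (st n).2, n) (bb0 n).
have s0 n : 0 <= s n by have [/andP[]] := Hs n.
have sb n : s n <= bb n by have [/andP[]] := Hs n.
have bbS n : bb n.+1 <= bb n / 2 by rewrite {1}/bb stS /= ge_min lexx.
have bbeta n : bb n.+1 <= eta n / 8 by rewrite {1}/bb stS /= ge_min lexx orbT.
have part n k : series s (n + k)%N - series s n <= 2 * bb n - 2 * bb (n + k)%N.
  elim: k => [|k IH]; first by rewrite addn0 !subrr.
  rewrite addnS seriesSr; have := sb (n + k)%N; have := bbS (n + k)%N; lra.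
have ub n k : series s (n + k)%N <= series s n + 2 * bb n.
  by have := part n k; have := bb0 (n + k)%N; lra.
have nds : nondecreasing_seq (series s).
  by apply/nondecreasing_seqP => n; rewrite seriesSr lerDl.
have cs : cvgn (series s).
  apply: nondecreasing_is_cvgn => //; exists (2 * bb 0%N) => _ [k _ <-].
  by have := ub 0%N k; rewrite add0n {2}/series/= big_geq// add0r.
have tail n : limn (series s) - series s n <= 2 * bb n.
  rewrite lerBlDl; apply: limr_le => //; near=> m.
  have nm : (n <= m)%N by near: m; exact: nbhs_infty_ge.
  by rewrite -(subnKC nm).
have stE n z : (st n).1 z = W z + \sum_(0 <= j < n) s j * e j z.
  elim: n => [|n IH]; first by rewrite big_geq// addr0.
  by rewrite stS /= IH big_nat_recr//= addrA.
exists s; split=> //.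
  have := tail 0%N; rewrite {2}/series/= big_geq// subr0 /bb /=; lra.
move=> Winf HW z z' mz mz' j.
have near_min y : (forall t, Winf y <= Winf t) -> forall t,
    (st j).1 y + s j * e j y <= (st j).1 t + s j * e j t + eta j.
  move=> my t; have := HW j.+1 y; have := HW j.+1 t; rewrite -!stE !stS /=.
  rewrite !ler_norml => /andP[_ h1] /andP[h2 _].
  have := tail j.+1; have := bbeta j; have := my t; have := bb0 j.+1; lra.
by have [_ _] := Hs j; apply; exact: near_min.
Unshelve. all: by end_near. Qed.

End VariationalPrinciple.

(** * Sequential compactness of the space of states *)

Section Compactness.
Context (R : realType) (d k : nat).
Local Notation Td := (torus R d).
Local Notation Tk := (torus R k).
Local Notation P := (pmeas R d).

Lemma subseq_infty (phi : nat -> nat) : (forall j, (phi j < phi j.+1)%N) ->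
  phi j @[j --> \oo] --> \oo.
Proof.
move=> H; have ge j : (j <= phi j)%N.
  by elim: j => // j IH; exact: leq_ltn_trans IH (H j).
move=> A [N _ HN]; exists N => // j /= Nj; apply: HN => /=.
exact: leq_trans Nj (ge j).
Qed.

Lemma curve_tdist (n : nat) (tn : nat -> R) t : tn j @[j --> \oo] --> t ->
  tdist (curve n t) (curve n (tn j)) @[j --> \oo] --> 0.
Proof.
move=> ct.
have H : \sum_(i < n) `|schoenberg n t 0 i - schoenberg n (tn j) 0 i| @[j --> \oo] -->
    \sum_(i < n) `|schoenberg n t 0 i - schoenberg n t 0 i|.
  apply: cvg_sumr => i; apply: cvg_norm; apply: cvgB; first exact: cvg_cst.
  exact: (cvg_comp _ _ ct (@schoenberg_continuous R n i t)).
rewrite [X in _ --> X]big1 in H; last by move=> i _; rewrite subrr normr0.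
apply: (@squeeze_cvgr _ _ _ _ (fun=> 0) _ _ _ _ _ H); last exact: cvg_cst.
by apply: nearW => j; rewrite tdist_ge0/=; exact: tdist_pi_le.
Qed.

Lemma state_compact (T : R) (t s : nat -> R) (mu nu : nat -> P) (p : nat -> Tk) :
  (forall j, `|t j| <= T) -> (forall j, `|s j| <= T) ->
  exists phi : nat -> nat, exists (t' s' : R) (mu' nu' : P) (p' : Tk),
    (forall j, (phi j < phi j.+1)%N) /\
    [/\ t (phi j) @[j --> \oo] --> t', s (phi j) @[j --> \oo] --> s',
      law_cvg (mu \o phi) mu', law_cvg (nu \o phi) nu' &
      tdist p' (p (phi j)) @[j --> \oo] --> (0 : R)].
Proof.
move=> tT sT.
have /choice[qm Hm] := fun j => law_exists (mu j).
have /choice[qn Hn] := fun j => law_exists (nu j).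
have /choice[x Hx] : forall j, exists x : R, 0 <= x <= 1 /\ curve k x = p j.
  by move=> j; have [x x01 E] := curve_surj (p j); exists x.
(* A single extraction serves both quantile functions at rational points and three reals: [t], [s]
   and the parameter of [p] on the curve, at the indices 0, 1 and -1 of ['I_3]. *)
pose D := (rat + rat + 'I_3)%type.
pose f (j : nat) (i : D) : R := match i with
  | inl (inl r) => qm j (ratr r)
  | inl (inr r) => qn j (ratr r)
  | inr i => if i == 0 then t j else if i == 1 then s j else x j end.
have T0 : 0 <= T by apply: le_trans (tT 0%N).
have fM j i : `|f j i| <= T + 1.
  have u01 (u : R) : 0 <= u <= 1 -> `|u| <= T + 1.
    by move=> /andP[u0 u1]; rewrite ger0_norm//; lra.
  case: i => [[r|r]|i] /=.
  - by apply: u01; have [] := Hm j.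
  - by apply: u01; have [] := Hn j.
  - case: ifP => _; first by apply: le_trans (tT j) _; rewrite lerDl.
    case: ifP => _; first by apply: le_trans (sT j) _; rewrite lerDl.
    by apply: u01; have [] := Hx j.
have [phi [g [Hphi Hg]]] := diagonal_extraction fM.
have lawc (q : nat -> R -> R) (m : nat -> P) (h : rat -> R) :
    (forall j, [/\ {homo q j : x y / x <= y}, forall u, 0 <= q j u <= 1 & law_of (m j) (q j)]) ->
    (forall r, q (phi j) (ratr r) @[j --> \oo] --> h r) ->
    exists m', law_cvg (m \o phi) m'.
  move=> Hq ch.
  have [|||q' [hq' cq']] := @helly R (q \o phi) h; first by move=> j; have [] := Hq (phi j).
  - by move=> j; have [] := Hq (phi j).
  - exact: ch.
  have mono_meas (a : R -> R) : {homo a : x y / x <= y} ->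
      measurable_fun setT (a : measurableTypeR R -> measurableTypeR R).
    by move=> ha; apply: nondecreasing_measurable => // u v _ _; exact: ha.
  have [m' lm'] := @law_mfun_exists R d q' (mono_meas _ hq').
  exists m', (q \o phi), q'; split.
  + by move=> j; have [h1 _ h3] := Hq (phi j); split; [exact: mono_meas|].
  + exact: mono_meas.
  + exact: lm'.
  + exact: cq'.
have [mu' cmu'] := lawc qm mu (fun r => g (inl (inl r))) Hm (fun r => Hg (inl (inl r))).
have [nu' cnu'] := lawc qn nu (fun r => g (inl (inr r))) Hn (fun r => Hg (inl (inr r))).
exists phi, (g (inr 0)), (g (inr 1)), mu', nu', (curve k (g (inr (-1)))); split=> //.
split=> //; first exact: (Hg (inr 0)).
  exact: (Hg (inr 1)).
have := curve_tdist k (Hg (inr (-1))).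
rewrite (_ : (fun j => tdist _ (curve k (f (phi j) _))) = (fun j => tdist (curve k (g (inr (-1)))) (p (phi j))))//.
by apply/funext => j; have [_ <-] := Hx (phi j).
Qed.

Lemma continuous_txmp_seq (U : R -> Td -> P -> Tk -> R) (tn : nat -> R) t
    (xn : nat -> R) x mun mu pn p :
  continuous_txmp U -> (forall j, 0 <= tn j) ->
  tn j @[j --> \oo] --> t -> xn j @[j --> \oo] --> x -> law_cvg mun mu ->
  tdist p (pn j) @[j --> \oo] --> 0 ->
  U (tn j) (curve d (xn j)) (mun j) (pn j) @[j --> \oo] --> U t (curve d x) mu p.
Proof.
move=> cU tn0 ct cx cmu cp.
have t0 : 0 <= t.
  rewrite -(cvg_lim (@Rhausdorff R) ct); apply: limr_ge; first by apply/cvg_ex; exists t.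
  exact: nearW.
apply/cvgrPdist_lt => e e0.
have [del del0 H] := cU t (curve d x) mu p e t0 e0.
have small (u : nat -> R) : u j @[j --> \oo] --> 0 -> \forall j \near \oo, u j < del.
  move=> /cvgr0_norm_lt/(_ _ del0); apply: filterS => j; apply: le_lt_trans.
  exact: ler_norm.
have /cvgrPdist_lt/(_ _ del0) h1 := ct.
have h3 := small _ (law_cvg_W1 cmu); have h4 := small _ cp.
have h2 : \forall j \near \oo, tdist (curve d x) (curve d (xn j)) < del.
  by apply: small; exact: curve_tdist.
by near=> j; apply: H => //; [near: j|near: j|near: j|near: j].
Unshelve. all: by end_near. Qed.

End Compactness.

(** * Stability properties of the classes C^n *)

Section CnClosure.
Context (R : realType) (V : normedModType R).
Implicit Types F G : V -> R.

Lemma Cn_continuous n F : Cn n F -> continuous F.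
Proof. by case: n => [|n] []. Qed.

Lemma CnS n F : Cn n.+1 F -> Cn n F.
Proof.
elim: n F => [|n IH] F [cF dF]; split=> // v.
by have [dv cv] := dF v; split=> //; exact: IH.
Qed.

Lemma CnB n F G : Cn n F -> Cn n G -> Cn n (fun z => F z - G z).
Proof.
elim: n F G => [|n IH] F G [cF dF] [cG dG].
  by split=> // z; apply: cvgB; [exact: cF|exact: cG].
split=> [z|v]; first by apply: cvgB; [exact: cF|exact: cG].
have [dvF cvF] := dF v; have [dvG cvG] := dG v; split.
  by move=> z; apply: derivableB.
have -> : 'D_v (fun z => F z - G z) = (fun z => 'D_v F z - 'D_v G z).
  by apply/funext => z; rewrite -deriveB.
exact: IH.
Qed.

End CnClosure.

Lemma rV_continuous (R : realType) n (X : topologicalType) (f : X -> 'rV[R]_n) :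
  (forall i, continuous (fun x => f x 0 i)) -> continuous f.
Proof.
move=> cf x; have Fx := nbhs_filter x.
apply/cvgrPdist_lt => e e0.
have : \forall y \near x, forall j, `|f x 0 j - f y 0 j| < e.
  have := @filter_forall _ _ (fun j y => `|f x 0 j - f y 0 j| < e) _ Fx; apply=> j.
  by have /cvgrPdist_lt/(_ _ e0) := cf j x.
apply: filterS => y Hy.
change (mx_norm (f x - f y) < e).
rewrite mx_normrE; apply: bigmax_lt => // -[i j] _ /=.
by have := Hy j; rewrite !mxE ord1.
Qed.

(** * Partial derivatives on the product of the two tori *)

Section TorusCalculus.
Context (R : realType) (d k : nat).
Local Notation Td := (torus R d).
Local Notation Tk := (torus R k).
Local Notation V := ('rV[R]_d * 'rV[R]_k)%type.
Implicit Types (g h : Td -> Tk -> R) (a b : 'I_d + 'I_k).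

Lemma lift2_shift g (v z z' : V) (s : R) :
  \pi_Td z.1 = \pi_Td z'.1 -> \pi_Tk z.2 = \pi_Tk z'.2 ->
  lift2 g (s *: v + z) = lift2 g (s *: v + z').
Proof.
move=> /pi_torusP E1 /pi_torusP E2; rewrite /lift2 /=; congr (g _ _); apply/pi_torusP => i.
  by rewrite !mxE opprD addrACA subrr add0r.
by rewrite !mxE opprD addrACA subrr add0r.
Qed.

Lemma lift2_periodic g (z z' : V) :
  \pi_Td z.1 = \pi_Td z'.1 -> \pi_Tk z.2 = \pi_Tk z'.2 -> lift2 g z = lift2 g z'.
Proof. by rewrite /lift2 => -> ->. Qed.

Lemma derive_lift2_periodic g (v z z' : V) :
  \pi_Td z.1 = \pi_Td z'.1 -> \pi_Tk z.2 = \pi_Tk z'.2 ->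
  'D_v (lift2 g) z = 'D_v (lift2 g) z'.
Proof.
move=> E1 E2; rewrite /derive; congr (lim _).
have -> // : (fun h : R => h^-1 *: ((lift2 g \o shift z) (h *: v) - lift2 g z)) =
          (fun h : R => h^-1 *: ((lift2 g \o shift z') (h *: v) - lift2 g z')).
by apply/funext => h /=; rewrite (lift2_shift g v h E1 E2) (lift2_periodic g E1 E2).
Qed.

(** Partial derivation as an operator on functions of [(x, p)], so that it can be iterated; by
    periodicity its lift is the derivative of the lift, and both [partial] in [x] and [partial] in
    [p] are instances of it. *)
Definition dd a g : Td -> Tk -> R :=
  fun x p => 'D_(basis_dir R a) (lift2 g) (repr x, repr p).

Lemma lift2_dd a g : lift2 (dd a g) = 'D_(basis_dir R a) (lift2 g).
Proof.
by apply/funext => z; apply: derive_lift2_periodic; rewrite /= reprK.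
Qed.

Lemma partial_dd_l i g p : partial i (g^~ p) = (dd (inl i) g)^~ p.
Proof.
apply/funext => x; rewrite /partial /dd /derive; congr (lim _).
have -> // : (fun h : R => h^-1 *: (((g^~ p) \o \pi_Td \o shift (repr x)) (h *: delta_mx 0 i) -
     ((g^~ p) \o \pi_Td) (repr x))) =
  (fun h : R => h^-1 *: ((lift2 g \o shift (repr x, repr p)) (h *: basis_dir R (inl i)) -
     lift2 g (repr x, repr p))).
by apply/funext => h; rewrite /= /lift2 /= scaler0 add0r !reprK.
Qed.

Lemma partial_dd_r j g x : partial j (g x) = dd (inr j) g x.
Proof.
apply/funext => p; rewrite /partial /dd /derive; congr (lim _).
have -> // : (fun h : R => h^-1 *: ((g x \o \pi_Tk \o shift (repr p)) (h *: delta_mx 0 j) -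
     (g x \o \pi_Tk) (repr p))) =
  (fun h : R => h^-1 *: ((lift2 g \o shift (repr x, repr p)) (h *: basis_dir R (inr j)) -
     lift2 g (repr x, repr p))).
by apply/funext => h; rewrite /= /lift2 /= scaler0 add0r !reprK.
Qed.

Lemma lap_dd_l g p x : lap (g^~ p) x = \sum_(i < d) dd (inl i) (dd (inl i) g) x p.
Proof. by apply: eq_bigr => i _; rewrite partial_dd_l (partial_dd_l i (dd (inl i) g)). Qed.

Lemma lap_dd_r g x p : lap (g x) p = \sum_(j < k) dd (inr j) (dd (inr j) g) x p.
Proof. by apply: eq_bigr => j _; rewrite partial_dd_r (partial_dd_r j (dd (inr j) g)). Qed.

Lemma Cn_dd n a g : Cn n.+1 (lift2 g) -> Cn n (lift2 (dd a g)).
Proof. by rewrite lift2_dd => -[_ /(_ (basis_dir R a))[]]. Qed.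

Lemma lift2_continuous_l g p : continuous (lift2 g) -> continuous (g^~ p).
Proof.
move=> cg; apply/torus_continuousP.
have -> : (g^~ p) \o \pi_Td = lift2 g \o (fun z => (z, repr p)).
  by apply/funext => z; rewrite /= /lift2 /= reprK.
move=> z; apply: continuous_comp; last exact: cg.
move=> A [[B C] /= [nB nC] sub]; apply: filterS nB => y By; apply: sub.
by split=> //; exact: nbhs_singleton nC.
Qed.

Lemma ddB a g h : Cn 1 (lift2 g) -> Cn 1 (lift2 h) ->
  dd a (fun x p => g x p - h x p) = (fun x p => dd a g x p - dd a h x p).
Proof.
move=> [_ /(_ (basis_dir R a))[dg _]] [_ /(_ (basis_dir R a))[dh _]].
apply/funext => x; apply/funext => p; rewrite /dd.
by rewrite (_ : lift2 _ = lift2 g - lift2 h)// deriveB.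
Qed.

Lemma C2norm_le g (M : R) : (C2norm g <= M%:E)%E ->
  [/\ forall x p, `|g x p| <= M, forall a x p, `|dd a g x p| <= M &
      forall a b x p, `|dd a (dd b g) x p| <= M].
Proof.
move=> H.
have le r : ([set `|lift2 g z|%:E | z in setT]
     `|` [set e | exists a z, e = `|'D_(basis_dir R a) (lift2 g) z|%:E]
     `|` [set e | exists a a' z,
            e = `|'D_(basis_dir R a) ('D_(basis_dir R a') (lift2 g)) z|%:E]) r%:E -> r <= M.
  move=> Sr; rewrite -lee_fin; apply: le_trans H; exact: ereal_sup_ubound.
split.
- move=> x p; apply: le; left; left; exists (repr x, repr p) => //.
  by rewrite /lift2 /= !reprK.
- by move=> a x p; apply: le; left; right; exists a, (repr x, repr p).
- by move=> a b x p; apply: le; right; exists a, b, (repr x, repr p); rewrite /dd lift2_dd.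
Qed.

Lemma BD_dd n (M : R) g a : BD n.+1 M (lift2 g) -> BD n M (lift2 (dd a g)).
Proof.
rewrite lift2_dd => bg; have M0 := BD_ge0 bg.
case: bg => _ /(_ (basis_dir R a))[_]; apply: BD_le.
rewrite ler_piMr//.
have nd m (i : 'I_m) : `|delta_mx 0 i : 'rV[R]_m| <= 1.
  change (mx_norm (delta_mx 0 i : 'rV[R]_m) <= 1).
  rewrite mx_normrE; apply: bigmax_le => // -[i' j'] _ /=.
  by rewrite mxE; case: (_ && _); rewrite ?normr1 ?normr0.
by rewrite prod_normE; case: a => i /=; rewrite ge_max normr0 ler01 nd.
Qed.

Lemma BD_lift2 n (M : R) g : BD n M (lift2 g) -> forall x p, `|g x p| <= M.
Proof. by move=> bg x p; have := BD_bound (repr x, repr p) bg; rewrite /lift2/= !reprK. Qed.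

Lemma space_B't_bound (U : R -> Td -> pmeas R d -> Tk -> R) (T : R) :
  space_B't U -> 0 < T -> exists M : R, forall t m, 0 <= t <= T ->
  [/\ forall x p, `|U t x m p| <= M, forall a x p, `|dd a (fun x p => U t x m p) x p| <= M &
      forall a b x p, `|dd a (dd b (fun x p => U t x m p)) x p| <= M].
Proof.
move=> [_ _ /(_ T)] H T0; have {}H := H T0.
set S := ereal_sup _ in H.
have SM : (S <= (fine S)%:E)%E by case: (S) H => //= r; rewrite ?leNye.
exists (fine S) => t m tT; apply: C2norm_le; apply: le_trans SM.
by apply: ereal_sup_ubound; exists (t, m).
Qed.

End TorusCalculus.

(** * First and second order conditions at a minimum in the parameter *)

Section MinimumTests.
Context (R : realType).

(** If [f2 0 < 0], then [f1], which vanishes at 0, is negative just to the right of 0, and the mean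
    value theorem makes [f] smaller there than at 0. *)
Lemma second_order_min (f f1 f2 : R -> R) :
  (forall s : R, is_derive s 1 f (f1 s)) -> (forall s : R, is_derive s 1 f1 (f2 s)) ->
  (forall s, f 0 <= f s) -> f1 0 = 0 /\ 0 <= f2 0.
Proof.
move=> d1 d2 fmin.
have f10 : f1 0 = 0.
  have [] := @derive1_at_min R f (-1) 1 0.
  - lra.
  - by move=> t _; have [] := d1 t.
  - by rewrite in_itv/=; lra.
  - by move=> t _; exact: fmin.
  by move=> _ E0; have [_ E1] := d1 0; rewrite -E1; exact: E0.
split=> //; rewrite leNgt; apply/negP => neg.
have [df2 Ef2] := d2 0.
have q : h^-1 *: ((f1 \o shift 0) (h *: 1) - f1 0) @[h --> 0^'] --> f2 0.
  by rewrite -Ef2; exact: df2.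
have n0 : \forall h \near 0^', h^-1 *: ((f1 \o shift 0) (h *: 1) - f1 0) < 0.
  by apply: (cvgr_lt (f2 0) q).
have [e /= e0 He] := n0.
have f1neg s : 0 < s -> s < e -> f1 s < 0.
  move=> s0 se; have := He s; rewrite /= sub0r normrN gtr0_norm// => /(_ se).
  rewrite gt_eqF// => /(_ isT); rewrite f10 subr0 /= addr0.
  have -> : (s *: (1 : R)) = s by rewrite /GRing.scale/= mulr1.
  by rewrite pmulr_rlt0// invr_gt0.
have e20 : 0 < e / 2 by rewrite divr_gt0.
have [|c] := @MVT R f f1 0 (e / 2) e20 (fun x _ => d1 x).
  by apply: derivable_within_continuous => x _; have [] := d1 x.
rewrite in_itv/= subr0 => /andP[c0 ce] E.
have := fmin (e / 2); rewrite -subr_ge0 E pmulr_lge0// leNgt f1neg//; lra.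
Qed.

End MinimumTests.

Section MinimumInP.
Context (R : realType) (d k : nat).
Local Notation Td := (torus R d).
Local Notation Tk := (torus R k).
Implicit Types g h : Td -> Tk -> R.

Lemma lift2_bounded g : continuous (lift2 g) -> exists M, forall x p, `|g x p| <= M.
Proof.
move=> cg.
have cK : compact (@unit_cube R d `*` @unit_cube R k).
  by apply: compact_setX; exact: unit_cube_compact.
have cn : {within @unit_cube R d `*` @unit_cube R k, continuous (fun z => `|lift2 g z|)}.
  apply: continuous_subspaceT => z; apply: continuous_comp; first exact: cg.
  exact: norm_continuous.
have [|c _ H] := compact_EVT_max _ cK cn.
  have [u cu _] := unit_cube_surj (point : Td); have [v cv _] := unit_cube_surj (point : Tk).
  by exists (u, v).
exists `|lift2 g c| => x p.
have [u cu <-] := unit_cube_surj x; have [v cv <-] := unit_cube_surj p.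
by apply: (H (u, v)); rewrite inE.
Qed.

Let line (j : 'I_k) (p0 : Tk) (s : R) : Tk := \pi_Tk (s *: delta_mx 0 j + repr p0).

Lemma is_derive_pair_p (mu : pmeas R d) g j p0 (M : R) (s : R) :
  Cn 1 (lift2 g) -> (forall x p, `|dd (inr j) g x p| <= M) ->
  is_derive s 1 (fun s => pair_p (fun x => g x (line j p0 s)) mu)
    (pair_p (fun x => dd (inr j) g x (line j p0 s)) mu).
Proof.
move=> Cg gM.
have cg p : continuous (g^~ p) by apply: lift2_continuous_l; exact: Cn_continuous Cg.
have D x (t : R) : is_derive t 1 (fun t => g x (line j p0 t)) (dd (inr j) g x (line j p0 t)).
  have [_ /(_ (basis_dir R (inr j)))[dg _]] := Cg.
  have := is_derive_line (F := lift2 g) (z := (repr x, repr p0)) (v := basis_dir R (inr j)) (dg (t *: _ + _)).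
  have -> : (fun t : R => lift2 g (t *: basis_dir R (inr j) + (repr x, repr p0))) =
      (fun t => g x (line j p0 t)).
    by apply/funext => u; rewrite /lift2 /= scaler0 add0r reprK.
  suff -> : 'D_(basis_dir R (inr j)) (lift2 g) (t *: basis_dir R (inr j) + (repr x, repr p0)) =
     dd (inr j) g x (line j p0 t) by [].
  apply: derive_lift2_periodic => /=; first by rewrite scaler0 add0r.
  by rewrite reprK.
have I1 t : mu.-integrable setT (EFin \o (fun x => g x (line j p0 t))).
  exact: torus_integrable.
pose G (_ : Td) : R := M.
have M0 : 0 <= M by apply: le_trans (gM point point).
have cc : continuous G by exact: cst_continuous.
have Is : (`]s - 1, s + 1[%classic : set R) s by rewrite /= in_itv/=; lra.
have E x t : partial1of2 (fun t x => g x (line j p0 t)) t x = dd (inr j) g x (line j p0 t).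
  by rewrite partial1of2E; have [_ ->] := D x t.
have Dd t x : derivable (fun t => g x (line j p0 t)) t 1 by have [] := D x t.
have GM t x : (`]s - 1, s + 1[%classic : set R) t -> [set: Td] x ->
    `|partial1of2 (fun t x => g x (line j p0 t)) t x| <= G x.
  by move=> _ _; rewrite E.
have IG : mu.-integrable setT (EFin \o G) by exact: torus_integrable.
split.
  exact: (@derivable_under_integral R _ Td mu (fun t x => g x (line j p0 t)) setT measurableT
    s (s - 1) (s + 1) Is (fun t _ => I1 t) (fun t x _ _ => Dd t x) G (fun _ => M0) IG GM).
rewrite -derive1E.
rewrite (@differentiation_under_integral R _ Td mu (fun t x => g x (line j p0 t)) setT measurableT
    s (s - 1) (s + 1) Is (fun t _ => I1 t) (fun t x _ _ => Dd t x) G (fun _ => M0) IG GM).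
by apply: eq_Rintegral => x _; exact: E.
Qed.

Lemma min_in_p (mu nu : pmeas R d) g h (p0 : Tk) j :
  C2 g -> C2 h ->
  (forall p, pair_p (g^~ p0) mu + pair_p (h^~ p0) nu <= pair_p (g^~ p) mu + pair_p (h^~ p) nu) ->
  pair_p ((dd (inr j) g)^~ p0) mu + pair_p ((dd (inr j) h)^~ p0) nu = 0 /\
  0 <= pair_p ((dd (inr j) (dd (inr j) g))^~ p0) mu
       + pair_p ((dd (inr j) (dd (inr j) h))^~ p0) nu.
Proof.
rewrite /C2 => Cg Ch Hmin.
have C1g := CnS Cg; have C1h := CnS Ch.
have C1g' := Cn_dd (inr j) Cg; have C1h' := Cn_dd (inr j) Ch.
have [M1 b1] := lift2_bounded (Cn_continuous C1g').
have [M2 b2] := lift2_bounded (Cn_continuous C1h').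
have [M3 b3] := lift2_bounded (Cn_continuous (Cn_dd (inr j) C1g')).
have [M4 b4] := lift2_bounded (Cn_continuous (Cn_dd (inr j) C1h')).
have l0 : line j p0 0 = p0 by rewrite /line scale0r add0r reprK.
have := @second_order_min R
  (fun s => pair_p (fun x => g x (line j p0 s)) mu + pair_p (fun x => h x (line j p0 s)) nu)
  (fun s => pair_p (fun x => dd (inr j) g x (line j p0 s)) mu +
            pair_p (fun x => dd (inr j) h x (line j p0 s)) nu)
  (fun s => pair_p (fun x => dd (inr j) (dd (inr j) g) x (line j p0 s)) mu +
            pair_p (fun x => dd (inr j) (dd (inr j) h) x (line j p0 s)) nu).
rewrite l0; apply.
- move=> s; apply: is_deriveD; [exact: is_derive_pair_p C1g b1|exact: is_derive_pair_p C1h b2].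
- move=> s; apply: is_deriveD; [exact: is_derive_pair_p C1g' b3|exact: is_derive_pair_p C1h' b4].
- by move=> s; exact: Hmin.
Qed.

End MinimumInP.

(** * Convexity and derivatives of the Hamiltonian *)

Section Hamiltonian.
Context (R : realType) (d : nat).
Local Notation Td := (torus R d).
Context (H : Td -> 'rV[R]_d -> R) (HC1 : C1_hamiltonian H)
  (Hconvex : forall x, convex_function setT (H x)).
Local Notation F := (fun z : 'rV[R]_d * 'rV[R]_d => H (\pi_Td z.1) z.2).

Lemma is_derive_H x q v : is_derive q v (H x) ('D_(0, v) F (repr x, q)).
Proof.
apply: is_derive_of_line.
have [_ /(_ (0, v))[dF _]] := HC1.
have := is_derive_line0 (dF (repr x, q)).
rewrite (_ : (fun s : R => F (s *: (0, v) + (repr x, q))) = (fun s : R => H x (s *: v + q)))//.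
by apply/funext => s; rewrite /= scaler0 add0r reprK.
Qed.

Lemma Cn_H x : Cn 1 (H x).
Proof.
have [cF dF] := HC1.
have cp (G : 'rV[R]_d * 'rV[R]_d -> R) : continuous G -> continuous (fun q => G (repr x, q)).
  move=> cG q; apply: continuous_comp; last exact: cG.
  move=> A [[B C] /= [nB nC] sub]; apply: filterS nC => y By; apply: sub.
  by split=> //; exact: nbhs_singleton nB.
split.
  rewrite (_ : H x = (fun q => F (repr x, q))); first exact: (cp F cF).
  by apply/funext => q; rewrite /= reprK.
move=> v; have [dv [cv _]] := dF (0, v); split=> [q|]; first by have [] := is_derive_H x q v.
split=> //; rewrite (_ : 'D_v (H x) = (fun q => 'D_(0, v) F (repr x, q))); first exact: cp cv.
by apply/funext => q; have [] := is_derive_H x q v.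
Qed.

(** By convexity the difference quotients of [H x] along [q' - q] with step in []0, 1]] are at most
    [c], hence so is their limit. *)
Lemma convex_gradient x (q q' : 'rV[R]_d) :
  H x q + dotv (q' - q) (DpH H x q) <= H x q'.
Proof.
have -> : dotv (q' - q) (DpH H x q) = 'D_(q' - q) (H x) q.
  rewrite {2}(row_sum_delta (q' - q)) (Cn1_derive_sum _ _ _ _ (Cn_H x)).
  by apply: eq_bigr => i _; rewrite !mxE.
set v := q' - q; set c := H x q' - H x q.
suff : 'D_v (H x) q <= c by rewrite /c; lra.
have [dH _] := is_derive_H x q v.
rewrite leNgt; apply/negP => cD.
have [e /= e0 He] := cvgr_gt _ dH _ cD.
pose h : R := Num.min (e / 2) (1 / 2).
have h0 : 0 < h by rewrite lt_min !divr_gt0.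
have h1 : h <= 1 by rewrite ge_min; apply/orP; right; lra.
have he : h < e by rewrite gt_min; apply/orP; left; lra.
have := He h; rewrite /= sub0r normrN gtr0_norm// => /(_ he).
rewrite gt_eqF// => /(_ isT).
rewrite [_ *: _]/(h^-1 * _) ltr_pdivlMl//.
have h01 : (0 <= h <= 1)%R by rewrite ltW.
have := Hconvex x (Itv01 (ltW h0) h1) (in_setT q') (in_setT q).
rewrite convRE.
change (H x (h *: q' + (1 - h) *: q) <= h * H x q' + (1 - h) * H x q ->
  h * c < H x (h *: v + q) - H x q -> False).
rewrite (_ : h *: q' + (1 - h) *: q = h *: v + q); first by rewrite /c; lra.
by rewrite /v scalerBr scalerBl scale1r addrA addrAC.
Qed.

Lemma cvg_pairF (X : topologicalType) (G : 'rV[R]_d * 'rV[R]_d -> R)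
    (u : X -> 'rV[R]_d) (w : X -> 'rV[R]_d) :
  continuous G -> continuous u -> continuous w -> continuous (fun x => G (u x, w x)).
Proof.
move=> cG cu cw x; apply: (@continuous_comp _ _ _ (fun x => (u x, w x)) G); last exact: cG.
have Fx := nbhs_filter x.
move=> A [[B C] /= [nB nC] sub].
have nn := @filterI _ _ Fx _ _ (cu x _ nB) (cw x _ nC).
change (nbhs x (fun y => A (u y, w y))).
by apply: filterS nn => y [By Cy]; apply: sub.
Qed.

Lemma H_continuous (w : Td -> 'rV[R]_d) : (forall i, continuous (fun x => w x 0 i)) ->
  continuous (fun x => H x (w x)).
Proof.
move=> cw; apply/torus_continuousP.
apply: (@cvg_pairF _ F (fun z => z) (w \o \pi_Td)); first exact: Cn_continuous HC1.
  by move=> z; exact: cvg_id.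
exact/torus_continuousP/rV_continuous.
Qed.

Lemma DpHE z q i : DpH H (\pi_Td z) q 0 i = 'D_(0, delta_mx 0 i) F (z, q).
Proof.
rewrite mxE; have [_ ->] := is_derive_H (\pi_Td z) q (delta_mx 0 i).
rewrite /derive; congr (lim _).
have -> // : (fun h : R => h^-1 *: ((F \o shift (repr (\pi_Td z), q)) (h *: (0, delta_mx 0 i)) -
     F (repr (\pi_Td z), q))) =
  (fun h : R => h^-1 *: ((F \o shift (z, q)) (h *: (0, delta_mx 0 i)) - F (z, q))).
by apply/funext => h; rewrite /= scaler0 !add0r reprK.
Qed.

Lemma DpH_continuous (w : Td -> 'rV[R]_d) i : (forall i, continuous (fun x => w x 0 i)) ->
  continuous (fun x => DpH H x (w x) 0 i).
Proof.
move=> cw; apply/torus_continuousP.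
rewrite (_ : _ \o _ = fun z => 'D_(0, delta_mx 0 i) F (z, (w \o \pi_Td) z)); last first.
  by apply/funext => z; rewrite /= DpHE.
apply: (@cvg_pairF _ ('D_(0, delta_mx 0 i) F) (fun z => z) (w \o \pi_Td)).
- by have [_ /(_ (0, delta_mx 0 i))[_ []]] := HC1.
- by move=> z; exact: cvg_id.
- exact/torus_continuousP/rV_continuous.
Qed.

(** Compactness of a cube, which represents the whole torus, times a box of gradients. Applied to
    the bounds on the gradients of [U] and [V], it yields the constant [Bh]. *)
Lemma DpH_bounded (M : R) : exists B, forall x (q : 'rV[R]_d) i,
  (forall j, `|q 0 j| <= M) -> `|DpH H x q 0 i| <= B.
Proof.
pose box : set 'rV[R]_d := [set q | forall j, `[- M, M]%classic (q 0 j)].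
have cb : compact box.
  exact: (@rV_compact R d (fun=> `[- M, M]%classic) (fun i => @segment_compact R (- M) M)).
have cK : compact (@unit_cube R d `*` box) by apply: compact_setX => //; exact: unit_cube_compact.
have bnd i : exists B, forall x (q : 'rV[R]_d), (forall j, `|q 0 j| <= M) -> `|DpH H x q 0 i| <= B.
  have cD : continuous ('D_(0, delta_mx 0 i) F) by have [_ /(_ (0, delta_mx 0 i))[_ []]] := HC1.
  have cn : {within @unit_cube R d `*` box, continuous (fun z => `|'D_(0, delta_mx 0 i) F z|)}.
    apply: continuous_subspaceT => z.
    have cz := cD z; have := cvg_norm cz; exact.
  have [K0|/set0P nK] := eqVneq (@unit_cube R d `*` box) set0.
    exists 0 => x q qM; have [u cu _] := unit_cube_surj x.
    have : (@unit_cube R d `*` box) (u, q).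
      by split=> //= j; rewrite /= in_itv/= -ler_norml.
    by rewrite K0.
  have [c _ Hc] := compact_EVT_max nK cK cn.
  exists `|'D_(0, delta_mx 0 i) F c| => x q qM.
  have [u cu <-] := unit_cube_surj x; rewrite DpHE; apply: (Hc (u, q)).
  by rewrite inE; split=> //= j; rewrite /= in_itv/= -ler_norml.
have /choice[B HB] := bnd.
exists (\sum_i `|B i|) => x q i qM.
apply: le_trans (HB i x q qM) _; apply: le_trans (ler_norm _) _.
by rewrite (bigD1 i)//= lerDl; exact: sumr_ge0.
Qed.

End Hamiltonian.

Lemma rV_coord_norm (R : realType) n (v : 'rV[R]_n) i : `|v 0 i| <= `|v|.
Proof.
change (`|v 0 i| <= mx_norm v); rewrite mx_normrE.
exact: (le_bigmax _ (fun ij : 'I_1 * 'I_n => `|v ij.1 ij.2|) (0, i)).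
Qed.

(** * The countable family of test functionals *)

Section TestFamily.
Context (R : realType) (d k : nat).
Local Notation Td := (torus R d).
Local Notation Tk := (torus R k).
Local Notation V := ('rV[R]_d * 'rV[R]_k)%type.
Local Notation P := (pmeas R d).
Local Notation Jd := ('I_d * bool)%type.
Local Notation Jk := ('I_k * bool)%type.

Lemma BD_trig_coord n (b : bool) (c : V -> R) :
  (forall z v (h : R), c (h *: v + z) = h * c v + c z) -> (forall v, `|c v| <= `|v|) ->
  exists C, BD n C (fun z => (if b then @cos R else @sin R) (pi *+ 2 * c z)).
Proof.
move=> lin bnd; have p0 : 0 <= pi *+ 2 :> R by rewrite mulrn_wge0// pi_ge0.
have K1 : 1 <= pi *+ 2 + 1 :> R by rewrite lerDr.
have l1 z v h : pi *+ 2 * c (h *: v + z) = h * (pi *+ 2 * c v) + pi *+ 2 * c z.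
  by rewrite lin mulrDr mulrCA.
have l2 v : `|pi *+ 2 * c v| <= (pi *+ 2 + 1) * `|v|.
  by rewrite normrM ger0_norm//; apply: ler_pM => //; rewrite lerDl.
have [Hc Hs] := @BD_trig R V n (fun z => pi *+ 2 * c z) (pi *+ 2 + 1) K1 l1 l2.
by exists ((pi *+ 2 + 1) ^+ n); case: b.
Qed.

Lemma BD_psi n N (r : {ffun Jd -> rat}) : exists C, BD n C (lift2 (fun (x : Td) (p : Tk) => psi N r x)).
Proof.
have /choice[C HC] : forall j : Jd, exists C, BD n C
    (fun z : V => expR (N%:R - N%:R ^+ 2 * (trigc j (\pi_Td z.1) - ratr (r j)))).
  move=> j; have [||C HC] := @BD_trig_coord n j.2 (fun z => z.1 0 j.1).
  - by move=> z v h; rewrite !mxE.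
  - by move=> v; apply: le_trans (rV_coord_norm _ _) _; rewrite prod_normE le_max lexx.
  have H2 := BD_add (BD_cst V n (N%:R + N%:R ^+ 2 * ratr (r j))) (BD_scale (- N%:R ^+ 2) HC).
  have [C' HC'] := BD_expR H2.
  exists C'; rewrite (_ : (fun z => _) = fun z : V => expR (N%:R + N%:R ^+ 2 * ratr (r j) +
     - N%:R ^+ 2 * (if j.2 then @cos R else @sin R) (pi *+ 2 * z.1 0 j.1)))//.
  by apply/funext => z; rewrite trigc_pi; congr expR; ring.
have HS := BD_sum (index_enum Jd) HC.
have [C' HC'] := BD_expR (BD_scale (-1) HS).
exists C'; rewrite (_ : lift2 _ = fun z : V => expR (-1 * \sum_j
   expR (N%:R - N%:R ^+ 2 * (trigc j (\pi_Td z.1) - ratr (r j)))))//.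
by apply/funext => z; rewrite mulN1r.
Qed.

Lemma BD_psi_trig n N (r : {ffun Jd -> rat}) (l : Jk) :
  exists C, BD n C (lift2 (fun (x : Td) (p : Tk) => trigc l p * psi N r x)).
Proof.
have [C HC] := BD_psi n N r.
have [||C' HC'] := @BD_trig_coord n l.2 (fun z => z.2 0 l.1).
- by move=> z v h; rewrite !mxE.
- by move=> v; apply: le_trans (rV_coord_norm _ _) _; rewrite prod_normE le_max lexx orbT.
exists (2 ^+ n * (C' * C)).
rewrite (_ : lift2 _ = fun z : V => (if l.2 then @cos R else @sin R) (pi *+ 2 * z.2 0 l.1) *
   lift2 (fun (x : Td) (p : Tk) => psi N r x) z); first exact: BD_mul.
by apply/funext => z; rewrite /lift2 trigc_pi.
Qed.

Definition test_index := ((nat * {ffun Jd -> rat}) * (bool + Jk))%type.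

(* The three kinds of test functionals are [<psi, mu>], [<psi, nu>] and
   [trigc l p * <psi, mu - nu>]; the last ones determine [p] when [mu <> nu]. *)
Definition raw_a (i : test_index) (x : Td) (p : Tk) : R :=
  match i.2 with
  | inl true => psi i.1.1 i.1.2 x
  | inl false => 0
  | inr l => trigc l p * psi i.1.1 i.1.2 x
  end.

Definition raw_b (i : test_index) (x : Td) (p : Tk) : R :=
  match i.2 with
  | inl true => 0
  | inl false => psi i.1.1 i.1.2 x
  | inr l => - (trigc l p * psi i.1.1 i.1.2 x)
  end.

Lemma raw_bounded n i : exists C : R,
  [/\ 0 < C, BD n C (lift2 (raw_a i)) & BD n C (lift2 (raw_b i))].
Proof.
case: i => [[N r] [[|]|l]]; rewrite /raw_a /raw_b /=.
- have [C HC] := BD_psi n N r; exists (C + 1); split.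
  + by have := BD_ge0 HC; lra.
  + by apply: BD_le HC; lra.
  + have := BD_cst V n (0 : R); apply: BD_le; rewrite normr0; have := BD_ge0 HC; lra.
- have [C HC] := BD_psi n N r; exists (C + 1); split.
  + by have := BD_ge0 HC; lra.
  + have := BD_cst V n (0 : R); apply: BD_le; rewrite normr0; have := BD_ge0 HC; lra.
  + by apply: BD_le HC; lra.
- have [C HC] := BD_psi_trig n N r l; exists (C + 1); split.
  + by have := BD_ge0 HC; lra.
  + by apply: BD_le HC; lra.
  + have := BD_scale (-1) HC; rewrite normrN normr1 mul1r.
    rewrite (_ : (fun z => _) = lift2 (fun x p => - (trigc l p * psi N r x))); last first.
      by apply/funext => z; rewrite mulN1r.
    by apply: BD_le; lra.
Qed.

Lemma wsumD (s : nat -> R) (f g : nat -> V -> R) (M : R) z :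
  (forall j, 0 <= s j) -> cvgn (series s) -> (forall j, `|f j z| <= M) -> (forall j, `|g j z| <= M) ->
  wsum s f z + wsum s g z = wsum s (fun j z => f j z + g j z) z.
Proof.
move=> s0 cs fM gM; apply/esym/(cvg_lim (@Rhausdorff R)).
rewrite (_ : series _ = (fun m => series (fun j => s j * f j z) m + series (fun j => s j * g j z) m)).
  by apply: cvgD; [exact: wsum_cvg fM|exact: wsum_cvg gM].
apply/funext => m; rewrite !seriesEnat /= -big_split /=.
by apply: eq_bigr => j _; rewrite mulrDr.
Qed.

(* [2 ^ c (2 m + 1)] codes the [m]-th occurrence of the index of code [c]. *)
Definition test_seq (j : nat) : test_index :=
  if unpickle (logn 2 j) is Some i then i else ((0%N, [ffun=> 0]), inl true).

(** The variational principle makes the functional of rank [j] agree at two minimizers only up to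
    [1 / (j + 1)]; an index that recurs at arbitrarily large ranks gives exact agreement. *)
Lemma test_seq_often (i : test_index) (m : nat) : exists2 j, (m <= j)%N & test_seq j = i.
Proof.
exists (2 ^ pickle i * m.*2.+1)%N.
  have p2 : (0 < 2 ^ pickle i)%N by rewrite expn_gt0.
  apply: (@leq_trans (m.*2.+1)); last by rewrite leq_pmull.
  by rewrite -addnn ltnW// ltnS leq_addr.
rewrite /test_seq lognM ?expn_gt0// pfactorK// lognE /= dvdn2 /= odd_double /= addn0.
by rewrite pickleK.
Qed.

Lemma wsum_tail_lift2 (s : nat -> R) (f : nat -> Td -> Tk -> R) (M : R) x p n :
  (forall j, 0 <= s j) -> cvgn (series s) -> (forall j x p, `|f j x p| <= M) ->
  `|wsum s (fun j => lift2 (f j)) (repr x, repr p) - \sum_(0 <= j < n) s j * f j x p|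
    <= M * (limn (series s) - series s n).
Proof.
move=> s0 cs fM.
have h := @wsum_tail R V s s0 cs (fun j => lift2 (f j)) M (repr x, repr p) n (fun j => fM j _ _).
suff <- : \sum_(0 <= j < n) s j * lift2 (f j) (repr x, repr p) = \sum_(0 <= j < n) s j * f j x p.
  exact: h.
by apply: eq_bigr => j _; rewrite /lift2 /= !reprK.
Qed.

(** The second item is the separation property, off the diagonal [mu = nu]; the estimate that closes
    the third one is the tail bound required of [Winf] in [perturbed_minimum]. *)
Lemma test_family : exists e : nat -> P * P * Tk -> R,
  [/\ forall j z, `|e j z| <= 1,
    forall z z', (forall j, `|e j z - e j z'| <= j.+1%:R^-1) -> ~ pmeas_eq z.1.1 z.1.2 ->
      [/\ pmeas_eq z.1.1 z'.1.1, pmeas_eq z.1.2 z'.1.2 & z.2 = z'.2] &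
    forall s : nat -> R, (forall j, 0 <= s j) -> cvgn (series s) -> exists A B : Td -> Tk -> R,
      [/\ BD 4 (limn (series s)) (lift2 A), BD 4 (limn (series s)) (lift2 B),
        forall x p p', A x p + B x p = A x p' + B x p' &
        forall n z, `|pair_p (A^~ z.2) z.1.1 + pair_p (B^~ z.2) z.1.2
                      - \sum_(0 <= j < n) s j * e j z| <= limn (series s) - series s n]].
Proof.
(* Order 5, because summing the series costs one order. *)
have /choice[C HC] := raw_bounded 5.
(* The factor bounds [a i] and [b i] by 1/2 each, hence the functional [e0 i] by 1. *)
pose a i (x : Td) (p : Tk) := (2 * C i)^-1 * raw_a i x p.
pose b i (x : Td) (p : Tk) := (2 * C i)^-1 * raw_b i x p.
have C0 i : 0 < (2 * C i)^-1 by rewrite invr_gt0 mulr_gt0//; have [] := HC i.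
have C2 i : `|(2 * C i)^-1| * C i = 2^-1.
  by rewrite gtr0_norm//; field; have [h _ _] := HC i; rewrite gt_eqF.
have ba i : BD 5 2^-1 (lift2 (a i)).
  by have [_ h _] := HC i; rewrite -(C2 i); exact: BD_scale h.
have bb i : BD 5 2^-1 (lift2 (b i)).
  by have [_ _ h] := HC i; rewrite -(C2 i); exact: BD_scale h.
have ca i p : continuous ((a i)^~ p).
  by apply: lift2_continuous_l; exact: Cn_continuous (BD_Cn (ba i)).
have cb i p : continuous ((b i)^~ p).
  by apply: lift2_continuous_l; exact: Cn_continuous (BD_Cn (bb i)).
have na i x p : `|a i x p| <= 2^-1 by exact: BD_lift2 (ba i) x p.
have nb i x p : `|b i x p| <= 2^-1 by exact: BD_lift2 (bb i) x p.
pose e0 i (z : P * P * Tk) := pair_p ((a i)^~ z.2) z.1.1 + pair_p ((b i)^~ z.2) z.1.2.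
exists (fun j => e0 (test_seq j)); split.
- move=> j z; apply: le_trans (ler_normD _ _) _.
  have := pair_p_norm z.1.1 (ca (test_seq j) z.2) (fun x => na (test_seq j) x z.2).
  have := pair_p_norm z.1.2 (cb (test_seq j) z.2) (fun x => nb (test_seq j) x z.2).
  lra.
- move=> [[mu nu] p] [[mu' nu'] p'] /= He nmn.
  have E i : e0 i (mu, nu, p) = e0 i (mu', nu', p').
    apply/eqP; rewrite -subr_eq0 -normr_le0; apply/ler_addgt0Pr => eps eps0; rewrite add0r.
    have [m _ Hm] := near_infty_natSinv_lt (PosNum eps0).
    have [j mj <-] := test_seq_often i m.
    by apply: le_trans (He j) (ltW _); exact: Hm.
  have pc (c : R) : pair_p (fun _ : Td => c) mu = c := pair_p_cst c mu.
  have Ea N r : pair_p (psi N r) mu = pair_p (psi N r) mu'.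
    have := E ((N, r), inl true); rewrite /e0 /a /b /raw_a /raw_b /=.
    rewrite !pair_pZ; try exact: cst_continuous; try exact: psi_continuous.
    rewrite !pair_p_cst !mulr0 !addr0 => /mulfI; apply; exact: lt0r_neq0.
  have Eb N r : pair_p (psi N r) nu = pair_p (psi N r) nu'.
    have := E ((N, r), inl false); rewrite /e0 /a /b /raw_a /raw_b /=.
    rewrite !pair_pZ; try exact: cst_continuous; try exact: psi_continuous.
    rewrite !pair_p_cst !mulr0 !add0r => /mulfI; apply; exact: lt0r_neq0.
  split; [exact: pair_psi_eq|exact: pair_psi_eq|].
  have [N [r neq]] : exists N r, pair_p (psi N r) mu != pair_p (psi N r) nu.
    apply: contrapT => H; apply: nmn; apply: pair_psi_eq => N r.
    by apply/eqP; apply: contrapT => h; apply: H; exists N, r; apply/negP.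
  apply: trigc_sep => l.
  have := E ((N, r), inr l); rewrite /e0 /a /b /raw_a /raw_b /=.
  have cp (q : Tk) : continuous (fun x => trigc l q * psi N r x).
    by move=> x; have Fx := nbhs_filter x; apply: cvgMl_tmp; exact: psi_continuous.
  have cn (q : Tk) : continuous (fun x => - (trigc l q * psi N r x)).
    by move=> x; have Fx := nbhs_filter x; apply: cvgN; exact: cp.
  have pN (q : Tk) (m : P) : pair_p (fun x => - (trigc l q * psi N r x)) m = - (trigc l q * pair_p (psi N r) m).
    under eq_fun do rewrite -mulNr.
    by rewrite pair_pZ ?mulNr//; exact: psi_continuous.
  rewrite !pair_pZ ?pN; try exact: cp; try exact: cn; try exact: psi_continuous.
  (* The measures being already identified, both sides carry the same factor
     [<psi, mu> - <psi, nu>], nonzero by the choice of [N] and [r], and [trigc l] takes the same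
     value at [p] and [p']. *)
  rewrite -!Ea -!Eb -!mulrDr -!mulrBr => /mulfI; rewrite gt_eqF// => /(_ isT).
  by move=> /mulIf; apply; rewrite subr_eq0.
move=> s s0 cs.
pose A (x : Td) (p : Tk) := wsum s (fun j => lift2 (a (test_seq j))) (repr x, repr p).
pose B (x : Td) (p : Tk) := wsum s (fun j => lift2 (b (test_seq j))) (repr x, repr p).
(* [A] and [B] are computed at representatives; as every term is periodic, their lifts are the
   series of the lifts, to which [BD_wsum] applies. *)
have per (f : test_index -> Td -> Tk -> R) : lift2 (fun x p => wsum s (fun j => lift2 (f (test_seq j))) (repr x, repr p)) =
    wsum s (fun j => lift2 (f (test_seq j))).
  apply/funext => z; rewrite /lift2 /wsum; congr (limn (series _)).
  by apply/funext => j /=; rewrite !reprK.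
have S0 : 0 <= limn (series s).
  by apply: limr_ge => //; near=> m; rewrite seriesEnat; exact: sumr_ge0.
have half : limn (series s) * 2^-1 <= limn (series s) by lra.
have bA : BD 4 (limn (series s)) (lift2 A).
  by rewrite /A per; apply: BD_le half _; apply: BD_wsum => // j; exact: ba.
have bB : BD 4 (limn (series s)) (lift2 B).
  by rewrite /B per; apply: BD_le half _; apply: BD_wsum => // j; exact: bb.
exists A, B; split=> //.
- move=> x p p'; rewrite /A /B.
  rewrite !(@wsumD s _ _ 2^-1) //; try (by move=> j; exact: na); try (by move=> j; exact: nb).
  congr (limn (series _)); apply/funext => j; congr (_ * _).
  rewrite /lift2 /= !reprK /a /b /raw_a /raw_b -!mulrDr; congr (_ * _).
  by case: ((test_seq j).2) => [[|]|l] //; rewrite !subrr.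
- move=> n [[mu nu] p] /=.
  have cA : continuous (A^~ p) by apply: lift2_continuous_l; exact: Cn_continuous (BD_Cn bA).
  have cB : continuous (B^~ p) by apply: lift2_continuous_l; exact: Cn_continuous (BD_Cn bB).
  pose An x := \sum_(0 <= j < n) s j * a (test_seq j) x p.
  pose Bn x := \sum_(0 <= j < n) s j * b (test_seq j) x p.
  have cs' (f : Td -> R) c : continuous f -> continuous (fun x => c * f x).
    by move=> cf x; have Fx := nbhs_filter x; apply: cvgMl_tmp; exact: cf.
  have cAn : continuous An by apply: continuous_sumr => j; apply: cs'; exact: ca.
  have cBn : continuous Bn by apply: continuous_sumr => j; apply: cs'; exact: cb.
  have cD (f g : Td -> R) : continuous f -> continuous g -> continuous (fun x => f x - g x).
    by move=> cf cg x; have Fx := nbhs_filter x; apply: cvgB; [exact: cf|exact: cg].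
  have tA x : `|A x p - An x| <= 2^-1 * (limn (series s) - series s n).
    exact: (@wsum_tail_lift2 s (fun j => a (test_seq j)) 2^-1 x p n s0 cs (fun j => na (test_seq j))).
  have tB x : `|B x p - Bn x| <= 2^-1 * (limn (series s) - series s n).
    exact: (@wsum_tail_lift2 s (fun j => b (test_seq j)) 2^-1 x p n s0 cs (fun j => nb (test_seq j))).
  have -> : \sum_(0 <= j < n) s j * e0 (test_seq j) (mu, nu, p) = pair_p An mu + pair_p Bn nu.
    rewrite /An /Bn !pair_p_sum; try (by move=> j; apply: cs'; exact: ca); try (by move=> j; apply: cs'; exact: cb).
    rewrite -big_split /=; apply: eq_bigr => j _.
    by rewrite mulrDr (pair_pZ _ _ (ca _ _)) (pair_pZ _ _ (cb _ _)).
  have := pair_p_norm mu (cD _ _ cA cAn) tA; have := pair_p_norm nu (cD _ _ cB cBn) tB.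
  rewrite !pair_pB// => h1 h2.
  rewrite opprD addrACA; apply: le_trans (ler_normD _ _) _; lra.
Unshelve. all: by end_near. Qed.

End TestFamily.

(** * Quadratic test functions of time *)

Section Quadratics.
Context (R : realType).

Definition quad (a b c : R) (t : R^o) : R := a * t ^+ 2 + b * t + c.

Lemma is_derive_quad a b c (t v : R^o) : is_derive t v (quad a b c) (v * (2 * a * t + b)).
Proof.
have h1 := @is_derive_id R R^o t v.
have h2 := @is_deriveX R R^o _ 2 t v _ h1.
have h3 := is_deriveD (is_deriveD (is_deriveZ a h2) (is_deriveZ b h1)) (is_derive_cst (c : R^o) t v).
apply: (is_derive_eq h3); rewrite addr0.
change (a * (2%:R * t ^+ 1 * v) + b * v = v * (2 * a * t + b)); ring.
Qed.

Lemma smooth_quad a b c : smooth (quad a b c).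
Proof.
move=> n; elim: n a b c => [|n IH] a b c.
  split=> // t; apply: differentiable_continuous; apply/derivable1_diffP.
  by have [] := is_derive_quad a b c t 1.
split.
  move=> t; apply: differentiable_continuous; apply/derivable1_diffP.
  by have [] := is_derive_quad a b c t 1.
move=> v; split; first by move=> z; have [] := is_derive_quad a b c z v.
rewrite (_ : 'D_v _ = quad 0 (2 * a * v) (v * b)); first exact: IH.
apply/funext => z; have [_ ->] := is_derive_quad a b c z v.
by rewrite /quad; ring.
Qed.

Lemma derive1_quad a b c (t : R) : derive1 (quad a b c : R -> R) t = 2 * a * t + b.
Proof. by rewrite derive1E; have [_ ->] := is_derive_quad a b c t 1; rewrite mul1r. Qed.

End Quadratics.

(** * Continuity and minima of functionals on the space of states *)

Section StateSpace.
Context (R : realType) (d k : nat).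
Local Notation Td := (torus R d).
Local Notation Tk := (torus R k).
Local Notation P := (pmeas R d).
Implicit Types (U V : R -> Td -> P -> Tk -> R) (mu nu : P) (p : Tk).

Lemma tdistxx n (x : torus R n) : tdist x x = 0.
Proof.
apply/eqP; rewrite eq_le tdist_ge0 andbT -[x]reprK; apply: le_trans (tdist_pi_le _ _) _.
by rewrite big1// => i _; rewrite subrr normr0.
Qed.

(** One quantile function parametrizes both measures. Consequently a function continuous for [W1]
    takes equal values at measures that agree on Borel sets. *)
Lemma W1_pmeas_eq mu nu : pmeas_eq mu nu -> W1 mu nu = 0.
Proof.
move=> E; apply/eqP; rewrite eq_le W1_ge0 andbT.
have [q [hq _ lq]] := law_exists mu.
have mq : measurable_fun setT (q : measurableTypeR R -> measurableTypeR R).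
  by apply: nondecreasing_measurable => // u v _ _; exact: hq.
have lq' : law_of nu q by move=> A mA; rewrite -E//; exact: lq.
apply: le_trans (W1_law_le mq mq lq lq') _.
rewrite (_ : path_gap _ _ _ = cst 0) ?Rintegral_cst ?mul0r//.
by apply/funext => u; rewrite /path_gap big1// => i _; rewrite subrr normr0.
Qed.

Lemma txmp_pmeas_eq U t x mu nu p : continuous_txmp U -> 0 <= t -> pmeas_eq mu nu ->
  U t x mu p = U t x nu p.
Proof.
move=> cU t0 E; apply/eqP; rewrite -subr_eq0 -normr_le0; apply/ler_addgt0Pr => e e0.
rewrite add0r; have [del del0 H] := cU t x mu p e t0 e0.
by apply: ltW; apply: H; rewrite ?subrr ?normr0 ?tdistxx ?W1_pmeas_eq.
Qed.

(** What passing to the limit in [<U(t,.,mu,p), nu>] uses. Besides the solutions it covers [A] and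
    [B], seen as functions of [(t, x, m, p)], so a single limit lemma treats all the pairings in the
    cost. *)
Definition regular U :=
  [/\ continuous_txmp U, forall t mu p, 0 <= t -> continuous (fun x => U t x mu p) &
      forall T, 0 < T -> exists M, forall t x mu p, 0 <= t <= T -> `|U t x mu p| <= M].

Lemma space_B't_regular U : space_B't U -> regular U.
Proof.
move=> HU; have [cU C2U _] := HU; split=> //.
- move=> t mu p t0; have := Cn_continuous (C2U t mu t0).
  by move/(@lift2_continuous_l _ _ _ (fun x p => U t x mu p) p).
- move=> T T0; have [M HM] := space_B't_bound HU T0.
  by exists M => t x mu p /HM => /(_ mu)[].
Qed.

Lemma tdist_lt_repr n (x y : torus R n) (e : R) : tdist x y < e ->
  exists u v : 'rV[R]_n, [/\ \pi_(torus R n) u = x, \pi_(torus R n) v = y & `|u - v| <= e].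
Proof.
move=> xy.
have [|_ [[u v] /= [ux vy] <-] ze] := inf_lt _ xy.
  by exists (Num.sqrt (\sum_(i < n) ((repr x) 0 i - (repr y) 0 i) ^+ 2)), (repr x, repr y) => //; split; exact: reprK.
exists u, v; split=> //; apply: le_trans (ltW ze).
change (mx_norm (u - v) <= Num.sqrt (\sum_(i < n) (u 0 i - v 0 i) ^+ 2)).
rewrite mx_normrE; apply/bigmax_leP; split=> [|[i j] _]; first exact: sqrtr_ge0.
rewrite /= !mxE ord1 -sqrtr_sqr ler_wsqrtr// (bigD1 j)//= lerDl.
by apply: sumr_ge0 => ? _; exact: sqr_ge0.
Qed.

Lemma BD_regular (M : R) (A : Td -> Tk -> R) : BD 2 M (lift2 A) ->
  regular (fun _ x _ p => A x p).
Proof.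
move=> bA; split.
- move=> t x m p e t0 e0.
  have M0 := BD_ge0 bA.
  exists (e / (M + 1)); first by rewrite divr_gt0// ltr_wpDl.
  move=> t' x' m' p' _ _ /tdist_lt_repr[u [u' [<- <- du]]] _ /tdist_lt_repr[v [v' [<- <- dv]]].
  have := @BD_lipschitz R _ M (lift2 A) (u', v') ((u, v) - (u', v')) (BDS bA).
  rewrite subrK => h; apply: le_lt_trans h _.
  have : `|(u, v) - (u', v')| <= e / (M + 1) by rewrite prod_normE ge_max /= du dv.
  move=> h; apply: le_lt_trans (ler_wpM2l M0 h) _.
  rewrite mulrCA gtr_pMr// ltr_pdivrMr ?mul1r; first by rewrite ltrDl.
  by rewrite ltr_wpDl.
- by move=> _ _ p _; apply: lift2_continuous_l; exact: BD_continuous (BDS bA).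
- by move=> T _; exists M => _ x _ p _; exact: BD_lift2 bA x p.
Qed.

Lemma cvg_itv (T : R) (t : nat -> R) t' : (forall j, 0 <= t j <= T) ->
  t j @[j --> \oo] --> t' -> 0 <= t' <= T.
Proof.
move=> h c; apply/andP; split.
  by apply: (cvgr_to_ge c); apply: nearW => j; have /andP[] := h j.
by apply: (cvgr_to_le c); apply: nearW => j; have /andP[] := h j.
Qed.

Lemma pair_p_cvg U (T : R) tn t mun mu nun nu pn p : regular U -> 0 < T ->
  (forall j, 0 <= tn j <= T) -> tn j @[j --> \oo] --> t ->
  law_cvg mun mu -> law_cvg nun nu -> tdist p (pn j) @[j --> \oo] --> (0 : R) ->
  pair_p (fun x => U (tn j) x (mun j) (pn j)) (nun j) @[j --> \oo] -->
  pair_p (fun x => U t x mu p) nu.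
Proof.
move=> [cU sU bU] T0 htn ct cmu cnu cp; have [M HM] := bU T T0.
have /andP[t0 _] := cvg_itv htn ct.
have htn0 j : 0 <= tn j by have /andP[] := htn j.
apply: (law_cvg_pair (M := M) cnu).
- by move=> j; exact: sU.
- exact: sU.
- by move=> j x; exact: HM.
- by move=> xn x cx; exact: continuous_txmp_seq.
Qed.

(** Sequential continuity for [law_cvg], the convergence provided by [state_compact]: the direct
    method then runs without a topology on measures. *)
Definition state_continuous (T : R) (W : R -> R -> P -> P -> Tk -> R) : Prop :=
  forall (t s : nat -> R) (mu nu : nat -> P) (p : nat -> Tk) t' s' mu' nu' p',
    (forall j, 0 <= t j <= T) -> (forall j, 0 <= s j <= T) ->
    t j @[j --> \oo] --> t' -> s j @[j --> \oo] --> s' ->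
    law_cvg mu mu' -> law_cvg nu nu' -> tdist p' (p j) @[j --> \oo] --> (0 : R) ->
    W (t j) (s j) (mu j) (nu j) (p j) @[j --> \oo] --> W t' s' mu' nu' p'.

Lemma state_minimum T W (M : R) : state_continuous T W ->
  (forall t s mu nu p, 0 <= t <= T -> 0 <= s <= T -> M <= W t s mu nu p) ->
  forall (t1 s1 : R) (mu1 nu1 : P) (p1 : Tk), 0 <= t1 <= T -> 0 <= s1 <= T ->
  exists t0 s0 mu0 nu0 p0, [/\ 0 <= t0 <= T, 0 <= s0 <= T &
    forall t s mu nu p, 0 <= t <= T -> 0 <= s <= T -> W t0 s0 mu0 nu0 p0 <= W t s mu nu p].
Proof.
move=> cW bW t1 s1 mu1 nu1 p1 ht1 hs1.
pose S := [set r | exists t s mu nu p, [/\ 0 <= t <= T, 0 <= s <= T & r = W t s mu nu p]].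
have hS : has_inf S.
  split; first by exists (W t1 s1 mu1 nu1 p1), t1, s1, mu1, nu1, p1.
  by exists M => _ [t [s [mu [nu [p [? ? ->]]]]]]; exact: bW.
have /choice[z Hz] : forall j : nat, exists z : (R * R) * (P * P) * Tk,
    [/\ 0 <= z.1.1.1 <= T, 0 <= z.1.1.2 <= T &
        W z.1.1.1 z.1.1.2 z.1.2.1 z.1.2.2 z.2 < inf S + j.+1%:R^-1].
  move=> j; have j0 : (0 : R) < j.+1%:R^-1 by rewrite invr_gt0.
  have [_ [t [s [mu [nu [p [? ? ->]]]]]] h] := inf_adherent j0 hS.
  by exists ((t, s), (mu, nu), p).
have [phi [t0 [s0 [mu0 [nu0 [p0 [hphi [ct cs cmu cnu cp]]]]]]]] :=
  @state_compact R d k T (fun j => (z j).1.1.1) (fun j => (z j).1.1.2)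
   (fun j => (z j).1.2.1) (fun j => (z j).1.2.2) (fun j => (z j).2)
   (fun j => let: And3 h _ _ := Hz j in ltac:(by have /andP[h1 h2] := h; rewrite ger0_norm))
   (fun j => let: And3 _ h _ := Hz j in ltac:(by have /andP[h1 h2] := h; rewrite ger0_norm)).
have htp j : 0 <= (z (phi j)).1.1.1 <= T by have [] := Hz (phi j).
have hsp j : 0 <= (z (phi j)).1.1.2 <= T by have [] := Hz (phi j).
exists t0, s0, mu0, nu0, p0; split; [exact: cvg_itv htp ct|exact: cvg_itv hsp cs|].
move=> t s mu nu p ht hs.
apply: (@le_trans _ _ (inf S)); last by apply: ge_inf; [exact: hS.2|exists t, s, mu, nu, p].
have cv := cW _ _ _ _ _ _ _ _ _ _ htp hsp ct cs cmu cnu cp.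
have c2 : inf S + (phi j).+1%:R^-1 @[j --> \oo] --> inf S + 0.
  apply: cvgD; first exact: cvg_cst.
  exact: (cvg_comp _ _ (subseq_infty hphi) (@cvg_harmonic R)).
rewrite addr0 in c2; apply: (ler_cvg_to cv c2); apply: nearW => j.
by have [_ _ /ltW] := Hz (phi j).
Qed.

Definition energy U V (t s : R) mu nu p : R :=
  pair_p (fun x => U t x mu p - V s x nu p) mu - pair_p (fun x => U t x mu p - V s x nu p) nu.

Lemma regular_slice U t mu p : regular U -> 0 <= t -> continuous (fun x => U t x mu p).
Proof. by move=> [_ h _] t0; exact: h. Qed.

Lemma energyE U V t s mu nu p : regular U -> regular V -> 0 <= t -> 0 <= s ->
  energy U V t s mu nu p =
  (pair_p (fun x => U t x mu p) mu - pair_p (fun x => V s x nu p) mu)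
  - (pair_p (fun x => U t x mu p) nu - pair_p (fun x => V s x nu p) nu).
Proof. by move=> rU rV t0 s0; rewrite /energy !pair_pB//; exact: regular_slice. Qed.

Lemma energy_continuous U V (T : R) : regular U -> regular V -> 0 < T ->
  state_continuous T (energy U V).
Proof.
move=> rU rV T0 t s mu nu p t' s' mu' nu' p' ht hs ct cs cmu cnu cp.
have t0 j : 0 <= t j by have /andP[] := ht j.
have s0 j : 0 <= s j by have /andP[] := hs j.
have /andP[t'0 _] := cvg_itv ht ct; have /andP[s'0 _] := cvg_itv hs cs.
rewrite energyE//; under eq_fun do rewrite energyE//.
by apply: cvgB; (apply: cvgB; [exact: (pair_p_cvg rU T0 ht)|exact: (pair_p_cvg rV T0 hs)]).
Qed.

Lemma energy_bounded U V (T : R) : regular U -> regular V -> 0 < T ->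
  exists M, forall t s mu nu p, 0 <= t <= T -> 0 <= s <= T -> `|energy U V t s mu nu p| <= M.
Proof.
move=> rU rV T0; have [_ _ /(_ T T0)[M1 H1]] := rU; have [_ _ /(_ T T0)[M2 H2]] := rV.
exists (2 * (M1 + M2)) => t s mu nu p ht hs.
have /andP[t0 _] := ht; have /andP[s0 _] := hs.
have cD : continuous (fun x => U t x mu p - V s x nu p).
  move=> x; have Fx := nbhs_filter x.
  by apply: cvgB; exact: regular_slice.
have bD x : `|U t x mu p - V s x nu p| <= M1 + M2.
  by apply: le_trans (ler_normB _ _) _; apply: lerD; [exact: H1|exact: H2].
have := pair_p_norm mu cD bD; have := pair_p_norm nu cD bD.
rewrite /energy => h1 h2; apply: le_trans (ler_normB _ _) _; lra.
Qed.

Lemma energy_pmeas_eq U V t s mu nu p : regular U -> regular V -> 0 <= t -> 0 <= s ->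
  pmeas_eq mu nu -> energy U V t s mu nu p = 0.
Proof.
move=> rU rV t0 s0 E; rewrite /energy (pair_p_eq E) ?subrr// => x.
by have Fx := nbhs_filter x; apply: cvgB; exact: regular_slice.
Qed.

(** If every [K = j + 1] failed, a limit point of the failures would have [t = s], because the
    energy is bounded and [j] grows, and [t * s = 0]: its two times are 0, and the energy there is
    at most [- c]. *)
Lemma energy_barrier U V (T c : R) : regular U -> regular V -> 0 < T -> 0 < c ->
  (forall mu nu p, 0 <= energy U V 0 0 mu nu p) ->
  exists2 K : R, 0 < K & forall t s mu nu p, 0 <= t <= T -> 0 <= s <= T ->
    energy U V t s mu nu p + K * (t - s) ^+ 2 <= - c -> 0 < t /\ 0 < s.
Proof.
move=> rU rV T0 c0 E0; apply: contrapT => nK.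
(* The failure of [0 < t /\ 0 < s] is recorded as [t * s = 0], an equation that passes to the
   limit. *)
have /choice[z Hz] : forall j : nat, exists z : (R * R) * (P * P) * Tk,
    [/\ 0 <= z.1.1.1 <= T, 0 <= z.1.1.2 <= T,
        energy U V z.1.1.1 z.1.1.2 z.1.2.1 z.1.2.2 z.2 + j.+1%:R * (z.1.1.1 - z.1.1.2) ^+ 2 <= - c
        & z.1.1.1 * z.1.1.2 = 0].
  move=> j; apply: contrapT => nz; apply: nK; exists j.+1%:R => // t s mu nu p ht hs Hle.
  have /andP[t0 _] := ht; have /andP[s0 _] := hs.
  rewrite !lt_def t0 s0 !andbT; apply/andP; rewrite -negb_or -mulf_eq0.
  by apply/negP => /eqP ts; apply: nz; exists ((t, s), (mu, nu), p).
have [M HM] := energy_bounded rU rV T0.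
have ht j : 0 <= (z j).1.1.1 <= T by have [] := Hz j.
have hs j : 0 <= (z j).1.1.2 <= T by have [] := Hz j.
have nt j : `|(z j).1.1.1| <= T by have /andP[h1 h2] := ht j; rewrite ger0_norm.
have ns j : `|(z j).1.1.2| <= T by have /andP[h1 h2] := hs j; rewrite ger0_norm.
have [phi [t0 [s0 [mu0 [nu0 [p0 [hphi [ct cs cmu cnu cp]]]]]]]] :=
  @state_compact R d k T (fun j => (z j).1.1.1) (fun j => (z j).1.1.2)
   (fun j => (z j).1.2.1) (fun j => (z j).1.2.2) (fun j => (z j).2) nt ns.
have cphi := subseq_infty hphi.
have ce := energy_continuous rU rV T0 (fun j => ht (phi j)) (fun j => hs (phi j)) ct cs cmu cnu cp.
have ed : energy U V t0 s0 mu0 nu0 p0 <= - c.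
  apply: (cvgr_to_le ce); apply: nearW => j; have [_ _ h _] := Hz (phi j).
  by apply: le_trans h; rewrite lerDl mulr_ge0// sqr_ge0.
have ts0 : t0 * s0 = 0.
  apply: (cvg_unique _ (cvgM ct cs)) => //.
  rewrite (_ : _ \* _ = fun=> 0); first exact: cvg_cst.
  by apply/funext => j /=; have [] := Hz (phi j).
have d0 : (t0 - s0) ^+ 2 <= 0.
  have c2 : M * (phi j).+1%:R^-1 @[j --> \oo] --> M * 0.
    by apply: cvgM; [exact: cvg_cst|exact: (cvg_comp _ _ cphi (@cvg_harmonic R))].
  rewrite mulr0 in c2.
  have cd : ((z (phi j)).1.1.1 - (z (phi j)).1.1.2) ^+ 2 @[j --> \oo] --> (t0 - s0) ^+ 2.
    by rewrite expr2; under eq_fun do rewrite expr2; apply: cvgM; exact: cvgB.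
  apply: (ler_cvg_to cd c2); apply: nearW => j; rewrite ler_pdivlMr//.
  have [_ _ h _] := Hz (phi j).
  have := HM _ _ (z (phi j)).1.2.1 (z (phi j)).1.2.2 (z (phi j)).2 (ht (phi j)) (hs (phi j)).
  by rewrite ler_norml => /andP[h1 _]; rewrite mulrC; lra.
have ets : t0 = s0 by apply/eqP; rewrite -subr_eq0 -sqrf_eq0 eq_le d0 sqr_ge0.
have t00 : t0 = 0 by move: ts0; rewrite -ets -expr2 => /eqP; rewrite sqrf_eq0 => /eqP.
by move: ed (E0 mu0 nu0 p0); rewrite -ets t00 => h1 h2; lra.
Qed.

End StateSpace.

Lemma ler_norm_sum_cst (R : realType) n (F : 'I_n -> R) (c : R) :
  (forall i, `|F i| <= c) -> `|\sum_(i < n) F i| <= n%:R * c.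
Proof.
move=> Fc; apply: le_trans (ler_norm_sum _ _ _) _.
apply: le_trans (ler_sum _ (fun i _ => Fc i)) _.
by rewrite sumr_const card_ord mulr_natl.
Qed.

Lemma sum_sub_sub (R : realType) n (F G L M : 'I_n -> R) :
  (forall i, F i = G i - (L i - M i)) ->
  \sum_(i < n) F i = \sum_(i < n) G i - (\sum_(i < n) L i - \sum_(i < n) M i).
Proof. by move=> E; rewrite -!sumrB; apply: eq_bigr. Qed.

(** The letters [f], [h], [t], [l], [x], [r] stand for pairings of [f], [hjb], [transport],
    [sigma * lapx], [drift] and [sigma' * lapp], and [q] comes from [K (t - s)^2]. The two tested
    inequalities group the [h] terms by solution, the two dissipation bounds by measure; their sums
    contain the same four terms. *)
Lemma balance (R : realFieldType) (C gam q x1 x2 r1 r2 l1 l2 f1 f2 f3 f4 t1 t2 h1 h2 h3 h4 : R) :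
  0 <= r1 + r2 -> x1 + x2 = 0 -> 0 <= f1 - f3 - (f2 - f4) ->
  f1 - f2 + t1 - l1 <= q - gam + (h1 - h2) ->
  f4 - f3 + t2 - l2 <= - q - gam + (h4 - h3) ->
  h1 - h3 - t1 + l1 <= C - x1 - r1 -> h4 - h2 - t2 + l2 <= C - x2 - r2 -> gam <= C.
Proof. lra. Qed.

(** * The inequality satisfied at a minimum with doubled time *)

Section Dissipation.
Context (R : realType) (d k : nat).
Local Notation Td := (torus R d).
Local Notation Tk := (torus R k).
Local Notation P := (pmeas R d).
Context (sigma sigma' : R) (hsigma : 0 < sigma) (hsigma' : 0 <= sigma').
Context (b : Tk -> 'rV[R]_k) (H : Td -> 'rV[R]_d -> R) (HC1 : C1_hamiltonian H)
  (Hconvex : forall x, convex_function setT (H x)).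
Implicit Types (g h A : Td -> Tk -> R) (p : Tk) (mu nu : P).

Local Opaque dd pair_p.

Definition gradx g p x : 'rV[R]_d := \row_i dd (inl i) g x p.
Definition lapx g p x : R := \sum_(i < d) dd (inl i) (dd (inl i) g) x p.
Definition lapp g p x : R := \sum_(j < k) dd (inr j) (dd (inr j) g) x p.
Definition drift g p x : R := \sum_(j < k) b p 0 j * dd (inr j) g x p.
Definition hjb g p x : R :=
  - sigma * lapx g p x - drift g p x - sigma' * lapp g p x + H x (gradx g p x).
Definition transport g h p x : R := \sum_(i < d) dd (inl i) g x p * DpH H x (gradx h p x) 0 i.

Lemma C2_Cn1 g : C2 g -> Cn 1 (lift2 g).
Proof. exact: (@CnS _ _ 1). Qed.

Lemma dd_continuous a g p : Cn 1 (lift2 g) -> continuous ((dd a g)^~ p).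
Proof. by move=> Cg; apply: lift2_continuous_l; exact: Cn_continuous (Cn_dd a Cg). Qed.

Lemma dd2_continuous a g p : C2 g -> continuous ((dd a (dd a g))^~ p).
Proof. by move=> Cg; apply: dd_continuous; exact: Cn_dd. Qed.

Lemma continuousMl (c : R) (u : Td -> R) : continuous u -> continuous (fun x => c * u x).
Proof. by move=> cu x; have Fx := nbhs_filter x; apply: cvgMl_tmp; exact: cu. Qed.

Lemma lapx_continuous g p : C2 g -> continuous (lapx g p).
Proof. by move=> Cg; apply: continuous_sumr => i; exact: dd2_continuous. Qed.

Lemma lapp_continuous g p : C2 g -> continuous (lapp g p).
Proof. by move=> Cg; apply: continuous_sumr => i; exact: dd2_continuous. Qed.

Lemma drift_continuous g p : C2 g -> continuous (drift g p).
Proof.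
move=> Cg; apply: continuous_sumr => j; apply: continuousMl; apply: dd_continuous.
exact: C2_Cn1 Cg.
Qed.

Lemma gradx_continuous g p : C2 g -> forall i, continuous (fun x => gradx g p x 0 i).
Proof.
move=> Cg i; under eq_fun do rewrite mxE.
by apply: dd_continuous; exact: C2_Cn1 Cg.
Qed.

Lemma hjb_continuous g p : C2 g -> continuous (hjb g p).
Proof.
move=> Cg x; have Fx := nbhs_filter x.
have c1 := @continuousMl (- sigma) _ (lapx_continuous (p := p) Cg).
have c2 := @continuousMl sigma' _ (lapp_continuous (p := p) Cg).
have c3 := drift_continuous (p := p) Cg.
have c4 := H_continuous HC1 (gradx_continuous (p := p) Cg).
by apply: cvgD; [apply: cvgB; [apply: cvgB; [exact: c1|exact: c3]|exact: c2]|exact: c4].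
Qed.

Lemma transport_continuous g h p : C2 g -> C2 h -> continuous (transport g h p).
Proof.
move=> Cg Ch; apply: continuous_sumr => i x; have Fx := nbhs_filter x.
apply: cvgM; first exact: (@dd_continuous (inl i) g p (C2_Cn1 Cg) x).
exact: (DpH_continuous HC1 (gradx_continuous (p := p) Ch)).
Qed.

(** Two solutions are compared at the same measure. Written with [w = g - h + A], the contributions
    of [g] and [h] cancel, have a sign by [convex_gradient], or stay in [drift w] and [lapp w],
    which minimality in [p] controls. The rest comes from [A]: the four summands of the constant
    bound its transport, its Laplacian in [x], its drift and its Laplacian in [p]. *)
Lemma dissipation_le g h A (beta Bb Bh : R) p x : C2 g -> C2 h -> C2 A ->
  (forall a x p, `|dd a A x p| <= beta) -> (forall a x p, `|dd a (dd a A) x p| <= beta) ->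
  (forall j, `|b p 0 j| <= Bb) -> (forall i, `|DpH H x (gradx g p x) 0 i| <= Bh) ->
  let w := fun x p => g x p - (h x p - A x p) in
  (hjb g p x - hjb h p x - transport w g p x + sigma * lapx w p x <=
  (d%:R * Bh + sigma * d%:R + k%:R * Bb + sigma' * k%:R) * beta
    - drift w p x - sigma' * lapp w p x : Prop).
Proof.
move=> Cg Ch CA bA1 bA2 bb bH w.
have Cd a (u : Td -> Tk -> R) : C2 u -> Cn 1 (lift2 (dd a u)) by exact: Cn_dd.
have d1 a : dd a w = fun x p => dd a g x p - (dd a h x p - dd a A x p).
  rewrite /w ddB; [|exact: C2_Cn1 Cg|exact: C2_Cn1 (CnB Ch CA : C2 (fun x p => h x p - A x p))].
  by rewrite ddB//; [exact: C2_Cn1 Ch|exact: C2_Cn1 CA].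
have d2 a : dd a (dd a w) =
    fun x p => dd a (dd a g) x p - (dd a (dd a h) x p - dd a (dd a A) x p).
  rewrite d1 ddB; [|exact: Cd|exact: CnB (Cd a _ Ch) (Cd a _ CA)].
  by rewrite ddB//; exact: Cd.
have El : lapx w p x = lapx g p x - (lapx h p x - lapx A p x).
  by apply: sum_sub_sub => i; rewrite d2.
have Er : lapp w p x = lapp g p x - (lapp h p x - lapp A p x).
  by apply: sum_sub_sub => i; rewrite d2.
have Ed : drift w p x = drift g p x - (drift h p x - drift A p x).
  by apply: sum_sub_sub => i; rewrite d1 !mulrBr.
have Et : transport w g p x =
    transport A g p x - dotv (gradx h p x - gradx g p x) (DpH H x (gradx g p x)).
  by rewrite /transport /dotv -sumrB; apply: eq_bigr => i _; rewrite d1 [(_ - gradx _ _ _) _ _]mxE [(- gradx _ _ _) _ _]mxE ![gradx _ _ _ _ _]mxE; ring.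
have := convex_gradient HC1 Hconvex x (gradx g p x) (gradx h p x).
have bl : `|lapx A p x| <= d%:R * beta.
  by rewrite /lapx; apply: (@ler_norm_sum_cst R d _ beta) => i; exact: (bA2 (inl i) x p).
have br : `|lapp A p x| <= k%:R * beta.
  by rewrite /lapp; apply: (@ler_norm_sum_cst R k _ beta) => i; exact: (bA2 (inr i) x p).
have bd : `|drift A p x| <= k%:R * (Bb * beta).
  rewrite /drift; apply: (@ler_norm_sum_cst R k _ (Bb * beta)) => i.
  by rewrite normrM; apply: ler_pM => //; exact: (bA1 (inr i) x p).
have bt : `|transport A g p x| <= d%:R * (beta * Bh).
  rewrite /transport; apply: (@ler_norm_sum_cst R d _ (beta * Bh)) => i.
  by rewrite normrM; apply: ler_pM => //; exact: (bA1 (inl i) x p).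
rewrite El Er Ed Et /hjb.
move: bl br bd bt; rewrite !ler_norml => /andP[_ bl] /andP[_ br] /andP[_ bd] /andP[bt _].
have := ler_wpM2l (ltW hsigma) bl; have := ler_wpM2l hsigma' br; move: bd bt.
clear.
move: (dotv _ _) (transport _ _ _ _) (H x _) (H x _) (d%:R : R) (k%:R : R) => D Tr h1 h2 dR kR.
move: (drift _ _ _) (drift _ _ _) (drift _ _ _) => d1 d2 d3.
move: (lapx _ _ _) (lapx _ _ _) (lapx _ _ _) (lapp _ _ _) (lapp _ _ _) (lapp _ _ _) => l1 l2 l3 r1 r2 r3.
move=> bd bt br bl hc; rewrite !mulrDl.
move: bd bt br bl; rewrite !mulrBr !mulNr !mulrA.
set m1 := sigma * l1; set m2 := sigma * l2; set m3 := sigma * l3.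
lra.
Qed.

Context (f U0 : Td -> P -> Tk -> R) (fcont : continuous_xmp f)
  (fmono : forall p, monotone_fun (fun x m => f x m p)).

Lemma f_continuous mu p : continuous (fun x => f x mu p).
Proof.
apply: tdist_continuous => x e e0; have [del del0 Hf] := fcont x mu p e0.
by exists del => // y xy; apply: Hf => //; rewrite ?tdistxx ?W1_pmeas_eq.
Qed.

(** The inequality of a monotone solution with the signed measure taken to be [charge_of nu], and
    with all derivatives expressed by [dd], which both solutions then share. *)
Lemma solution_test U (phi : Td -> Tk -> R) nu (theta : R -> R) (T t0 : R) mu0 p0 :
  monotone_solution sigma sigma' b H f U0 U ->
  C2 phi -> smooth (theta : R^o -> R) -> 0 < T -> 0 < t0 <= T ->
  (forall t mu p, 0 <= t <= T -> ~ [/\ t = t0, pmeas_eq mu mu0 & p = p0] ->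
    pair_p (fun x => U t0 x mu0 p0 - phi x p0) mu0
      - pair_p (fun x => U t0 x mu0 p0 - phi x p0) nu - theta t0 <
    pair_p (fun x => U t x mu p - phi x p) mu
      - pair_p (fun x => U t x mu p - phi x p) nu - theta t) ->
  let g := fun x p => U t0 x mu0 p in let w := fun x p => g x p - phi x p in
  (pair_p (fun x => f x mu0 p0) mu0 - pair_p (fun x => f x mu0 p0) nu
    + pair_p (transport w g p0) mu0 - sigma * pair_p (lapx w p0) mu0
  <= derive1 theta t0 + (pair_p (hjb g p0) mu0 - pair_p (hjb g p0) nu) : Prop).
Proof.
move=> [BU _ sol] Cphi sth T0 t0T Hmin g w.
have rU := space_B't_regular BU; have [_ C2U _] := BU.
have t00 : 0 <= t0 by have /andP[/ltW] := t0T.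
have Cg : C2 g by exact: C2U.
have Cw : C2 w by exact: CnB Cg Cphi.
have cphi p : continuous (phi^~ p) by apply: lift2_continuous_l; exact: Cn_continuous Cphi.
have cw t mu p : 0 <= t -> continuous (fun x => U t x mu p - phi x p).
  move=> t0'; move=> x; have Fx := nbhs_filter x.
  by apply: cvgB; [exact: regular_slice|exact: cphi].
have := sol phi (charge_of nu) theta T t0 mu0 p0 Cphi sth T0 t0T.
have smin : strict_min_point T (fun t m p => pair_p (fun x => U t x m p - phi x p) m
    - pair_s (fun x => U t x m p - phi x p) (charge_of nu) - theta t) t0 mu0 p0.
  move=> t mu p ht hn; rewrite !pair_s_charge; try exact: cw; first exact: Hmin.
  by apply: cw; have /andP[] := ht.
move=> /(_ smin) /=.
have -> : (fun x => - sigma * lap (fun x => U t0 x mu0 p0) x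
    - dotv (b p0) (grad (fun p => U t0 x mu0 p) p0)
    - sigma' * lap (fun p => U t0 x mu0 p) p0
    + H x (grad (fun x => U t0 x mu0 p0) x)) = hjb g p0.
  apply/funext => x; rewrite /hjb (lap_dd_l g p0 x) (lap_dd_r g x p0).
  congr (_ - _ - _ + H x _).
    by rewrite /dotv /drift; apply: eq_bigr => j _; rewrite mxE (partial_dd_r j g x).
  by apply/rowP => i; rewrite !mxE (partial_dd_l i g p0).
have -> : lap (fun x => U t0 x mu0 p0 - phi x p0) = lapx w p0.
  by apply/funext => x; rewrite (lap_dd_l w p0 x).
rewrite /pair_div.
have -> : (fun x => dotv (grad (fun x => U t0 x mu0 p0 - phi x p0) x)
    (DpH H x (grad (fun x => U t0 x mu0 p0) x))) = transport w g p0.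
  apply/funext => x; rewrite /dotv /transport; apply: eq_bigr => i _.
  rewrite [grad _ _ _ _]mxE (partial_dd_l i w p0); congr (_ * DpH H x _ 0 i).
  by apply/rowP => l; rewrite !mxE (partial_dd_l l g p0).
rewrite !pair_s_charge ?opprK//; first exact: hjb_continuous.
exact: f_continuous.
Qed.

Definition cost U V A B (K gam t s : R) mu nu p : R :=
  energy U V t s mu nu p + K * (t - s) ^+ 2 + gam * (t + s)
  + (pair_p (A^~ p) mu + pair_p (B^~ p) nu).

Lemma pair_p_lapp mu g p : C2 g ->
  pair_p (lapp g p) mu = \sum_(j < k) pair_p ((dd (inr j) (dd (inr j) g))^~ p) mu.
Proof. by move=> Cg; rewrite pair_p_sum// => j; exact: dd2_continuous. Qed.

Lemma pair_p_drift mu g p : C2 g ->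
  pair_p (drift g p) mu = \sum_(j < k) b p 0 j * pair_p ((dd (inr j) g)^~ p) mu.
Proof.
move=> Cg; have cg j : continuous ((dd (inr j) g)^~ p) by apply: dd_continuous; exact: C2_Cn1.
rewrite pair_p_sum; last by move=> j; apply: continuousMl; exact: cg.
by apply: eq_bigr => j _; rewrite pair_pZ.
Qed.

Lemma pair_dissipation_le mu g h A (beta Bb Bh : R) p : C2 g -> C2 h -> C2 A ->
  (forall a x p, `|dd a A x p| <= beta) -> (forall a x p, `|dd a (dd a A) x p| <= beta) ->
  (forall j, `|b p 0 j| <= Bb) -> (forall x i, `|DpH H x (gradx g p x) 0 i| <= Bh) ->
  let w := fun x p => g x p - (h x p - A x p) in
  (pair_p (hjb g p) mu - pair_p (hjb h p) mu - pair_p (transport w g p) mu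
    + sigma * pair_p (lapx w p) mu <=
  (d%:R * Bh + sigma * d%:R + k%:R * Bb + sigma' * k%:R) * beta
    - pair_p (drift w p) mu - sigma' * pair_p (lapp w p) mu : Prop).
Proof.
move=> Cg Ch CA bA1 bA2 bb bH w.
have Cw : C2 w by exact: CnB Cg (CnB Ch CA).
have cg := hjb_continuous (p := p) Cg; have ch := hjb_continuous (p := p) Ch.
have ct := transport_continuous (p := p) Cw Cg.
have cl := lapx_continuous (p := p) Cw; have cr := lapp_continuous (p := p) Cw.
have cd := drift_continuous (p := p) Cw.
have csl := @continuousMl sigma _ cl; have csr := @continuousMl sigma' _ cr.
have cB (u v : Td -> R) : continuous u -> continuous v -> continuous (fun x => u x - v x).
  by move=> cu cv x; have Fx := nbhs_filter x; apply: cvgB; [exact: cu|exact: cv].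
have cD (u v : Td -> R) : continuous u -> continuous v -> continuous (fun x => u x + v x).
  by move=> cu cv x; have Fx := nbhs_filter x; apply: cvgD; [exact: cu|exact: cv].
have cc (c : R) : continuous (fun _ : Td => c) by exact: cst_continuous.
rewrite -(pair_pZ sigma mu cl) -(pair_pZ sigma' mu cr) -(pair_p_cst (_ * beta) mu).
rewrite -(pair_pB mu cg ch) -(pair_pB mu (cB _ _ cg ch) ct) -(pair_pD mu (cB _ _ (cB _ _ cg ch) ct) csl).
rewrite -(pair_pB mu (cc _) cd) -(pair_pB mu (cB _ _ (cc _) cd) csr).
apply: pair_p_le; [exact: cD (cB _ _ (cB _ _ cg ch) ct) csl|exact: cB (cB _ _ (cc _) cd) csr|].
by move=> x; exact: (dissipation_le (h := h) (A := A) Cg Ch CA bA1 bA2 bb (bH x)).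
Qed.

Lemma min_in_p_operators mu nu g h p0 : C2 g -> C2 h ->
  (forall p, pair_p (g^~ p0) mu + pair_p (h^~ p0) nu <= pair_p (g^~ p) mu + pair_p (h^~ p) nu) ->
  pair_p (drift g p0) mu + pair_p (drift h p0) nu = 0 /\
  0 <= pair_p (lapp g p0) mu + pair_p (lapp h p0) nu.
Proof.
move=> Cg Ch minp; have crit j := min_in_p j Cg Ch minp; split.
  rewrite !pair_p_drift// -big_split big1//= => j _.
  by have [c1 _] := crit j; rewrite -mulrDr; exact: etrans (congr1 _ c1) (mulr0 _).
by rewrite (pair_p_lapp _ _ Cg) (pair_p_lapp _ _ Ch) -big_split /=; apply: sumr_ge0 => j _; exact: proj2 (crit j).
Qed.

Lemma doubled_minimum U V A B (K gam beta Bb Bh T t0 s0 : R) mu0 nu0 p0 :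
  monotone_solution sigma sigma' b H f U0 U -> monotone_solution sigma sigma' b H f U0 V ->
  0 < T -> 0 < t0 <= T -> 0 < s0 <= T ->
  BD 4 beta (lift2 A) -> BD 4 beta (lift2 B) ->
  (forall x p p', A x p + B x p = A x p' + B x p') ->
  (forall j, `|b p0 0 j| <= Bb) ->
  (forall x i, `|DpH H x (gradx (fun x p => U t0 x mu0 p) p0 x) 0 i| <= Bh) ->
  (forall x i, `|DpH H x (gradx (fun x p => V s0 x nu0 p) p0 x) 0 i| <= Bh) ->
  (forall t s mu nu p, 0 <= t <= T -> 0 <= s <= T ->
    ~ ([/\ t = t0, s = s0 & pmeas_eq mu mu0] /\ pmeas_eq nu nu0 /\ p = p0) ->
    cost U V A B K gam t0 s0 mu0 nu0 p0 <
    cost U V A B K gam t s mu nu p + ((t - t0) ^+ 2 + (s - s0) ^+ 2)) ->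
  gam <= (d%:R * Bh + sigma * d%:R + k%:R * Bb + sigma' * k%:R) * beta.
Proof.
move=> sU sV T0 t0T s0T bA bB AB bb bHU bHV Hmin.
have [BU _ _] := sU; have [BV _ _] := sV; have [_ C2U _] := BU; have [_ C2V _] := BV.
have rU := space_B't_regular BU; have rV := space_B't_regular BV.
have t00 : 0 <= t0 by have /andP[/ltW] := t0T.
have s00 : 0 <= s0 by have /andP[/ltW] := s0T.
have t0T' : 0 <= t0 <= T by have /andP[_ ->] := t0T; rewrite t00.
have s0T' : 0 <= s0 <= T by have /andP[_ ->] := s0T; rewrite s00.
pose gU x p := U t0 x mu0 p; pose gV x p := V s0 x nu0 p.
have CU : C2 gU by exact: C2U.
have CV : C2 gV by exact: C2V.
have CA : C2 A by apply: CnS; exact: BD_Cn bA.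
have CB : C2 B by apply: CnS; exact: BD_Cn bB.
have bA1 a x p : `|dd a A x p| <= beta by exact: (BD_lift2 (BD_dd a bA)).
have bB1 a x p : `|dd a B x p| <= beta by exact: (BD_lift2 (BD_dd a bB)).
have bA2 a x p : `|dd a (dd a A) x p| <= beta by exact: (BD_lift2 (BD_dd a (BD_dd a bA))).
have bB2 a x p : `|dd a (dd a B) x p| <= beta by exact: (BD_lift2 (BD_dd a (BD_dd a bB))).
have cA p : continuous (A^~ p) by apply: lift2_continuous_l; exact: Cn_continuous CA.
have cB p : continuous (B^~ p) by apply: lift2_continuous_l; exact: Cn_continuous CB.
have cU t mu p : 0 <= t -> continuous (fun x => U t x mu p) by exact: regular_slice.
have cV t mu p : 0 <= t -> continuous (fun x => V t x mu p) by exact: regular_slice.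
have csub (u v : Td -> R) : continuous u -> continuous v -> continuous (fun x => u x - v x).
  by move=> cu cv x; have Fx := nbhs_filter x; apply: cvgB; [exact: cu|exact: cv].
have P3 (u v a : Td -> R) mu : continuous u -> continuous v -> continuous a ->
    pair_p (fun x => u x - (v x - a x)) mu = pair_p u mu - (pair_p v mu - pair_p a mu).
  by move=> cu cv ca; rewrite pair_pB ?pair_pB//; exact: csub.
have PAB mu p : pair_p (A^~ p) mu + pair_p (B^~ p) mu = pair_p (A^~ p0) mu + pair_p (B^~ p0) mu.
  rewrite -!pair_pD//; congr (pair_p _ mu); apply/funext => x; exact: AB.
pose w1 x p := gU x p - (gV x p - A x p); pose w2 x p := gV x p - (gU x p - B x p).
have Cw1 : C2 w1 by exact: CnB CU (CnB CV CA).
have Cw2 : C2 w2 by exact: CnB CV (CnB CU CB).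
(* Here [theta t = - (K (t - s0)^2 + (t - t0)^2 + gam t)], expanded; its derivative at [t0] no
   longer sees the added square. *)
have test1 := @solution_test U (fun x p => gV x p - A x p) nu0
  (quad (- (K + 1)) (2 * K * s0 + 2 * t0 - gam) (- (K * s0 ^+ 2 + t0 ^+ 2))) T t0 mu0 p0
  sU (CnB CV CA) (smooth_quad _ _ _) T0 t0T.
have {}test1 := test1 _.
have test2 := @solution_test V (fun x p => gU x p - B x p) mu0
  (quad (- (K + 1)) (2 * K * t0 + 2 * s0 - gam) (- (K * t0 ^+ 2 + s0 ^+ 2))) T s0 nu0 p0
  sV (CnB CU CB) (smooth_quad _ _ _) T0 s0T.
have {}test2 := test2 _.
(* Up to constants, the functional tested by [U] is the cost with [s] and [nu] frozen, plus the
   square in [t]; [PAB] trades [- <A(.,p), nu0>] for [<B(.,p), nu0>]. *)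
have E1 t mu p : 0 <= t -> pair_p (fun x => U t x mu p - (gV x p - A x p)) mu
      - pair_p (fun x => U t x mu p - (gV x p - A x p)) nu0
      - quad (- (K + 1)) (2 * K * s0 + 2 * t0 - gam) (- (K * s0 ^+ 2 + t0 ^+ 2)) t =
    cost U V A B K gam t s0 mu nu0 p + ((t - t0) ^+ 2 + (s0 - s0) ^+ 2)
    - (pair_p (A^~ p0) nu0 + pair_p (B^~ p0) nu0) - gam * s0.
  move=> th; rewrite -(PAB nu0 p) !P3//; try exact: cU; try exact: cV.
  by rewrite /cost energyE// /quad /gV; ring.
have E2 s nu p : 0 <= s -> pair_p (fun x => V s x nu p - (gU x p - B x p)) nu
      - pair_p (fun x => V s x nu p - (gU x p - B x p)) mu0
      - quad (- (K + 1)) (2 * K * t0 + 2 * s0 - gam) (- (K * t0 ^+ 2 + s0 ^+ 2)) s =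
    cost U V A B K gam t0 s mu0 nu p + ((t0 - t0) ^+ 2 + (s - s0) ^+ 2)
    - (pair_p (A^~ p0) mu0 + pair_p (B^~ p0) mu0) - gam * t0.
  move=> sh; rewrite -(PAB mu0 p) !P3//; try exact: cU; try exact: cV.
  by rewrite /cost energyE// /quad /gU; ring.
have {}test1 := test1 ltac:(move=> t mu p ht hn; have /andP[th _] := ht;
  rewrite (E1 t0 mu0 p0 t00) (E1 t mu p th) !ltrD2r !subrr expr0n /= !addr0;
  have := Hmin t s0 mu nu0 p ht s0T'; rewrite subrr expr0n /= addr0; apply;
  by move=> [[? _ ?] [_ ?]]; apply: hn).
have {}test2 := test2 ltac:(move=> s nu p hs hn; have /andP[sh _] := hs;
  rewrite (E2 s0 nu0 p0 s00) (E2 s nu p sh) !ltrD2r !subrr expr0n /= !addr0;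
  have := Hmin t0 s mu0 nu p t0T' hs; rewrite subrr expr0n /= add0r; apply;
  by move=> [[_ ? _] [? ?]]; apply: hn).
have diss1 := pair_dissipation_le mu0 CU CV CA bA1 bA2 bb bHU.
have diss2 := pair_dissipation_le nu0 CV CU CB bB1 bB2 bb bHV.
(* As a function of [p] alone, the cost is [<w1(.,p), mu0> + <w2(.,p), nu0>] up to a constant. *)
have minp p : pair_p (w1^~ p0) mu0 + pair_p (w2^~ p0) nu0 <= pair_p (w1^~ p) mu0 + pair_p (w2^~ p) nu0.
  have [->|ne] := pselect (p = p0); first exact: lexx.
  have := Hmin t0 s0 mu0 nu0 p t0T' s0T' (fun E => ne (proj2 (proj2 E))).
  rewrite !subrr expr0n /= !addr0 /cost !energyE// => /ltW.
  rewrite /w1 /w2 !P3//; try exact: cU; try exact: cV.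
  by rewrite /gU /gV => h; lra.
have [drift0 lapp0] := min_in_p_operators Cw1 Cw2 minp.
have fm := fmono p0 mu0 nu0.
rewrite !pair_pB// in fm; try exact: f_continuous.
have {}lapp0 := mulr_ge0 hsigma' lapp0; rewrite mulrDr in lapp0.
move: test1 test2 diss1 diss2; rewrite /= !derive1_quad.
rewrite -/gU -/gV -/w1 -/w2.
have -> : 2 * - (K + 1) * t0 + (2 * K * s0 + 2 * t0 - gam) = 2 * K * (s0 - t0) - gam by ring.
have -> : 2 * - (K + 1) * s0 + (2 * K * t0 + 2 * s0 - gam) = - (2 * K * (s0 - t0)) - gam by ring.
exact: balance lapp0 drift0 fm.
Qed.

End Dissipation.

(** * Convex combinations of probability measures *)

Section Mixture.
Context (R : realType) (n : nat) (mu lam : pmeas R n) (h : R) (h01 : 0 <= h <= 1).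
Local Notation T := (torus R n).

Let h0 : 0 <= h. Proof. by have /andP[] := h01. Qed.
Let h1 : 0 <= 1 - h. Proof. by have /andP[] := h01; rewrite subr_ge0. Qed.

Definition mixture : set T -> \bar R :=
  measure_add (mscale (NngNum h1) mu) (mscale (NngNum h0) lam).

HB.instance Definition _ := Measure.on mixture.

Let mixture_setT : mixture setT = 1%E.
Proof.
rewrite /mixture measure_addE.
change ((1 - h)%:E * mu setT + h%:E * lam setT = 1)%E.
by rewrite !probability_setT !mule1 -EFinD subrK.
Qed.

HB.instance Definition _ := Measure_isProbability.Build _ _ _ mixture mixture_setT.

Lemma pair_p_mixture (g : T -> R) : continuous g ->
  pair_p g (mixture : pmeas R n) = (1 - h) * pair_p g mu + h * pair_p g lam.
Proof.
move=> cg; have [M gM] := torus_bounded cg.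
have cM : continuous (fun _ : T => M) by exact: cst_continuous.
have cgM : continuous (fun x => g x + M).
  by move=> x; have Fx := nbhs_filter x; apply: cvgD; [exact: cg|exact: cM].
(* Shifting by the bound [M] makes the integrand nonnegative, the setting of the formulas for sums
   and multiples of measures. *)
suff E : pair_p (fun x => g x + M) (mixture : pmeas R n) =
    (1 - h) * pair_p (fun x => g x + M) mu + h * pair_p (fun x => g x + M) lam.
  by move: E; rewrite !pair_pD// !pair_p_cst => E; apply: (addIr M); rewrite E; ring.
have g0 x : (0 <= (g x + M)%:E)%E.
  by rewrite lee_fin -lerBlDr sub0r; have := gM x; rewrite ler_norml => /andP[].
have mg : measurable_fun setT (fun x => (g x + M)%:E).
  by apply/measurable_EFinP; exact: torus_measurable_continuous.
have Imu (m : pmeas R n) : (\int[m]_x (g x + M)%:E)%E = (pair_p (fun x => g x + M) m)%:E.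
  by rewrite /pair_p /Rintegral fineK// integral_fune_fin_num//; exact: torus_integrable.
apply: EFin_inj; rewrite -Imu /mixture ge0_integral_measure_add//.
by rewrite !ge0_integral_mscale// !Imu.
Qed.

End Mixture.

(** * Nonnegativity of the bracket and uniqueness *)

Section Uniqueness.
Context (R : realType) (d k : nat).
Local Notation Td := (torus R d).
Local Notation Tk := (torus R k).
Local Notation P := (pmeas R d).

Lemma law_cvg_cst (mu : P) : law_cvg (fun=> mu) mu.
Proof.
have [q [hq _ lq]] := law_exists mu.
have mq : measurable_fun setT (q : measurableTypeR R -> measurableTypeR R).
  by apply: nondecreasing_measurable => // u v _ _; exact: hq.
exists (fun=> q), q; split=> //; apply: aeW => u; exact: cvg_cst.
Qed.

Lemma pair_p_dirac (g : Td -> R) x : continuous g -> pair_p g (\d_x : P) = g x.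
Proof.
move=> cg; rewrite /pair_p /Rintegral integral_dirac//.
  by rewrite diracT mul1e.
by apply/measurable_EFinP; exact: torus_measurable_continuous.
Qed.

Lemma field_bounded (b : Tk -> 'rV[R]_k) : smooth_field b ->
  exists M, forall p j, `|b p 0 j| <= M.
Proof.
move=> sb; have /choice[M HM] : forall j, exists M, forall p, `|b p 0 j| <= M.
  move=> j; apply: torus_bounded; apply/torus_continuousP.
  exact: Cn_continuous (sb j 0%N).
exists (\sum_j `|M j|) => p j; apply: le_trans (HM j p) _; apply: le_trans (ler_norm _) _.
by rewrite (bigD1 j)//= lerDl; exact: sumr_ge0.
Qed.

Lemma cost_continuous (U V : R -> Td -> P -> Tk -> R) (A B : Td -> Tk -> R) (beta K gam T : R) :
  regular U -> regular V -> 0 < T -> BD 2 beta (lift2 A) -> BD 2 beta (lift2 B) ->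
  state_continuous T (cost U V A B K gam).
Proof.
move=> rU rV T0 bA bB t s mu nu p t' s' mu' nu' p' ht hs ct cs cmu cnu cp.
rewrite /cost; apply: cvgD; first apply: cvgD; first apply: cvgD.
- exact: (energy_continuous rU rV T0 ht hs ct cs cmu cnu cp).
- apply: cvgMl_tmp; rewrite expr2; under eq_fun do rewrite expr2.
  by apply: cvgM; exact: cvgB.
- by apply: cvgMl_tmp; exact: cvgD.
- apply: cvgD; first exact: (pair_p_cvg (BD_regular bA) T0 ht ct cmu cmu cp).
  exact: (pair_p_cvg (BD_regular bB) T0 hs cs cnu cnu cp).
Qed.

Context (sigma sigma' : R) (hsigma : 0 < sigma) (hsigma' : 0 <= sigma').
Context (b : Tk -> 'rV[R]_k) (hb : smooth_field b).
Context (H : Td -> 'rV[R]_d -> R) (HC1 : C1_hamiltonian H)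
  (Hconvex : forall x, convex_function setT (H x)).
Context (f U0 : Td -> P -> Tk -> R) (fcont : continuous_xmp f)
  (fmono : forall p, monotone_fun (fun x m => f x m p))
  (U0mono : forall p, monotone_fun (fun x m => U0 x m p)).
Local Notation solution := (monotone_solution sigma sigma' b H f U0).
Implicit Types (U V : R -> Td -> P -> Tk -> R) (mu nu lam : P) (p : Tk).

Lemma energy_ge0 U V t mu nu p : solution U -> solution V -> 0 <= t ->
  0 <= energy U V t t mu nu p.
Proof.
move=> sU sV tge0; rewrite leNgt; apply/negP => neg.
have [BU iU _] := sU; have [BV iV _] := sV.
have rU := space_B't_regular BU; have rV := space_B't_regular BV.
have E0 mu' nu' p' : 0 <= energy U V 0 0 mu' nu' p'.
  rewrite /energy (_ : (fun x => _) = (fun x => U0 x mu' p' - U0 x nu' p')); first exact: U0mono.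
  by apply/funext => x; rewrite iU iV.
(* The negative value is [- 4 c]. At [(t, t, mu, nu, p)] the terms in [gam] cost at most [2 c] and
   those in [A], [B] at most [beta <= c / 2]; going back from the cost to the energy costs [beta]
   again, so the minimizer still has energy plus [K (t0 - s0)^2] at most [- c]. *)
pose c := - energy U V t t mu nu p / 4.
have c0 : 0 < c by rewrite /c; lra.
pose T := t + 1.
have T0 : 0 < T by rewrite /T; lra.
have tT : 0 <= t <= T by rewrite tge0 /T; lra.
pose gam := c / T.
have gam0 : 0 < gam by exact: divr_gt0.
have gamT : gam * T = c by rewrite /gam divfK// gt_eqF.
have [K K0 barrier] := energy_barrier rU rV T0 c0 E0.
have [M1 HM1] := space_B't_bound BU T0; have [M2 HM2] := space_B't_bound BV T0.
have [Bh HBh] := DpH_bounded HC1 (Num.max M1 M2).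
have [Bb HBb] := field_bounded hb.
pose C := d%:R * Bh + sigma * d%:R + k%:R * Bb + sigma' * k%:R.
(* The first bound keeps the minimum at a negative level; the second one gives [C * beta < gam], in
   contradiction with [doubled_minimum]. *)
pose beta := Num.min (c / 2) (gam / (`|C| + 1)).
have C1 : 0 < `|C| + 1 by rewrite ltr_wpDl.
have beta0 : 0 < beta by rewrite /beta lt_min; apply/andP; split; apply: divr_gt0.
have betac : beta <= c / 2 by rewrite ge_min lexx.
have betag : C * beta < gam.
  apply: (@le_lt_trans _ _ (`|C| * beta)); first by rewrite ler_wpM2r ?ler_norm// ltW.
  apply: (@lt_le_trans _ _ ((`|C| + 1) * beta)); first by rewrite ltr_pM2r// ltrDl.
  by rewrite mulrC -ler_pdivlMr// ge_min lexx orbT.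
have [e [e1 esep etest]] := test_family R d k.
pose Z := {z : (R * R) * (P * P * Tk) | 0 <= z.1.1 <= T /\ 0 <= z.1.2 <= T}.
pose W (z : Z) := let: (t, s, (mu, nu, p)) := sval z in
  energy U V t s mu nu p + K * (t - s) ^+ 2 + gam * (t + s).
have [s [s_ge0 cs sb Hs]] :=
  @perturbed_minimum R Z W (fun j z => e j (sval z).2) beta (fun j z => e1 j _) beta0.
have [A [B [bA bB AB HAB]]] := etest s s_ge0 cs.
have pert mu' nu' p' : `|pair_p (A^~ p') mu' + pair_p (B^~ p') nu'| <= beta.
  have := HAB 0%N ((mu', nu'), p'); rewrite /= seriesEnat /= !big_geq// !subr0 => h.
  exact: le_trans h sb.
have {}bA := BD_le sb bA; have {}bB := BD_le sb bB.
pose F t s mu nu p := cost U V A B K gam t s mu nu p.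
have cF : state_continuous T F by apply: cost_continuous; [..|exact: BDS (BDS bA)|exact: BDS (BDS bB)].
have [M HM] := energy_bounded rU rV T0.
have lowF t' s' mu' nu' p' : 0 <= t' <= T -> 0 <= s' <= T ->
    energy U V t' s' mu' nu' p' + K * (t' - s') ^+ 2 - beta <= F t' s' mu' nu' p'.
  move=> /andP[t'0 _] /andP[s'0 _]; have := pert mu' nu' p'.
  rewrite ler_norml => /andP[h _]; have := mulr_ge0 (ltW gam0) (addr_ge0 t'0 s'0).
  by rewrite /F /cost; lra.
have bF t' s' mu' nu' p' : 0 <= t' <= T -> 0 <= s' <= T -> - M - beta <= F t' s' mu' nu' p'.
  move=> ht hs; apply: le_trans (lowF _ _ _ _ _ ht hs).
  have := HM _ _ mu' nu' p' ht hs; rewrite ler_norml => /andP[h _].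
  by have := mulr_ge0 (ltW K0) (sqr_ge0 (t' - s')); lra.
have [t0 [s0 [mu0 [nu0 [p0 [ht0 hs0 Fmin]]]]]] := state_minimum cF bF mu nu p tT tT.
have low0 : energy U V t0 s0 mu0 nu0 p0 + K * (t0 - s0) ^+ 2 <= - c.
  have := lowF _ _ mu0 nu0 p0 ht0 hs0; have := Fmin t t mu nu p tT tT.
  have := pert mu nu p; rewrite ler_norml => /andP[_ h].
  have : gam * t <= c.
    by have /andP[_ tT'] := tT; rewrite -gamT; exact: ler_wpM2l (ltW gam0) _ _ tT'.
  have e4 : energy U V t t mu nu p = - (4 * c) by rewrite /c; field.
  by rewrite {2}/F /cost subrr expr0n /= mulr0 e4; lra.
have [t0pos s0pos] := barrier _ _ _ _ _ ht0 hs0 low0.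
have ne0 : ~ pmeas_eq mu0 nu0.
  move=> E; have e0 := @energy_pmeas_eq R d k U V t0 s0 mu0 nu0 p0 rU rV (ltW t0pos) (ltW s0pos) E.
  rewrite e0 in low0; by have := mulr_ge0 (ltW K0) (sqr_ge0 (t0 - s0)); lra.
have Hgrad (u : Td -> Tk -> R) q x :
    (forall a x p, `|dd a u x p| <= Num.max M1 M2) -> forall i, `|DpH H x (gradx u q x) 0 i| <= Bh.
  by move=> hu i; apply: HBh => j; rewrite mxE; exact: hu.
suff : gam <= C * beta by rewrite leNgt betag.
apply: (@doubled_minimum R d k sigma sigma' hsigma hsigma' b H HC1 Hconvex f U0 fcont fmono
  U V A B K gam beta Bb Bh T t0 s0 mu0 nu0 p0) => //.
- by rewrite t0pos; have /andP[] := ht0.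
- by rewrite s0pos; have /andP[] := hs0.
- move=> x; apply: Hgrad => a y q; rewrite le_max.
  by have [_ h _] := HM1 t0 mu0 ht0; rewrite h.
- move=> x; apply: Hgrad => a y q; rewrite le_max.
  by have [_ h _] := HM2 s0 nu0 hs0; rewrite h orbT.
(* Were the minimum not strict, both squares would vanish and the second point would minimize [F] as
   well; the test functionals would then agree at the two points up to [1 / (j + 1)], which forces
   the same measures and parameter. *)
move=> t' s' mu' nu' p' ht' hs' nz; rewrite ltNge; apply/negP => le.
have := Fmin t' s' mu' nu' p' ht' hs'; rewrite /F => ge.
have sq1 := sqr_ge0 (t' - t0); have sq2 := sqr_ge0 (s' - s0).
have t'E : t' = t0.
  by apply/eqP; rewrite -subr_eq0 -sqrf_eq0 eq_le sq1 andbT; lra.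
have s'E : s' = s0.
  by apply/eqP; rewrite -subr_eq0 -sqrf_eq0 eq_le sq2 andbT; lra.
have cE : F t' s' mu' nu' p' <= F t0 s0 mu0 nu0 p0 by rewrite /F; lra.
pose z0 : Z := exist _ ((t0, s0), ((mu0, nu0), p0)) (conj ht0 hs0).
pose z1 : Z := exist _ ((t', s'), ((mu', nu'), p')) (conj ht' hs').
pose Winf (z : Z) := let: (t, s, (mu, nu, p)) := sval z in F t s mu nu p.
have Wlim n (z : Z) : `|Winf z - (W z + \sum_(0 <= j < n) s j * e j (sval z).2)| <=
    limn (series s) - series s n.
  case: z => [[[t1 s1] [[mu1 nu1] p1]] hz]; rewrite /Winf /W /F /cost /=.
  by rewrite opprD addrACA subrr add0r; exact: (HAB n ((mu1, nu1), p1)).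
have m0 y : Winf z0 <= Winf y.
  by case: y => [[[t1 s1] [[mu1 nu1] p1]] [h1 h2]]; exact: Fmin.
have m1 y : Winf z1 <= Winf y by exact: le_trans cE (m0 y).
have [E1 E2 E3] := esep ((mu0, nu0), p0) ((mu', nu'), p') (Hs Winf Wlim z0 z1 m0 m1) ne0.
apply: nz; split; first by split=> // S mS; rewrite E1.
by split=> [S mS|//]; rewrite E2.
Qed.

Lemma pair_sub_ge0 U V t mu lam p : solution U -> solution V -> 0 <= t ->
  pair_p (fun x => U t x mu p - V t x mu p) lam <= pair_p (fun x => U t x mu p - V t x mu p) mu.
Proof.
move=> sU sV t0; have [BU _ _] := sU; have [BV _ _] := sV.
have rU := space_B't_regular BU; have rV := space_B't_regular BV.
have cU m : continuous (fun x => U t x m p) by exact: regular_slice.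
have cV m : continuous (fun x => V t x m p) by exact: regular_slice.
have hn (n : nat) : 0 <= (n.+1%:R^-1 : R) <= 1 by rewrite invr_ge0 ler0n invf_le1 ?ler1n.
pose nu n : P := mixture mu lam (hn n).
have key n : 0 <= (pair_p (fun x => U t x mu p) mu - pair_p (fun x => V t x (nu n) p) mu)
    - (pair_p (fun x => U t x mu p) lam - pair_p (fun x => V t x (nu n) p) lam).
  have := energy_ge0 mu (nu n) p sU sV t0; rewrite energyE// !pair_p_mixture//.
  have h0 : 0 < (n.+1%:R^-1 : R) by rewrite invr_gt0.
  (* With [h = 1 / (n + 1)], [mu - nu n = h (mu - lam)]: the energy is [h] times the bracket, and
     [h] is divided out. *)
  move=> Hk; rewrite -(pmulr_rge0 _ h0); apply: le_trans Hk _.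
  by rewrite le_eqVlt; apply/orP; left; apply/eqP; ring.
have z0 (j : nat) : `|0 : R| <= 0 by rewrite normr0.
(* A limit of the mixtures in the sense of [law_cvg] is obtained from compactness, then identified
   with [mu] through the functions [psi]. *)
have [phi [_ [_ [_ [nu' [p' [hphi [_ _ _ cnu cp]]]]]]]] :=
  @state_compact R d k 0 (fun=> 0) (fun=> 0) (fun=> mu) nu (fun=> p) z0 z0.
have cphi := subseq_infty hphi.
have Enu : pmeas_eq nu' mu.
  apply: pair_psi_eq => N r; have cpsi := @psi_continuous R d N r.
  have c1 : pair_p (psi N r) (nu (phi j)) @[j --> \oo] --> pair_p (psi N r) nu'.
    apply: (law_cvg_pair (M := 1) cnu) => //.
    - by move=> _ x; have /andP[? ?] := psi_itv N r x; rewrite ger0_norm.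
    - move=> tk t' ct.
      have cc : continuous_at t' (psi N r \o curve d).
        by apply: (@continuous_comp _ _ _ (curve d) (psi N r) t'); [exact: curve_continuous|exact: cpsi].
      exact: (cvg_comp _ _ ct cc).
  have ch : ((phi j).+1%:R^-1 : R) @[j --> \oo] --> 0.
    exact: (cvg_comp _ _ cphi (@cvg_harmonic R)).
  have c2 : pair_p (psi N r) (nu (phi j)) @[j --> \oo] -->
      (1 - 0) * pair_p (psi N r) mu + 0 * pair_p (psi N r) lam.
    under eq_fun do rewrite pair_p_mixture//.
    apply: cvgD; apply: cvgM; try exact: cvg_cst; last exact: ch.
    by apply: cvgB; [exact: cvg_cst|exact: ch].
  by rewrite (cvg_unique _ c1 c2) ?subr0 ?mul1r ?mul0r ?addr0//; exact: norm_hausdorff.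
have limV m : pair_p (fun x => V t x (nu (phi j)) p) m @[j --> \oo] -->
    pair_p (fun x => V t x mu p) m.
  rewrite (_ : (fun x => V t x mu p) = (fun x => V t x nu' p)); last first.
    by apply/funext => x; apply: txmp_pmeas_eq; [have [] := rV|exact: t0|move=> S mS; rewrite Enu].
  apply: (@pair_p_cvg R d k V (t + 1) (fun=> t) t (nu \o phi) nu' (fun=> m) m (fun=> p) p rV).
  - by rewrite ltr_wpDl.
  - by move=> _; apply/andP; split; [exact: t0|rewrite lerDl; exact: ler01].
  - exact: cvg_cst.
  - exact: cnu.
  - exact: law_cvg_cst.
  - by rewrite tdistxx; exact: cvg_cst.
rewrite -subr_ge0 !pair_pB//.
have cl : (pair_p (fun x => U t x mu p) mu - pair_p (fun x => V t x (nu (phi j)) p) mu)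
    - (pair_p (fun x => U t x mu p) lam - pair_p (fun x => V t x (nu (phi j)) p) lam)
    @[j --> \oo] --> (pair_p (fun x => U t x mu p) mu - pair_p (fun x => V t x mu p) mu)
    - (pair_p (fun x => U t x mu p) lam - pair_p (fun x => V t x mu p) lam).
  by apply: cvgB; (apply: cvgB; [exact: cvg_cst|exact: limV]).
by apply: (cvgr_to_ge cl); apply: nearW => j; exact: key.
Qed.

End Uniqueness.

Theorem theorem5p2 (R : realType) (d k : nat) (hd : (1 < d)%N) (hk : (1 <= k)%N)
    (sigma sigma' : R) (hsigma : 0 < sigma) (hsigma' : 0 <= sigma')
    (b : torus R k -> 'rV[R]_k) (hb : smooth_field b)
    (H : torus R d -> 'rV[R]_d -> R) (HC1 : C1_hamiltonian H)
    (Hconvex : forall x, convex_function setT (H x))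
    (f U0 : torus R d -> pmeas R d -> torus R k -> R)
    (fcont : continuous_xmp f) (U0cont : continuous_xmp U0)
    (fmono : forall p, monotone_fun (fun x m => f x m p))
    (U0mono : forall p, monotone_fun (fun x m => U0 x m p)) :
  (forall U V : R -> torus R d -> pmeas R d -> torus R k -> R,
      monotone_solution sigma sigma' b H f U0 U ->
      monotone_solution sigma sigma' b H f U0 V ->
      exists c : R -> pmeas R d -> torus R k -> R,
        forall t x m p, 0 <= t -> U t x m p = V t x m p + c t m p) /\
  (forall U : R -> torus R d -> pmeas R d -> torus R k -> R,
      monotone_solution sigma sigma' b H f U0 U ->
      forall t p, 0 <= t -> monotone_fun (fun x m => U t x m p)).
Proof.
split=> [U V sU sV|U sU t p t0 mu nu]; last first.
  exact: (energy_ge0 hsigma hsigma' hb HC1 Hconvex fcont fmono U0mono mu nu p sU sU t0).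
(* The candidate is the mean of [U - V] against [m]; with [lam = \d_x] the two inequalities bound
   the value at [x] by this mean from above and from below. *)
exists (fun t m p => pair_p (fun x => U t x m p - V t x m p) m) => t x m p t0.
have [BU _ _] := sU; have [BV _ _] := sV.
have rU := space_B't_regular BU; have rV := space_B't_regular BV.
have cU : continuous (fun x => U t x m p) by exact: regular_slice.
have cV : continuous (fun x => V t x m p) by exact: regular_slice.
have le1 := pair_sub_ge0 hsigma hsigma' hb HC1 Hconvex fcont fmono U0mono m (\d_x) p sU sV t0.
have le2 := pair_sub_ge0 hsigma hsigma' hb HC1 Hconvex fcont fmono U0mono m (\d_x) p sV sU t0.
move: le1 le2; rewrite !pair_pB// !pair_p_dirac// => le1 le2.
lra.
Qed.
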